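(* Let $X$ be a computable Polish space, $\nu$ a computable Borel probability measure on $X$, and $(\mathscr F_n)$ an almost-full effective filtration equipped uniformly with Kurtz disintegrations $\rho^{(n)}$. Let $p\ge 1$ be a computable real. Then for $x\in X$ the following are equivalent: (1) $x\in\mathsf{SR}^\nu$; (2) $x\in\mathsf{KR}^\nu$ and $\lim_n\mathbb E_\nu[f\mid\mathscr F_n](x)=f(x)$ for every $L_p(\nu)$ Schnorr test $f$; (3) $x\in\mathsf{KR}^\nu$, $\lim_n\mathbb E_\nu[f\mid\mathscr F_n](x)$ exists for every $L_p(\nu)$ Schnorr test $f$, and $\lim_n\mathbb E_\nu[I_U\mid\mathscr F_n](x)=I_U(x)$ for every c.e. open $U$ with $\nu(U)$ a computable real; (4) $x\in\mathsf{KR}^\nu$ and $\lim_n\mathbb E_\nu[f\mid\mathscr F_n](x)$ exists for every $L_p(\nu)$ Schnorr test $f$. Here ''$\lim_n a_n=b$'' means the limit exists, is finite and equals $b$, and ''the limit exists'' means it exists and is finite.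
   Context: A computable Polish space is a Polish space $X$ with a distinguished dense sequence $x_0,x_1,\dots$ and a distinguished compatible complete metric $d$ such that $d(x_i,x_j)$ is a computable real uniformly in $i,j$. An open set is c.e. open if it equals $\bigcup_i B(x_{n(i)},r_i)$ for a computable function $n(\cdot)$ and a computable sequence of positive rationals $r_i$; complements of c.e. open sets are effectively closed. A function $f:X\to(-\infty,\infty]$ is lower semi-computable (lsc) if the sets $f^{-1}(q,\infty]$, $q\in\mathbb Q$, are uniformly c.e. open. A real is left-c.e. if its left Dedekind cut is a c.e. set of rationals. A Borel probability measure $\nu$ is computable if $\nu(U)$ is left-c.e. uniformly in (an index for) the c.e. open $U$. For computable $p\ge1$, an $L_p(\nu)$ Schnorr test is an lsc $f:X\to[0,\infty]$ with $\|f\|_p=(\int|f|^pd\nu)^{1/p}$ a computable real. $\mathsf{KR}^\nu$ is the set of points lying in every c.e. open set of $\nu$-measure 1; $\mathsf{SR}^\nu$ is the set of $x$ with $f(x)<\infty$ for every $L_1(\nu)$ Schnorr test $f$. A computable basis is a computable sequence of c.e. open sets such that every c.e. open set can be effectively written as a union of its members; a $\nu$-computable basis is a computable basis such that finite unions of members have uniformly computable $\nu$-measure and each member is uniformly paired with an effectively closed superset of the same $\nu$-measure. A sub-$\sigma$-algebra of the Borel sets is $\nu$-effective if it is generated by a computable sequence of (codes for) members of the algebra generated by a $\nu$-computable basis. An almost-full effective filtration is an increasing sequence $(\mathscr F_n)$ of $\sigma$-algebras, $\mathscr F_n$ generated by $\{A_{n,m}:m\ge0\}$, a sequence uniformly computable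 in $n,m$ of members of the algebra generated by a $\nu$-computable basis, together with a uniform procedure computing from a c.e. open $U$ a computable sequence $A_{n_i,m_i}$ with $U\cap\mathsf{KR}^\nu=\bigcup_iA_{n_i,m_i}\cap\mathsf{KR}^\nu$. For a countably generated $\sigma$-algebra $\mathscr F$, $[x]_{\mathscr F}$ is the set of points belonging to exactly the same members of $\mathscr F$ as $x$. $\mathcal M^+(X)$ is the set of finite nonnegative Borel measures on $X$; $\mathbb L_1(\nu)$ is the set of pointwise-defined Borel $f:X\to[-\infty,\infty]$ with $\int|f|d\nu<\infty$. For Borel measurable $\rho:X\to\mathcal M^+(X)$, $x\mapsto\rho_x$, set $\mathbb E_\nu[f\mid\mathscr F](x)=\int f\,d\rho_x$ (where defined). For a $\nu$-effective $\mathscr F$, $\rho$ is a Kurtz disintegration of $\mathscr F$ with respect to $\nu$ if: (a) for every $f\in\mathbb L_1(\nu)$, $\mathbb E_\nu[f\mid\mathscr F]$ is a version of the conditional expectation of $f$ given $\mathscr F$; (b) for all $x\in\mathsf{KR}^\nu$, $\rho_x(X)=1$ and $\rho_x([x]_{\mathscr F}\cap\mathsf{KR}^\nu)=1$; (c) for c.e. open $U$, $x\mapsto\rho_x(U)$ is lsc uniformly in $U$. ''Equipped uniformly with Kurtz disintegrations $\rho^{(n)}$'' means each $\rho^{(n)}$ is a Kurtz disintegration of $\mathscr F_n$, uniformly in $n$, and $\mathbb E_\nu[f\mid\mathscr F_n](x)=\int f\,d\rho^{(n)}_x$. *)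

(* Defs.v *)
From HB Require Import structures.
From Stdlib Require Cantor.
From mathcomp Require Import all_boot all_order all_algebra.
From mathcomp Require Import all_classical all_reals all_analysis.
From mathcomp Require Import measurable_realfun.

Set Implicit Arguments.
Unset Strict Implicit.
Unset Printing Implicit Defensive.

Import Order.TTheory GRing.Theory Num.Theory.
Import numFieldTopology.Exports.

Local Open Scope classical_set_scope.
Local Open Scope ring_scope.

Definition cpair (m n : nat) : nat := Cantor.to_nat (m, n).
Definition unpair (k : nat) : nat * nat := Cantor.of_nat k.

(** Unary programs over the pairing [cpair]. [Prec a b] maps [cpair z n] to the
    [n]-th iterate of the primitive recursion with parameter [z], base [a] and
    step [b]; [Mu a] maps [z] to the least [n] with [a (cpair z n) = 0],
    provided that [a] is defined on all earlier arguments. *)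
Inductive code : Type :=
| Zero | Succ | Fst | Snd
| Pair of code & code
| Comp of code & code
| Prec of code & code
| Mu of code.

Fixpoint eval (c : code) (x y : nat) : Prop :=
  match c with
  | Zero => y = 0%N
  | Succ => y = x.+1
  | Fst => y = (unpair x).1
  | Snd => y = (unpair x).2
  | Pair a b => exists u v, [/\ eval a x u, eval b x v & y = cpair u v]
  | Comp a b => exists2 u, eval b x u & eval a u y
  | Prec a b =>
      let z := (unpair x).1 in
      (fix iterate (n y : nat) : Prop :=
         match n with
         | 0%N => eval a z y
         | m.+1 => exists2 u, iterate m u & eval b (cpair z (cpair m u)) y
         end) (unpair x).2 y
  | Mu a => eval a (cpair x y) 0 /\
      forall m, (m < y)%N -> exists u, eval a (cpair x m) u.+1
  end.

Fixpoint godel (c : code) : nat :=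
  match c with
  | Zero => 0 | Succ => 1 | Fst => 2 | Snd => 3
  | Pair a b => (cpair (godel a) (godel b) * 4 + 4)%N
  | Comp a b => (cpair (godel a) (godel b) * 4 + 5)%N
  | Prec a b => (cpair (godel a) (godel b) * 4 + 6)%N
  | Mu a => (godel a * 4 + 7)%N
  end.

(** As [godel] is injective, [phi e] is the graph of a partial function. *)
Definition phi (e x y : nat) : Prop := exists2 c, godel c = e & eval c x y.

Definition computable (f : nat -> nat) : Prop :=
  exists c, forall x, eval c x (f x).

Definition ce (W : set nat) : Prop :=
  exists c, W = [set x | exists y, eval c x y].

(** The values of the [e]-th partial recursive function; arguments at which it
    is undefined contribute nothing, so that the empty set is enumerated. *)
Definition enumerated (e : nat) : set nat := [set y | exists x, phi e x y].

Definition rat_of_code (k : nat) : rat :=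
  let: (a, bc) := unpair k in let: (b, c) := unpair bc in
  (a%:R - b%:R) / c.+1%:R.

Definition posrat_of_code (k : nat) : rat :=
  let: (a, b) := unpair k in a.+1%:R / b.+1%:R.

Section reals.
Variable R : realType.

Definition computable_reals (a : nat -> R) : Prop :=
  exists2 h, computable h &
    forall n k, `|ratr (rat_of_code (h (cpair n k))) - a n| <= 2 ^- k.

Definition computable_real (a : R) : Prop := computable_reals (fun=> a).

(** In particular, [z] is finite. *)
Definition computable_ereal (z : \bar R) : Prop :=
  exists2 a : R, computable_real a & z = a%:E.

Definition left_ce_reals (a : nat -> \bar R) : Prop :=
  ce [set m | ((ratr (rat_of_code (unpair m).2) : R)%:E < a (unpair m).1)%E].

End reals.

HB.mixin Record isComputablePolish (R : realType) X
    & Metric R X & Complete X & isPointed X := {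
  ideal_point : nat -> X ;
  dense_ideal_point : dense (range ideal_point) ;
  computable_mdist : computable_reals
    (fun k => mdist (ideal_point (unpair k).1) (ideal_point (unpair k).2))
}.

#[short(type="computablePolishType")]
HB.structure Definition ComputablePolish (R : realType) :=
  { X of Metric R X & Complete X & isPointed X & isComputablePolish R X }.

Notation borel X := (g_sigma_algebraType (@open X)).

Section effective_topology.
Context {R : realType} {X : computablePolishType R}.

(** [ce_open e] is the union of the balls [B(x_i, r)] whose codes are enumerated
    by the [e]-th partial recursive function; [e] is the index of the set. *)
Definition ce_open (e : nat) : set X :=
  \bigcup_(k in enumerated e)
    ball (ideal_point (unpair k).1) (ratr (posrat_of_code (unpair k).2)).

Definition lsc (f : X -> \bar R) : Prop :=
  exists2 h, computable h & forall k,
    [set x | ((ratr (rat_of_code k) : R)%:E < f x)%E] = ce_open (h k).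

Definition uniformly_lsc (f : nat -> X -> \bar R) : Prop :=
  exists2 h, computable h & forall n k,
    [set x | ((ratr (rat_of_code k) : R)%:E < f n x)%E] =
    ce_open (h (cpair n k)).

Definition computable_basis (B : nat -> set X) : Prop :=
  (exists2 b, computable b & forall i, B i = ce_open (b i)) /\
  (exists2 g, computable g & forall e,
    ce_open e = \bigcup_(i in enumerated (g e)) B i).

Definition atom (F : set_system X) (x : X) : set X :=
  [set y | forall A, F A -> (A y <-> A x)].

End effective_topology.

(** Boolean expressions over a sequence [B] of sets: codes for the members of the
    algebra that it generates. *)
Inductive bexp : Type :=
| Basic of nat
| Compl of bexp
| Union of bexp & bexp.

Fixpoint bexp_code (t : bexp) : nat :=
  match t with
  | Basic i => (i * 3)%N
  | Compl a => (bexp_code a * 3 + 1)%N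
  | Union a b => (cpair (bexp_code a) (bexp_code b) * 3 + 2)%N
  end.

Fixpoint bexp_set {T : Type} (B : nat -> set T) (t : bexp) : set T :=
  match t with
  | Basic i => B i
  | Compl a => ~` bexp_set B a
  | Union a b => bexp_set B a `|` bexp_set B b
  end.

Fixpoint seq_code (s : seq nat) : nat :=
  if s is i :: s' then (cpair i (seq_code s')).+1 else 0%N.

Section effective_measure.
Context {R : realType} {X : computablePolishType R}.
Variable nu : probability (borel X) R.

Definition computable_measure : Prop :=
  left_ce_reals (fun e => nu (ce_open e)).

Definition measure_computable_basis (B : nat -> set X) : Prop :=
  [/\ computable_basis B,
      exists2 a : nat -> R, computable_reals a & forall s : seq nat,
        nu (\bigcup_(i in [set` s]) B i) = (a (seq_code s))%:E &
      exists2 c, computable c & forall i,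
        B i `<=` ~` ce_open (c i) /\ nu (~` ce_open (c i)) = nu (B i)].

Definition schnorr_test (p : R) (f : X -> \bar R) : Prop :=
  [/\ forall x, (0 <= f x)%E, lsc f &
      computable_ereal (Lnorm nu p%:E (f : borel X -> \bar R))].

Definition KR : set X := [set x | forall e, nu (ce_open e) = 1%E -> ce_open e x].

Definition SR : set X := [set x | forall f, schnorr_test 1 f -> (f x < +oo)%E].

Definition almost_full_effective_filtration (F : nat -> set_system X) : Prop :=
  (forall n, F n `<=` F n.+1) /\
  exists (B : nat -> set X) (t : nat -> nat -> bexp),
  let A n m := bexp_set B (t n m) in
  [/\ measure_computable_basis B,
      computable (fun k => bexp_code (t (unpair k).1 (unpair k).2)),
      forall n, F n = <<s range (A n) >> &
      exists2 g, computable g & forall e,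
        ce_open e `&` KR =
        (\bigcup_(k in enumerated (g e)) A (unpair k).1 (unpair k).2) `&` KR].

Definition condexp_version (F : set_system X) (f g : borel X -> \bar R) : Prop :=
  [/\ forall Y : set (\bar R), measurable Y -> F (g @^-1` Y),
      nu.-integrable setT g &
      forall A, F A -> (\int[nu]_(x in A) g x = \int[nu]_(x in A) f x)%E].

(** Every finite kernel is s-finite, so [R.-ftker] consists of all the Borel maps
    to finite measures (for the sigma-algebra generated by the evaluations
    [mu |-> mu A]), without a uniform bound on the masses. Where the integral
    is undefined, its value is the library's convention [+oo - oo = -oo]. *)
Definition disint_exp (rho : R.-ftker borel X ~> borel X)
    (f : borel X -> \bar R) (x : X) : \bar R :=
  (\int[rho x]_y f y)%E.

(** The last condition is lower semi-computability of [x |-> rho n x U] uniformly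
    in the pair of [n] and an index of [U]. *)
Definition uniform_kurtz_disintegrations (F : nat -> set_system X)
    (rho : nat -> R.-ftker borel X ~> borel X) : Prop :=
  [/\ forall n (f : borel X -> \bar R), nu.-integrable setT f ->
        condexp_version (F n) f (disint_exp (rho n) f),
      forall n x, KR x ->
        rho n x setT = 1%E /\ rho n x (atom (F n) x `&` KR) = 1%E &
      uniformly_lsc
        (fun m x => rho (unpair m).1 x (ce_open (unpair m).2))].

End effective_measure.

(* Main.v *)
(* (1) => (2): let [f] be an L_p test, [g = f^p]. By almost fullness [g] is on [KR] a
   supremum of simple functions [s_m], where [s_m] is constant on the atoms of [F n] for
   large [n]. A computable sequence [m_i] satisfies [int (g - s_(m_i)) <= 4^-i], and for
   [d_i = (s_(m_(i+1)) - s_(m_i))^+] the functions [sup_n E(d_i | F_n)] reduce to finite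
   maxima, which are computable on [KR]. By Doob's maximal inequality their excesses over
   [2^-i] sum to a Schnorr test, so at a Schnorr random point [E(g - s_(m_i) | F_n)] is
   O(2^-i) uniformly in [n]. The elementary bound [f <= t + eps + eps^(1-p) (g - s)], with
   [t = s^(1/p)], transfers this to [f], while lower semi-computability gives
   [liminf E(f | F_n)(x) >= f(x)].
   (4) => (1): if [g(x) = oo] for an L_1 test [g], then [f = g^(1/p)] is an L_p test, and
   [E(f | F_n)(x)] tends to infinity by almost fullness.
   Powers are effective because [b^p] is compared with rationals through rational
   exponents close to [p].
   The implication (2) => (3) factors through (1), applied to the L_1 test [I_U]. *)
Require Import Defs.
From mathcomp Require Import all_boot all_order all_algebra.
From mathcomp Require Import all_classical all_reals all_analysis.
From mathcomp Require Import measurable_realfun.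
From mathcomp Require Import zify ring lra.
From Stdlib Require Cantor.

Set Implicit Arguments.
Unset Strict Implicit.
Unset Printing Implicit Defensive.

Import Order.TTheory GRing.Theory Num.Theory.
Import numFieldTopology.Exports.

Local Open Scope classical_set_scope.
Local Open Scope ring_scope.
(* [all_analysis] shadows [Defs.eval]. *)
Local Notation eval := Defs.eval.
Arguments cpair : simpl never.
Arguments unpair : simpl never.

(** * Computable functions *)

Section computability.
Local Open Scope nat_scope.

(** Every computability claim is reduced to cuts: a real, an integral or a value at a point is
    handled through the rationals below or above it. Such a set of rationals is c.e. as a projection
    of a decidable relation; Kleene's T predicate supplies these relations for the indices [e], and
    the s-m-n theorem leads back to indices. The sets that generate the filtration are in general
    neither open nor closed, so c.e. openness is only claimed relative to a set [K], mostly [KR].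
    The complement of [KR] is null for [nu], and for [rho n x] when [x] is in [KR], so integrals do
    not see it; a function is extended from [K] to [X] only to obtain a genuine Schnorr test. The
    obstacle is that a Schnorr test needs a computable integral, while c.e. data give lower bounds
    only. Hence indicators are replaced by functions with values in [[0, 1]] that are lower
    semi-computable together with their complement to 1: lower bounds of the integral of the
    complement are upper bounds of the integral itself. *)

Lemma unpairK m n : unpair (cpair m n) = (m, n).
Proof. exact: Cantor.cancel_of_to. Qed.

Lemma cpairK k : cpair (unpair k).1 (unpair k).2 = k.
Proof. by rewrite /cpair /unpair -surjective_pairing Cantor.cancel_to_of. Qed.

Lemma unpair_leq k : (unpair k).1 <= k /\ (unpair k).2 <= k.
Proof.
have := Cantor.to_nat_non_decreasing (unpair k).1 (unpair k).2.
rewrite -/(cpair _ _) cpairK; lia.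
Qed.

Lemma cpair_geq m n : m <= cpair m n /\ n <= cpair m n.
Proof. by have := unpair_leq (cpair m n); rewrite unpairK. Qed.

Lemma eval_fun c x y y' : eval c x y -> eval c x y' -> y = y'.
Proof.
elim: c x y y' => /=.
- by move=> x y y' -> ->.
- by move=> x y y' -> ->.
- by move=> x y y' -> ->.
- by move=> x y y' -> ->.
- move=> a IHa b IHb x y y' [u [v [hu hv ->]]] [u' [v' [hu' hv' ->]]].
  by rewrite (IHa _ _ _ hu hu') (IHb _ _ _ hv hv').
- move=> a IHa b IHb x y y' [u hu hy] [u' hu' hy'].
  by rewrite (IHb _ _ _ hu hu') in hy; apply: IHa hy hy'.
- move=> a IHa b IHb x; elim: (unpair x).2 => [|m IHm] y y'; first exact: IHa.
  by move=> [u hu hy] [u' hu' hy']; rewrite (IHm _ _ hu hu') in hy; apply: IHb hy hy'.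
- move=> a IHa x y y' [h0 hm] [h0' hm'].
  case: (ltngtP y y') => // lt.
    by have [u hu] := hm' _ lt; have := IHa _ _ _ h0 hu.
  by have [u hu] := hm _ lt; have := IHa _ _ _ h0' hu.
Qed.

Lemma comp_ext f g : f =1 g -> computable f -> computable g.
Proof. by move=> fg [c hc]; exists c => x; rewrite -fg. Qed.

Lemma comp_id : computable (fun z => z).
Proof.
exists (Pair Fst Snd) => x /=.
by exists (unpair x).1, (unpair x).2; split => //; rewrite cpairK.
Qed.

Lemma comp_comp f g : computable f -> computable g -> computable (fun z => f (g z)).
Proof.
by move=> [a ha] [b hb]; exists (Comp a b) => x /=; exists (g x).
Qed.

Lemma comp_S f : computable f -> computable (fun z => (f z).+1).
Proof. by apply: comp_comp; exists Succ. Qed.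

Lemma comp_const n : computable (fun=> n).
Proof. by elim: n => [|n IH]; [exists Zero | apply: comp_S]. Qed.

Lemma comp_fst f : computable f -> computable (fun z => (unpair (f z)).1).
Proof. by apply: (@comp_comp (fun z => (unpair z).1)); exists Fst. Qed.

Lemma comp_snd f : computable f -> computable (fun z => (unpair (f z)).2).
Proof. by apply: (@comp_comp (fun z => (unpair z).2)); exists Snd. Qed.

Lemma comp_pair f g : computable f -> computable g ->
  computable (fun z => cpair (f z) (g z)).
Proof.
by move=> [a ha] [b hb]; exists (Pair a b) => x /=; exists (f x), (g x).
Qed.

Lemma comp2 (F : nat -> nat -> nat) f g :
  computable (fun z => F (unpair z).1 (unpair z).2) ->
  computable f -> computable g -> computable (fun z => F (f z) (g z)).
Proof.
move=> hF hf hg; have := comp_comp hF (comp_pair hf hg).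
by apply: comp_ext => z; rewrite unpairK.
Qed.

(** This is [Prec] with parameter [z], proved for an arbitrary bound in the second component and
    then specialised by composition with [cpair z (n z)]. All the arithmetic below is built from
    it. *)
Lemma comp_iteri (s : nat -> nat -> nat -> nat) f n :
  computable (fun z => s (unpair z).1 (unpair (unpair z).2).1
    (unpair (unpair z).2).2) ->
  computable f -> computable n ->
  computable (fun z => iteri (n z) (s z) (f z)).
Proof.
move=> [b hb] [a ha] hn.
suff : computable (fun w => iteri (unpair w).2 (s (unpair w).1) (f (unpair w).1)).
  by move=> /comp_comp/(_ (comp_pair comp_id hn)); apply: comp_ext => z; rewrite unpairK.
exists (Prec a b) => w /=; elim: (unpair w).2 => [|m IH] /=; first exact: ha.
eexists; first exact: IH.
have := hb (cpair (unpair w).1 (cpair m (iteri m (s (unpair w).1) (f (unpair w).1)))).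
by rewrite !unpairK.
Qed.

Lemma comp_pred f : computable f -> computable (fun z => (f z).-1).
Proof.
move=> hf; apply: (@comp_ext (fun z => iteri (f z) (fun m _ => m) 0)).
  by move=> z; case: (f z).
apply: comp_iteri => //; [exact/comp_fst/comp_snd/comp_id | exact: comp_const].
Qed.

Lemma comp_add f g : computable f -> computable g -> computable (fun z => f z + g z).
Proof.
move=> hf hg; apply: (@comp_ext (fun z => iteri (g z) (fun _ u => u.+1) (f z))).
  by move=> z; elim: (g z) => [|n IH] /=; rewrite ?addn0 // IH addnS.
by apply: comp_iteri => //; exact/comp_S/comp_snd/comp_snd/comp_id.
Qed.

Lemma comp_sub f g : computable f -> computable g -> computable (fun z => f z - g z).
Proof.
move=> hf hg; apply: (@comp_ext (fun z => iteri (g z) (fun _ u => u.-1) (f z))).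
  by move=> z; elim: (g z) => [|n IH] /=; rewrite ?subn0 // IH subnS.
by apply: comp_iteri => //; exact/comp_pred/comp_snd/comp_snd/comp_id.
Qed.

Lemma comp_mul f g : computable f -> computable g -> computable (fun z => f z * g z).
Proof.
move=> hf hg; apply: (@comp_ext (fun z => iteri (g z) (fun _ u => u + f z) 0)).
  by move=> z; elim: (g z) => [|n IH] /=; rewrite ?muln0 // IH mulnS addnC.
apply: comp_iteri => //; last exact: comp_const.
apply: comp_add; first exact/comp_snd/comp_snd/comp_id.
by apply: comp_comp hf _; exact/comp_fst/comp_id.
Qed.

Definition dec (P : nat -> bool) := computable (fun z => P z : nat).

Lemma dec_ext P Q : P =1 Q -> dec P -> dec Q.
Proof. by move=> PQ; apply: comp_ext => z; rewrite PQ. Qed.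

Lemma dec_comp P f : dec P -> computable f -> dec (fun z => P (f z)).
Proof. exact: comp_comp. Qed.

Lemma dec2 (P : nat -> nat -> bool) f g :
  dec (fun z => P (unpair z).1 (unpair z).2) ->
  computable f -> computable g -> dec (fun z => P (f z) (g z)).
Proof. exact: (@comp2 (fun x y => P x y : nat)). Qed.

Lemma dec_const b : dec (fun=> b).
Proof. exact: comp_const. Qed.

Lemma dec_leq f g : computable f -> computable g -> dec (fun z => f z <= g z).
Proof.
move=> hf hg; apply: (@comp_ext (fun z => 1 - (f z - g z))); first by move=> z; lia.
by apply: comp_sub; [exact: comp_const | exact: comp_sub].
Qed.

Lemma dec_neg P : dec P -> dec (fun z => ~~ P z).
Proof.
move=> hP; apply: (@comp_ext (fun z => 1 - P z)); first by move=> z; case: (P z).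
by apply: comp_sub => //; exact: comp_const.
Qed.

Lemma dec_and P Q : dec P -> dec Q -> dec (fun z => P z && Q z).
Proof.
move=> hP hQ; apply: (@comp_ext (fun z => P z * Q z)); last exact: comp_mul.
by move=> z; rewrite mulnb.
Qed.

Lemma dec_or P Q : dec P -> dec Q -> dec (fun z => P z || Q z).
Proof.
move=> hP hQ; apply: (@dec_ext (fun z => ~~ (~~ P z && ~~ Q z))).
  by move=> z; rewrite negb_and !negbK.
by apply: dec_neg; apply: dec_and; exact: dec_neg.
Qed.

Lemma dec_eq f g : computable f -> computable g -> dec (fun z => f z == g z).
Proof.
move=> hf hg; apply: (@dec_ext (fun z => (f z <= g z) && (g z <= f z))).
  by move=> z; rewrite eqn_leq.
by apply: dec_and; exact: dec_leq.
Qed.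

Lemma dec_eqb P Q : dec P -> dec Q -> dec (fun z => P z == Q z).
Proof.
move=> hP hQ; apply: (@dec_ext (fun z => (P z && Q z) || (~~ P z && ~~ Q z))).
  by move=> z; case: (P z); case: (Q z).
by apply: dec_or; apply: dec_and => //; exact: dec_neg.
Qed.

Lemma comp_if P f g : dec P -> computable f -> computable g ->
  computable (fun z => if P z then f z else g z).
Proof.
move=> hP hf hg; apply: (@comp_ext (fun z => P z * f z + (~~ P z) * g z)).
  by move=> z; case: (P z); rewrite ?mul0n ?mul1n ?addn0.
apply: comp_add; apply: comp_mul => //; exact: dec_neg.
Qed.

Lemma dec_if P Q Q' : dec P -> dec Q -> dec Q' ->
  dec (fun z => if P z then Q z else Q' z).
Proof.
move=> hP hQ hQ'; apply: (@comp_ext (fun z => if P z then Q z : nat else Q' z)).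
  by move=> z; case: (P z).
exact: comp_if.
Qed.

Lemma dec_all (P : nat -> nat -> bool) n :
  dec (fun z => P (unpair z).1 (unpair z).2) -> computable n ->
  dec (fun z => all (P z) (iota 0 (n z))).
Proof.
move=> hP hn.
apply: (@comp_ext (fun z => iteri (n z) (fun m u => u * P z m) 1)).
  move=> z; elim: (n z) => [//|m IH].
  by rewrite -[m.+1]addn1 iotaD all_cat /= andbT addn1 /= IH mulnb.
apply: comp_iteri => //; last exact: comp_const.
apply: comp_mul; first exact/comp_snd/comp_snd/comp_id.
apply: (dec2 hP); first exact/comp_fst/comp_id.
exact/comp_fst/comp_snd/comp_id.
Qed.

Lemma dec_has (P : nat -> nat -> bool) n :
  dec (fun z => P (unpair z).1 (unpair z).2) -> computable n ->
  dec (fun z => has (P z) (iota 0 (n z))).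
Proof.
move=> hP hn; apply: (@dec_ext (fun z => ~~ all (fun k => ~~ P z k) (iota 0 (n z)))).
  by move=> z; rewrite -has_predC; apply: eq_has => k /=; rewrite negbK.
by apply: dec_neg; apply: (@dec_all (fun z k => ~~ P z k)) => //; exact: dec_neg.
Qed.

(** [Mu] seeks a zero, so it is applied to the negation of [P]; the existence of a solution for
    every [z] makes the search total. *)
Lemma comp_search (P : nat -> nat -> bool) :
  dec (fun z => P (unpair z).1 (unpair z).2) -> (forall z, exists k, P z k) ->
  exists2 h, computable h & forall z, P z (h z).
Proof.
move=> hP ex; exists (fun z => ex_minn (ex z)); last first.
  by move=> z; case: ex_minnP.
have [c hc] := dec_neg hP; exists (Mu c) => z /=.
case: ex_minnP => n Pn nmin; split.
  by have := hc (cpair z n); rewrite unpairK /= Pn.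
move=> m mn; exists 0; have := hc (cpair z m); rewrite unpairK /=.
suff -> : P z m = false by [].
by apply/negP => /nmin; rewrite leqNgt mn.
Qed.

(** The value is found by search in the graph. This gives division, whose graph is described by two
    inequalities. *)
Lemma comp_graph f : dec (fun z => f (unpair z).1 == (unpair z).2) -> computable f.
Proof.
move=> hf; have [|h ch hh] := @comp_search (fun z k => f z == k) hf.
  by move=> z; exists (f z).
by apply: comp_ext ch => z; rewrite (eqP (hh z)).
Qed.

End computability.

Ltac comp_step :=
  match goal with
  | H : computable ?h |- computable ?h => exact H
  | H : dec ?h |- dec ?h => exact H
  | |- computable (fun _ => ?n) => exact: comp_const
  | |- dec (fun _ => ?n) => exact: dec_const
  | |- computable (fun z => z) => exact: comp_id
  | |- computable (fun _ => if _ then _ else _) => apply: comp_if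
  | |- dec (fun _ => if _ then _ else _) => apply: dec_if
  | |- computable (fun z => (unpair _).1) => apply: comp_fst
  | |- computable (fun z => (unpair _).2) => apply: comp_snd
  | |- computable (fun z => cpair _ _) => apply: comp_pair
  | |- computable (cpair ?a) => apply: (@comp_pair (fun=> a) (fun z => z))
  | |- computable (fun z => addn _ _) => apply: comp_add
  | |- computable (fun z => subn _ _) => apply: comp_sub
  | |- computable (fun z => muln _ _) => apply: comp_mul
  | |- computable (fun z => _.-1) => apply: comp_pred
  | |- computable (fun z => _.+1) => apply: comp_S
  | |- dec (fun z => _ && _) => apply: dec_and
  | |- dec (fun z => _ || _) => apply: dec_or
  | |- dec (fun z => ~~ _) => apply: dec_neg
  | |- dec (fun z => leq _ _) => apply: dec_leq
  | |- dec (fun z => _ == _) => first [apply: dec_eq | apply: dec_eqb]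
  | |- dec (fun z => all (fun k => _) (iota 0 _)) => apply: dec_all
  | |- dec (fun z => has (fun k => _) (iota 0 _)) => apply: dec_has
  | H : computable ?h |- computable (fun z => ?h _) => apply: (comp_comp H)
  | H : dec ?h |- dec (fun z => ?h _) => apply: (dec_comp H)
  | H : computable (fun z => ?F (unpair z).1 (unpair z).2) |- computable (fun z => ?F _ _) => apply: (comp2 H)
  | H : dec (fun z => ?F (unpair z).1 (unpair z).2) |- dec (fun z => ?F _ _) => apply: (dec2 H)
  end.
(* Extended by [::=] once more closure lemmas are available. *)
Ltac comp_extra := fail.
Ltac comp := repeat (first [comp_step | comp_extra]).

Section computability2.
Local Open Scope nat_scope.

Lemma comp_div f d : computable f -> computable (fun z => f z %/ d.+1).
Proof.
move=> hf; apply: (@comp_comp (fun m => m %/ d.+1)) => //; apply: comp_graph.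
apply: (@dec_ext (fun z => ((unpair z).2 * d.+1 <= (unpair z).1) &&
   ((unpair z).1 < ((unpair z).2).+1 * d.+1))); last by comp.
move=> z; move: (unpair z).1 (unpair z).2 => m q.
by apply/idP/eqP => [|<-]; [nia | rewrite leq_divM /= ltn_ceil].
Qed.

Lemma comp_mod f d : computable f -> computable (fun z => f z %% d.+1).
Proof.
move=> hf; apply: (@comp_ext (fun z => f z - f z %/ d.+1 * d.+1)).
  by move=> z; rewrite {1}(divn_eq (f z) d.+1) addKn.
by have := comp_div d hf => ?; comp.
Qed.

Lemma comp_exp2 f : computable f -> computable (fun z => 2 ^ f z).
Proof.
move=> hf; apply: (@comp_ext (fun z => iteri (f z) (fun _ u => 2 * u) 1)).
  by move=> z; elim: (f z) => //= n ->; rewrite expnS.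
by apply: comp_iteri; comp.
Qed.

(** Every [w] codes an infinite sequence, so no length has to be checked. As every finite sequence
    occurs as a prefix, finitely many witnesses can be merged into one number. *)
Definition nthc (w i : nat) : nat := (unpair (iter i (fun v => (unpair v).2) w)).1.

Lemma comp_nthc f g : computable f -> computable g -> computable (fun z => nthc (f z) (g z)).
Proof.
move=> hf hg; apply: comp_fst.
apply: (@comp_ext (fun z => iteri (g z) (fun _ v => (unpair v).2) (f z))).
  by move=> z; elim: (g z) => //= n ->.
by apply: comp_iteri => //; comp.
Qed.

Lemma nthc_ex (s : nat -> nat) n : exists w, forall i, i < n -> nthc w i = s i.
Proof.
elim: n s => [|n IH] s; first by exists 0.
have [w hw] := IH (fun i => s i.+1); exists (cpair (s 0) w) => -[|i] lt.
  by rewrite /nthc /= unpairK.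
by rewrite -hw // /nthc iterSr unpairK.
Qed.

End computability2.

Ltac comp_extra ::=
  match goal with
  | |- computable (fun z => expn 2 _) => apply: comp_exp2
  | |- computable (fun z => nthc _ _) => apply: comp_nthc
  | |- computable (fun z => divn _ _) => apply: comp_div
  | |- computable (fun z => modn _ _) => apply: comp_mod
  end.

(** * Universality and c.e. predicates *)

Section universal.
Local Open Scope nat_scope.

Lemma allsP (P : nat -> bool) n : reflect (forall i, i < n -> P i) (all P (iota 0 n)).
Proof.
apply: (iffP allP) => h i; first by move=> lt; apply: h; rewrite mem_iota.
by rewrite mem_iota => /h.
Qed.

Lemma hassP (P : nat -> bool) n : reflect (exists2 i, i < n & P i) (has P (iota 0 n)).
Proof.
by apply: (iffP hasP) => -[i]; [rewrite mem_iota | move=> lt]; exists i => //; rewrite mem_iota.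
Qed.

Let tr e x y := cpair e (cpair x y).
Let res t := (unpair (unpair t).2).2.

(* The [i]-th triple (program, input, output) of [s] follows from earlier ones by
   one clause of [eval]. *)
Definition justified (s : nat -> nat) (i : nat) : bool :=
  let e := (unpair (s i)).1 in let x := (unpair (unpair (s i)).2).1 in
  let y := (unpair (unpair (s i)).2).2 in
  let c := (e - 4) %/ 4 in let r := (e - 4) %% 4 in
  let a := (unpair c).1 in let b := (unpair c).2 in
  if e == 0 then y == 0 else if e == 1 then y == x.+1
  else if e == 2 then y == (unpair x).1 else if e == 3 then y == (unpair x).2
  else if r == 0 then
    has (fun j => has (fun k => [&& s j == tr a x (res (s j)),
      s k == tr b x (res (s k)) & y == cpair (res (s j)) (res (s k))]) (iota 0 i)) (iota 0 i)
  else if r == 1 then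
    has (fun j => has (fun k => (s j == tr b x (res (s j))) &&
      (s k == tr a (res (s j)) y)) (iota 0 i)) (iota 0 i)
  else if r == 2 then
    if (unpair x).2 == 0 then has (fun j => s j == tr a (unpair x).1 y) (iota 0 i)
    else has (fun j => has (fun k =>
      (s j == tr e (cpair (unpair x).1 (unpair x).2.-1) (res (s j))) &&
      (s k == tr b (cpair (unpair x).1 (cpair (unpair x).2.-1 (res (s j)))) y))
      (iota 0 i)) (iota 0 i)
  else has (fun j => s j == tr c (cpair x y) 0) (iota 0 i) &&
    all (fun m => has (fun j => (s j == tr c (cpair x m) (res (s j))) &&
      (0 < res (s j))) (iota 0 i)) (iota 0 y).

Definition justified_code (w : nat) := justified (nthc w).

Lemma dec_justified : dec (fun z => justified_code (unpair z).1 (unpair z).2).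
Proof. by rewrite /justified_code /justified /tr /res; comp. Qed.

Lemma justified_sound s i : (forall j, j <= i -> justified s j) ->
  forall c, godel c = (unpair (s i)).1 ->
  eval c (unpair (unpair (s i)).2).1 (res (s i)).
Proof.
elim/ltn_ind: i => i IH hj.
have sub j c x y : j < i -> s j = tr (godel c) x y -> eval c x y.
  move=> ji sj; have := IH j ji _ c; rewrite /res sj /tr !unpairK; apply => //.
  by move=> k kj; apply: hj; lia.
have := hj i (leqnn i); rewrite /justified /res.
case: (unpair (s i)) => e xy /=; case: (unpair xy) => x y /= J c ec.
(* A compound program has a number of the form [n * 4 + (r + 4)], where [r < 4] tells the
   constructor and [n] codes the arguments; these are the tests that [justified] performs on it. *)
have gcase n r : r < 4 -> [/\ (n * 4 + (r + 4) == 0) = false,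
    (n * 4 + (r + 4) == 1) = false, (n * 4 + (r + 4) == 2) = false &
    [/\ (n * 4 + (r + 4) == 3) = false, (n * 4 + (r + 4) - 4) %/ 4 = n &
     (n * 4 + (r + 4) - 4) %% 4 = r]] by move=> r4; split; [lia..|split; lia].
case: c ec J; try by move=> <- /= /eqP.
- move=> a b <-; have [//|/= -> -> -> [-> -> ->]] := gcase (cpair (godel a) (godel b)) 0.
  rewrite ?unpairK /=.
  move=> /hassP[j ji /hassP[k ki /and3P[/eqP sj /eqP sk /eqP ->]]].
  by exists (res (s j)), (res (s k)); split => //; [exact: sub sj | exact: sub sk].
- move=> a b <-; have [//|/= -> -> -> [-> -> ->]] := gcase (cpair (godel a) (godel b)) 1.
  rewrite ?unpairK /=.
  move=> /hassP[j ji /hassP[k ki /andP[/eqP sj /eqP sk]]].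
  by exists (res (s j)); [exact: sub sj | exact: sub sk].
- move=> a b <-; have [//|/= -> -> -> [-> -> ->]] := gcase (cpair (godel a) (godel b)) 2.
  rewrite ?unpairK /=.
  case: (unpair x) => z [|m] /=.
    by move=> /hassP[j ji /eqP sj]; exact: sub sj.
  move=> /hassP[j ji /hassP[k ki /andP[/eqP sj /eqP sk]]].
  exists (res (s j)); last exact: sub sk.
  by have /= := sub j (Prec a b) _ _ ji sj; rewrite unpairK.
- move=> a <-; have [//|/= -> -> -> [-> -> ->]] := gcase (godel a) 3.
  move=> /andP[/hassP[j ji /eqP sj] /allsP h]; split; first exact: sub sj.
  move=> m /h /hassP[k ki /andP[/eqP sk pos]]; exists (res (s k)).-1.
  by rewrite prednK //; exact: sub sk.
Qed.

Definition justified_seq (l : seq nat) := forall i, i < size l -> justified (nth 0 l) i.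

(** The clauses of [justified] ask that certain triples occur earlier, not where they occur; so
    justification survives any rearrangement that keeps earlier triples earlier, in particular
    concatenation. *)
Lemma justified_mono s s' i i' : s i = s' i' ->
  (forall j, j < i -> exists2 j', j' < i' & s j = s' j') ->
  justified s i -> justified s' i'.
Proof.
move=> si hs; rewrite /justified si.
do 4 (case: ifP => // _).
case: ifP => _.
  move=> /hassP[j /hs[j' lt ->] /hassP[k /hs[k' lt' ->] h]].
  by apply/hassP; exists j' => //; apply/hassP; exists k'.
case: ifP => _.
  move=> /hassP[j /hs[j' lt ->] /hassP[k /hs[k' lt' ->] h]].
  by apply/hassP; exists j' => //; apply/hassP; exists k'.
case: ifP => _; [case: ifP => _|].
- by move=> /hassP[j /hs[j' lt ->] h]; apply/hassP; exists j'.
- move=> /hassP[j /hs[j' lt ->] /hassP[k /hs[k' lt' ->] h]].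
  by apply/hassP; exists j' => //; apply/hassP; exists k'.
move=> /andP[/hassP[j /hs[j' lt ->] h] /allsP h2]; apply/andP; split.
  by apply/hassP; exists j'.
apply/allsP => m /h2 /hassP[k /hs[k' lt' ->] h'].
by apply/hassP; exists k'.
Qed.

Lemma justified_seq_cat l l' : justified_seq l -> justified_seq l' -> justified_seq (l ++ l').
Proof.
move=> h h' i; rewrite size_cat => lt; case: (ltnP i (size l)) => il.
  apply: justified_mono (h i il); first by rewrite nth_cat il.
  by move=> j ji; exists j => //; rewrite nth_cat (ltn_trans ji il).
have il' : i - size l < size l' by lia.
apply: justified_mono (h' _ il'); first by rewrite nth_cat ltnNge il.
move=> j ji; exists (size l + j); first lia.
by rewrite nth_cat ltnNge leq_addr /= addKn.
Qed.

Lemma justified_seq_rcons l t : justified_seq l ->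
  justified (nth 0 (rcons l t)) (size l) -> justified_seq (rcons l t).
Proof.
move=> h ht i; rewrite size_rcons ltnS leq_eqVlt => /orP[/eqP -> //|lt].
apply: justified_mono (h i lt); first by rewrite nth_rcons lt.
by move=> j ji; exists j => //; rewrite nth_rcons (ltn_trans ji lt).
Qed.

(** The sequences of the subcomputations are concatenated and the new triple is appended. *)
Lemma justified_ex c x y : eval c x y ->
  exists2 l, justified_seq l & tr (godel c) x y \in l.
Proof.
have gcase n r : r < 4 -> [/\ (n * 4 + (r + 4) == 0) = false,
    (n * 4 + (r + 4) == 1) = false, (n * 4 + (r + 4) == 2) = false &
    [/\ (n * 4 + (r + 4) == 3) = false, (n * 4 + (r + 4) - 4) %/ 4 = n &
     (n * 4 + (r + 4) - 4) %% 4 = r]] by move=> r4; split; [lia..|split; lia].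
have step l t : justified_seq l -> justified (nth 0 (rcons l t)) (size l) ->
    exists2 l', justified_seq l' & t \in l'.
  by move=> hl ht; exists (rcons l t); [exact: justified_seq_rcons | rewrite mem_rcons inE eqxx].
have hin (l : seq nat) t u : u \in l ->
    exists2 j, j < size l & nth 0 (rcons l t) j = u.
  by move=> ul; exists (index u l); rewrite ?index_mem // nth_rcons index_mem ul nth_index.
have last1 (l : seq nat) t : nth 0 (rcons l t) (size l) = t by rewrite nth_rcons ltnn eqxx.
(* For [Mu], whose computation rests on one subcomputation for each smaller argument. *)
have all_ex (P : nat -> nat -> Prop) n :
    (forall m, m < n -> exists2 u, P m u & exists2 l, justified_seq l & u \in l) ->
    exists2 l, justified_seq l & forall m, m < n -> exists2 u, P m u & u \in l.
  elim: n => [|n IH] h; first by exists [::].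
  have [|l hl hm] := IH; first by move=> m mn; apply: h; lia.
  have [u Pu [l' hl' ul']] := h n (leqnn _).
  exists (l ++ l'); first exact: justified_seq_cat.
  move=> m; rewrite ltnS leq_eqVlt => /orP[/eqP ->|/hm[v Pv vl]].
    by exists u => //; rewrite mem_cat ul' orbT.
  by exists v => //; rewrite mem_cat vl.
elim: c x y => /=.
- by move=> x y ->; apply: (@step [::]) => //; rewrite /justified /tr !unpairK.
- by move=> x y ->; apply: (@step [::]) => //; rewrite /justified /tr !unpairK /=.
- by move=> x y ->; apply: (@step [::]) => //; rewrite /justified /tr !unpairK /=.
- by move=> x y ->; apply: (@step [::]) => //; rewrite /justified /tr !unpairK /=.
- move=> a IHa b IHb x y [u [v [/IHa[l hl ul] /IHb[l' hl' vl'] ->]]].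
  apply: (@step (l ++ l')); first exact: justified_seq_cat.
  rewrite /justified last1 /tr !unpairK /= ?unpairK /=.
  have [//|/= -> -> -> [-> -> ->]] := gcase (cpair (godel a) (godel b)) 0.
  rewrite ?unpairK /=.
  have [|j ji ej] := hin (l ++ l') (tr (cpair (godel a) (godel b) * 4 + 4) x (cpair u v)) _ (_ : tr (godel a) x u \in _).
    by rewrite mem_cat ul.
  have [|k ki ek] := hin (l ++ l') (tr (cpair (godel a) (godel b) * 4 + 4) x (cpair u v)) _ (_ : tr (godel b) x v \in _).
    by rewrite mem_cat vl' orbT.
  apply/hassP; exists j => //; apply/hassP; exists k => //.
  by rewrite /tr in ej ek *; rewrite ej ek /res ?unpairK /= ?unpairK /= !eqxx.
- move=> a IHa b IHb x y [u /IHb[l hl ul] /IHa[l' hl' vl']].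
  apply: (@step (l ++ l')); first exact: justified_seq_cat.
  rewrite /justified last1 /tr !unpairK /= ?unpairK /=.
  have [//|/= -> -> -> [-> -> ->]] := gcase (cpair (godel a) (godel b)) 1.
  rewrite ?unpairK /=.
  have [|j ji ej] := hin (l ++ l') (tr (cpair (godel a) (godel b) * 4 + 5) x y) _ (_ : tr (godel b) x u \in _).
    by rewrite mem_cat ul.
  have [|k ki ek] := hin (l ++ l') (tr (cpair (godel a) (godel b) * 4 + 5) x y) _ (_ : tr (godel a) u y \in _).
    by rewrite mem_cat vl' orbT.
  apply/hassP; exists j => //; apply/hassP; exists k => //.
  by rewrite /tr in ej ek *; rewrite ej ek /res ?unpairK /= ?unpairK /= !eqxx.
- move=> a IHa b IHb x.
  have -> : x = cpair (unpair x).1 (unpair x).2 by rewrite cpairK.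
  rewrite unpairK /=; move: (unpair x).1 => z; elim: (unpair x).2 => [|m IHm] y.
    move=> /IHa[l hl ul]; apply: (@step l) => //.
    rewrite /justified last1 /tr !unpairK /= ?unpairK /=.
    have [//|/= -> -> -> [-> -> ->]] := gcase (cpair (godel a) (godel b)) 2.
    rewrite ?unpairK /=.
    have [j ji ej] := hin l (tr (cpair (godel a) (godel b) * 4 + 6) (cpair z 0) y) _ ul.
    by apply/hassP; exists j => //; rewrite /tr in ej *; rewrite ej.
  move=> [u /IHm[l hl ul] /IHb[l' hl' vl']].
  apply: (@step (l ++ l')); first exact: justified_seq_cat.
  rewrite /justified last1 /tr !unpairK /= ?unpairK /=.
  have [//|/= -> -> -> [-> -> ->]] := gcase (cpair (godel a) (godel b)) 2.
  rewrite ?unpairK /=.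
  have [|j ji ej] := hin (l ++ l') (tr (cpair (godel a) (godel b) * 4 + 6) (cpair z m.+1) y) _ (_ : tr (cpair (godel a) (godel b) * 4 + 6) (cpair z m) u \in _).
    by rewrite mem_cat ul.
  have [|k ki ek] := hin (l ++ l') (tr (cpair (godel a) (godel b) * 4 + 6) (cpair z m.+1) y) _ (_ : tr (godel b) (cpair z (cpair m u)) y \in _).
    by rewrite mem_cat vl' orbT.
  apply/hassP; exists j => //; apply/hassP; exists k => //.
  by rewrite /tr in ej ek *; rewrite ej ek /res ?unpairK /= ?unpairK /= !eqxx.
- move=> a IHa x y [/IHa[l hl ul] hm].
  have [|l' hl' vl'] := all_ex (fun m t => exists u, t = tr (godel a) (cpair x m) u.+1) y.
    move=> m /hm[u hu]; exists (tr (godel a) (cpair x m) u.+1); first by exists u.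
    exact: IHa.
  apply: (@step (l ++ l')); first exact: justified_seq_cat.
  rewrite /justified last1 /tr !unpairK /= ?unpairK /=.
  have [//|/= -> -> -> [-> -> ->]] := gcase (godel a) 3.
  have ht := hin (l ++ l') (tr (godel a * 4 + 7) x y).
  apply/andP; split.
    have [|j ji ej] := ht _ (_ : tr (godel a) (cpair x y) 0 \in _).
      by rewrite mem_cat ul.
    by apply/hassP; exists j => //; rewrite /tr in ej *; rewrite ej.
  apply/allsP => m /vl'[t [u tu] tl'].
  have [|j ji ej] := ht t; first by rewrite mem_cat tl' orbT.
  apply/hassP; exists j => //.
  by rewrite /tr in ej tu *; rewrite ej tu /res ?unpairK /= ?unpairK /= eqxx.
Qed.

(* Kleene's T predicate: [w] codes a justified sequence that ends with [t]. *)
Definition kleeneT (t w : nat) : bool :=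
  all (fun i => justified_code (unpair w).2 i) (iota 0 (unpair w).1.+1) &&
  (nthc (unpair w).2 (unpair w).1 == t).

Lemma dec_kleeneT : dec (fun z => kleeneT (unpair z).1 (unpair z).2).
Proof. by have := dec_justified => ?; rewrite /kleeneT; comp. Qed.

(** Since every number is the index of a program, [phiP] needs no test for being an index. *)
Lemma godel_surj e : exists c, godel c = e.
Proof.
elim/ltn_ind: e => e IH.
case: (ltnP e 4) => [|e4].
  case: e {IH} => [|[|[|[|]]]] // _.
  by exists Zero. by exists Succ. by exists Fst. by exists Snd.
set n := (e - 4) %/ 4; have [h1 h2] := unpair_leq n; have en := cpairK n.
have [a ha] := IH (unpair n).1 ltac:(lia); have [b hb] := IH (unpair n).2 ltac:(lia).
have [d hd] := IH n ltac:(lia).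
have : (e - 4) %% 4 < 4 by rewrite ltn_pmod.
case er : ((e - 4) %% 4) => [|[|[|[|]]]] // _.
- by exists (Pair a b); rewrite /= ha hb en; lia.
- by exists (Comp a b); rewrite /= ha hb en; lia.
- by exists (Prec a b); rewrite /= ha hb en; lia.
- by exists (Mu d); rewrite /= hd; lia.
Qed.

Lemma godel_inj c d : godel c = godel d -> c = d.
Proof.
have cp a b a' b' : cpair a b = cpair a' b' -> a = a' /\ b = b'.
  by move=> /(congr1 unpair); rewrite !unpairK => -[-> ->].
elim: c d => [||||a IHa b IHb|a IHa b IHb|a IHa b IHb|a IHa] [||||a' b'|a' b'|a' b'|a'] //=; try lia.
- by move=> h; have /cp[/IHa -> /IHb ->] : cpair (godel a) (godel b) = cpair (godel a') (godel b') by lia.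
- by move=> h; have /cp[/IHa -> /IHb ->] : cpair (godel a) (godel b) = cpair (godel a') (godel b') by lia.
- by move=> h; have /cp[/IHa -> /IHb ->] : cpair (godel a) (godel b) = cpair (godel a') (godel b') by lia.
- by move=> h; have /IHa -> : godel a = godel a' by lia.
Qed.

Lemma kleene_evalP c x y :
  eval c x y <-> exists w, kleeneT (cpair (godel c) (cpair x y)) w.
Proof.
split=> [/justified_ex[l hl tl]|[w /andP[h0 /eqP e]]].
  have [w hw] := nthc_ex (nth 0 l) (size l).
  have lt : index (tr (godel c) x y) l < size l by rewrite index_mem.
  exists (cpair (index (tr (godel c) x y) l) w).
  rewrite /kleeneT unpairK; apply/andP; split; last by rewrite /= hw // nth_index.
  apply/allsP => i /= il.
  have il' : i < size l by lia.
  apply: justified_mono (hl i il'); first by rewrite hw.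
  by move=> j ji; exists j => //; rewrite hw //; lia.
have h := elimT (allsP _ _) h0; have := @justified_sound (nthc (unpair w).2) (unpair w).1 _ c.
by rewrite e /res /tr ?unpairK /= ?unpairK /=; apply.
Qed.

Lemma phiP e x y : phi e x y <-> exists w, kleeneT (cpair e (cpair x y)) w.
Proof.
split=> [[c <- /kleene_evalP//]|h].
by have [c hc] := godel_surj e; exists c => //; apply/kleene_evalP; rewrite hc.
Qed.

End universal.

(** * Closure properties of c.e. predicates *)

Section ce_predicates.
Local Open Scope nat_scope.

(** Projections of decidable relations instead of domains of programs: dovetailing then amounts to
    pairing witnesses. *)
Definition ce_pred (P : nat -> Prop) := exists2 D : nat -> nat -> bool,
  dec (fun z => D (unpair z).1 (unpair z).2) & forall z, P z <-> exists w, D z w.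

Lemma ce_pred_ext P Q : (forall z, P z <-> Q z) -> ce_pred P -> ce_pred Q.
Proof. by move=> PQ [D hD h]; exists D => // z; rewrite -PQ. Qed.

Lemma ce_ce_pred W : ce W -> ce_pred W.
Proof.
move=> [c ->]; have hT := dec_kleeneT.
exists (fun z w => kleeneT (cpair (godel c) (cpair z (unpair w).1)) (unpair w).2).
  by comp.
move=> z; split=> [[y /kleene_evalP[w hw]]|[w hw]].
  by exists (cpair y w); rewrite unpairK.
by exists (unpair w).1; apply/kleene_evalP; exists (unpair w).2.
Qed.

Lemma ce_pred_ce P : ce_pred P -> ce [set z | P z].
Proof.
move=> [D /dec_neg[c hc] h]; exists (Mu c).
have hc' z w : eval c (cpair z w) (~~ D z w) by have := hc (cpair z w); rewrite unpairK.
apply/seteqP; split => z /=.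
  move=> /h ex; exists (ex_minn ex); case: ex_minnP => n Dn nmin; split.
    by have := hc' z n; rewrite Dn.
  move=> m mn; exists 0; have := hc' z m; suff -> : D z m = false by [].
  by apply/negP => /nmin; rewrite leqNgt mn.
move=> [y [h0 _]]; apply/h; exists y.
by have := eval_fun h0 (hc' z y); case: (D z y).
Qed.

Lemma ce_pred_comp P f : ce_pred P -> computable f -> ce_pred (fun z => P (f z)).
Proof.
move=> [D hD h] hf; exists (fun z w => D (f z) w); last by move=> z; rewrite h.
by comp.
Qed.

Lemma ce_pred2 (P : nat -> nat -> Prop) f g :
  ce_pred (fun z => P (unpair z).1 (unpair z).2) ->
  computable f -> computable g -> ce_pred (fun z => P (f z) (g z)).
Proof.
move=> hP hf hg; have := ce_pred_comp hP (comp_pair hf hg).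
by apply: ce_pred_ext => z; rewrite unpairK.
Qed.

Lemma ce_pred_dec (P : nat -> bool) : dec P -> ce_pred (fun z => P z).
Proof.
move=> hP; exists (fun z _ => P z); first by comp.
by move=> z; split=> [h|[]//]; exists 0.
Qed.

Lemma ce_pred_ex (P : nat -> nat -> Prop) :
  ce_pred (fun z => P (unpair z).1 (unpair z).2) -> ce_pred (fun z => exists k, P z k).
Proof.
move=> [D hD h]; exists (fun z w => D (cpair z (unpair w).1) (unpair w).2); first by comp.
move=> z; split=> [[k]|[w hw]].
  have := h (cpair z k); rewrite unpairK /= => -> [w hw].
  by exists (cpair k w); rewrite unpairK.
exists (unpair w).1; have := h (cpair z (unpair w).1); rewrite unpairK /= => ->.
by exists (unpair w).2.
Qed.

Lemma ce_pred_and P Q : ce_pred P -> ce_pred Q -> ce_pred (fun z => P z /\ Q z).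
Proof.
move=> [D hD h] [D' hD' h']; exists (fun z w => D z (unpair w).1 && D' z (unpair w).2).
  by comp.
move=> z; rewrite h h'; split=> [[[w hw] [w' hw']]|[w /andP[hw hw']]].
  by exists (cpair w w'); rewrite unpairK /= hw.
by split; [exists (unpair w).1|exists (unpair w).2].
Qed.

Lemma ce_pred_or P Q : ce_pred P -> ce_pred Q -> ce_pred (fun z => P z \/ Q z).
Proof.
move=> [D hD h] [D' hD' h']; exists (fun z w => D z w || D' z w); first by comp.
move=> z; rewrite h h'; split=> [[[w hw]|[w hw]]|[w /orP[hw|hw]]].
- by exists w; rewrite hw.
- by exists w; rewrite hw orbT.
- by left; exists w.
- by right; exists w.
Qed.

(** The witnesses for the finitely many [i < n z] are coded by [nthc] in a single one. *)
Lemma ce_pred_all (P : nat -> nat -> Prop) n :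
  ce_pred (fun z => P (unpair z).1 (unpair z).2) -> computable n ->
  ce_pred (fun z => forall i, i < n z -> P z i).
Proof.
move=> [D hD h] hn.
exists (fun z w => all (fun i => D (cpair z i) (nthc w i)) (iota 0 (n z))); first by comp.
have hP z i : P z i <-> exists w, D (cpair z i) w.
  by have := h (cpair z i); rewrite unpairK.
move=> z; split=> [hz|[w /allsP hw] i /hw Dw]; last by apply/hP; exists (nthc w i).
have /choice[s hs] : forall i, exists w, i < n z -> D (cpair z i) w.
  move=> i; case: (ltnP i (n z)) => [/hz/hP[w hw]|]; first by exists w.
  by move=> ?; exists 0.
have [w hw] := nthc_ex s (n z); exists w; apply/allsP => i lt.
by rewrite hw //; exact: hs.
Qed.

(** Effective choice: the search runs over pairs of a value and a witness for it. *)
Lemma ce_pred_select (P : nat -> nat -> Prop) :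
  ce_pred (fun z => P (unpair z).1 (unpair z).2) -> (forall z, exists k, P z k) ->
  exists2 h, computable h & forall z, P z (h z).
Proof.
move=> [D hD h] ex.
have hP z i : P z i <-> exists w, D (cpair z i) w.
  by have := h (cpair z i); rewrite unpairK.
have [||s cs hs] := @comp_search (fun z k => D (cpair z (unpair k).1) (unpair k).2).
- by comp.
- move=> z; have [k /hP[w hw]] := ex z.
  by exists (cpair k w); rewrite unpairK.
- exists (fun z => (unpair (s z)).1); first by comp.
  by move=> z; apply/hP; exists (unpair (s z)).2.
Qed.

Lemma ce_pred_enumerated : ce_pred (fun z => enumerated (unpair z).1 (unpair z).2).
Proof.
apply: (@ce_pred_ext (fun z => exists x, exists w,
  kleeneT (cpair (unpair z).1 (cpair x (unpair z).2)) w)).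
  by move=> z; split=> [[x [w hw]]|[x /phiP[w hw]]]; exists x; [apply/phiP|]; exists w.
apply: ce_pred_ex; apply: ce_pred_ex; apply: ce_pred_dec.
by have := dec_kleeneT => ?; comp.
Qed.

(* The s-m-n theorem for the constant first argument [z]. *)
Lemma ce_pred_index (P : nat -> nat -> Prop) :
  ce_pred (fun z => P (unpair z).1 (unpair z).2) ->
  exists2 h, computable h & forall z k, enumerated (h z) k <-> P z k.
Proof.
move=> /ce_pred_ce[c hc].
have {}hc z k : P z k <-> exists y, eval c (cpair z k) y.
  have := congr1 (fun A => A (cpair z k)) hc; rewrite /= unpairK /=.
  by move=> ->.
pose idc := Pair Fst Snd.
have idcP x y : eval idc x y <-> y = x.
  split=> [[u [v [-> -> ->]]]|->]; first exact: cpairK.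
  by exists (unpair x).1, (unpair x).2; split => //; rewrite cpairK.
pose cst := fix cst n := if n is m.+1 then Comp Succ (cst m) else Zero.
have cstP z x y : eval (cst z) x y <-> y = z.
  elim: z y => [|z IH] y //=; split=> [[u /IH -> //]|->].
  by exists z => //; apply/IH.
(* On input [x] this runs [c] on [cpair z x] only to see that it halts, and then returns [x]; so it
   enumerates its own domain. *)
pose prog z := Comp Fst (Pair idc (Comp c (Pair (cst z) idc))).
have progP z k x : eval (prog z) x k <-> k = x /\ P z k.
  split=> [[_ [u [v [/idcP -> [w [a [b [/cstP -> /idcP -> ->]]] hv] ->]]]]|[-> /hc[y hy]]].
    by move=> /= ->; rewrite unpairK /=; split => //; apply/hc; exists v.
  exists (cpair x y); last by rewrite /= unpairK.
  exists x, y; split => //; first exact/idcP.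
  exists (cpair z x) => //; exists z, x; split => //; [exact/cstP|exact/idcP].
exists (fun z => godel (prog z)); last first.
  move=> z k; split=> [[x [d dz hd]]|hk].
    suff ed : d = prog z by move: hd; rewrite ed => /progP[].
    exact: godel_inj.
  by exists k, (prog z) => //; apply/progP.
have ccst : computable (fun z => godel (cst z)).
  (* [cpair 1 u * 4 + 5] is the number of [Comp Succ] applied to the program numbered [u]. *)
  apply: (@comp_ext (fun z => iteri z (fun _ u => cpair 1 u * 4 + 5) 0)).
    by elim=> //= n ->.
  by apply: comp_iteri; comp.
by rewrite /prog /=; comp.
Qed.

End ce_predicates.

(** * Rational codes and computable reals *)

Section rational_codes.
Context {R : realType}.
Implicit Types k l : nat.

Definition qr k : R := ratr (rat_of_code k).

Definition qnum k : nat := (unpair k).1.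
Definition qneg k : nat := (unpair (unpair k).2).1.
Definition qden k : nat := (unpair (unpair k).2).2.+1.
(** A code of [(a - b) / c] for positive [c]: codes store the predecessor of the denominator. *)
Definition qcode (a b c : nat) : nat := cpair a (cpair b c.-1).

Lemma qrE k : qr k = ((qnum k)%:R - (qneg k)%:R) / (qden k)%:R.
Proof.
rewrite /qr /rat_of_code /qnum /qneg /qden.
case: (unpair k) => a bc /=; case: (unpair bc) => b c /=.
by rewrite fmorph_div rmorphB /= !ratr_nat.
Qed.

Lemma qr_code a b c : (0 < c)%N -> qr (qcode a b c) = (a%:R - b%:R) / c%:R.
Proof. by move=> c0; rewrite qrE /qnum /qneg /qden /qcode !unpairK /= prednK. Qed.

Definition qadd k l := qcode (qnum k * qden l + qnum l * qden k)
  (qneg k * qden l + qneg l * qden k) (qden k * qden l).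
Definition qopp k := qcode (qneg k) (qnum k) (qden k).
Definition qmul k l := qcode (qnum k * qnum l + qneg k * qneg l)
  (qnum k * qneg l + qneg k * qnum l) (qden k * qden l).
Definition qnat (n : nat) := qcode n 0 1.
Definition qexp2 (n : nat) := qcode 1 0 (2 ^ n).

Lemma qr_add k l : qr (qadd k l) = qr k + qr l.
Proof.
rewrite qr_code ?muln_gt0 // !qrE !natrD !natrM.
by field; rewrite !pnatr_eq0.
Qed.

Lemma qr_opp k : qr (qopp k) = - qr k.
Proof. by rewrite qr_code // qrE -mulNr opprB. Qed.

Lemma qr_mul k l : qr (qmul k l) = qr k * qr l.
Proof.
rewrite qr_code ?muln_gt0 // !qrE !natrD !natrM.
by field; rewrite !pnatr_eq0.
Qed.

Lemma qr_nat n : qr (qnat n) = n%:R.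
Proof. by rewrite qr_code // subr0 divr1. Qed.

Lemma qr_exp2 n : qr (qexp2 n) = 2 ^- n.
Proof. by rewrite qr_code ?expn_gt0 // subr0 mul1r natrX. Qed.

(** A code dominates its components. This crude bound later shows that simple functions built from
    the first [m] codes are bounded by [m]. *)
Lemma qr_leq k : qr k <= k%:R.
Proof.
rewrite qrE ler_pdivrMr ?ltr0n // -natrM lerBlDr -natrD ler_nat.
by rewrite /qnum /qden; have [h _] := unpair_leq k; nia.
Qed.

(** After cross-multiplication, and with the subtracted parts moved across, natural numbers are
    compared. *)
Lemma dec_qlt f g : computable f -> computable g -> dec (fun z => qr (f z) < qr (g z)).
Proof.
move=> hf hg; apply: (@dec_ext (fun z =>
  (qnum (f z) * qden (g z) + qneg (g z) * qden (f z)).+1 <=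
  qnum (g z) * qden (f z) + qneg (f z) * qden (g z))%N); last first.
  by rewrite /qnum /qneg /qden; comp.
move=> z; rewrite !qrE ltr_pdivrMr ?ltr0n // mulrAC ltr_pdivlMr ?ltr0n //.
by rewrite !mulrBl ltrBlDr addrAC ltrBrDr -!natrM -!natrD ltr_nat.
Qed.

Lemma dec_qle f g : computable f -> computable g -> dec (fun z => qr (f z) <= qr (g z)).
Proof.
move=> hf hg; apply: (@dec_ext (fun z => ~~ (qr (g z) < qr (f z)))).
  by move=> z; rewrite -leNgt.
by apply: dec_neg; exact: dec_qlt.
Qed.

Lemma qr_dense (x y : R) : x < y -> exists k, x < qr k < y.
Proof.
move=> /rat_in_itvoo[q /itvP qxy].
suff [k kq] : exists k, rat_of_code k = q by exists k; rewrite /qr kq !qxy.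
have den0 := denq_gt0 q.
case: (numq q) (divq_num_den q) => n e.
- exists (cpair n (cpair 0 `|denq q|%N.-1)); rewrite /rat_of_code !unpairK subr0 prednK ?absz_gt0 ?denq_neq0 //.
  by rewrite -[RHS]e; congr (_ / _); rewrite -[in RHS](gtz0_abs den0).
- exists (cpair 0 (cpair n.+1 `|denq q|%N.-1)); rewrite /rat_of_code !unpairK prednK ?absz_gt0 ?denq_neq0 //.
  rewrite -[RHS]e; congr (_ / _); last by rewrite -[in RHS](gtz0_abs den0).
  by rewrite sub0r NegzE mulrNz.
Qed.

Lemma exp2_small (e : R) : 0 < e -> exists m, 2 ^- m < e.
Proof.
move=> e0; exists (Num.truncn e^-1); rewrite invf_plt ?posrE ?exprn_gt0 //.
apply: lt_le_trans (truncnS_gt e^-1) _; rewrite -natrX ler_nat.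
exact: ltn_expl.
Qed.

End rational_codes.

Lemma comp_qadd f g : computable f -> computable g -> computable (fun z => qadd (f z) (g z)).
Proof. by move=> hf hg; rewrite /qadd /qcode /qnum /qneg /qden; comp. Qed.
Lemma comp_qmul f g : computable f -> computable g -> computable (fun z => qmul (f z) (g z)).
Proof. by move=> hf hg; rewrite /qmul /qcode /qnum /qneg /qden; comp. Qed.
Lemma comp_qopp f : computable f -> computable (fun z => qopp (f z)).
Proof. by move=> hf; rewrite /qopp /qcode /qnum /qneg /qden; comp. Qed.
Lemma comp_qnat f : computable f -> computable (fun z => qnat (f z)).
Proof. by move=> hf; rewrite /qnat /qcode; comp. Qed.
Lemma comp_qexp2 f : computable f -> computable (fun z => qexp2 (f z)).
Proof. by move=> hf; rewrite /qexp2 /qcode; comp. Qed.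

Ltac comp_extra ::=
  match goal with
  | |- computable (fun z => expn 2 _) => apply: comp_exp2
  | |- computable (fun z => nthc _ _) => apply: comp_nthc
  | |- computable (fun z => divn _ _) => apply: comp_div
  | |- computable (fun z => modn _ _) => apply: comp_mod
  | |- computable (fun z => qadd _ _) => apply: comp_qadd
  | |- computable (fun z => qmul _ _) => apply: comp_qmul
  | |- computable (fun z => qopp _) => apply: comp_qopp
  | |- computable (fun z => qnat _) => apply: comp_qnat
  | |- computable (fun z => qexp2 _) => apply: comp_qexp2
  | |- dec (fun z => @Order.lt _ _ (qr _) (qr _)) => apply: dec_qlt
  | |- dec (fun z => @Order.le _ _ (qr _) (qr _)) => apply: dec_qle
  | H : ce_pred ?h |- ce_pred ?h => exact H
  | H : ce_pred ?h |- ce_pred (fun z => ?h _) => apply: (ce_pred_comp H)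
  | H : ce_pred (fun z => ?F (unpair z).1 (unpair z).2) |- ce_pred (fun z => ?F _ _) => apply: (ce_pred2 H)
  | |- ce_pred (fun z => _ /\ _) => apply: ce_pred_and
  | |- ce_pred (fun z => _ \/ _) => apply: ce_pred_or
  | |- ce_pred (fun z => exists k, _) => apply: ce_pred_ex
  | |- ce_pred (fun z => is_true _) => apply: ce_pred_dec
  end.

Section computable_reals.
Context {R : realType}.

(** [a n < q] iff some approximation plus its error [2^-m] is below [q]. The error is spent twice,
    once by the approximation and once by the safety margin, hence the halved gaps. *)
Lemma computable_reals_cuts (a : nat -> R) : computable_reals a ->
  ce_pred (fun z => a (unpair z).1 < qr (unpair z).2) /\
  ce_pred (fun z => qr (unpair z).2 < a (unpair z).1).
Proof.
move=> [h ch hh].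
have hn n m : `|qr (h (cpair n m)) - a n| <= 2 ^- m := hh n m.
split.
  apply: (@ce_pred_ext (fun z => exists m,
    (qr (qadd (h (cpair (unpair z).1 m)) (qexp2 m)) : R) < qr (unpair z).2)); last by comp.
  move=> z; move: (unpair z).1 (unpair z).2 => n k; split=> [[m]|ak].
    rewrite qr_add qr_exp2; have := hn n m; rewrite ler_norml => /andP[]; lra.
  have [|m hm] := @exp2_small R ((qr k - a n) / 2); first by rewrite divr_gt0 ?subr_gt0.
  exists m; rewrite qr_add qr_exp2; have := hn n m; rewrite ler_norml => /andP[]; lra.
apply: (@ce_pred_ext (fun z => exists m, (qr (unpair z).2 : R) <
    qr (qadd (h (cpair (unpair z).1 m)) (qopp (qexp2 m))))); last by comp.
move=> z; move: (unpair z).1 (unpair z).2 => n k; split=> [[m]|ak].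
  rewrite qr_add qr_opp qr_exp2; have := hn n m; rewrite ler_norml => /andP[]; lra.
have [|m hm] := @exp2_small R ((a n - qr k) / 2); first by rewrite divr_gt0 ?subr_gt0.
exists m; rewrite qr_add qr_opp qr_exp2; have := hn n m; rewrite ler_norml => /andP[]; lra.
Qed.

Lemma cuts_computable_reals (a : nat -> R) :
  ce_pred (fun z => a (unpair z).1 < qr (unpair z).2) ->
  ce_pred (fun z => qr (unpair z).2 < a (unpair z).1) -> computable_reals a.
Proof.
move=> hu hl.
have [||h ch hh] := @ce_pred_select (fun z k =>
    a (unpair z).1 < qr (qadd k (qexp2 (unpair z).2)) /\
    (qr (qadd k (qopp (qexp2 (unpair z).2))) : R) < a (unpair z).1).
- apply: ce_pred_and.
    by apply: (@ce_pred2 (fun n k => a n < qr k)) => //; comp.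
  by apply: (@ce_pred2 (fun n k => qr k < a n)) => //; comp.
- move=> z; have [|k /andP[hk1 hk2]] := @qr_dense R (a (unpair z).1) (a (unpair z).1 + 2 ^- (unpair z).2).
    by rewrite ltrDl invr_gt0 exprn_gt0.
  have : 0 < 2 ^- (unpair z).2 :> R by rewrite invr_gt0 exprn_gt0.
  by exists k; rewrite !qr_add qr_opp qr_exp2; lra.
exists h => // n m; have := hh (cpair n m); rewrite unpairK /= !qr_add qr_opp qr_exp2 => -[h1 h2].
by rewrite -/(qr _) ler_norml; lra.
Qed.

End computable_reals.

(** * Uniformly c.e. open sets *)

Section effective_open.
Context {R : realType} {X : computablePolishType R}.
Implicit Types (K : set X) (W : nat -> X -> Prop).

Definition cball (k : nat) : set X :=
  ball (ideal_point (unpair k).1) (ratr (posrat_of_code (unpair k).2)).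

(* [W] coincides on [K] with a uniformly c.e. open sequence of sets. Members of the
   algebra generated by a measure-computable basis are c.e. open only in this sense,
   for [K] the set [KR]. *)
Definition ce_open_on K W := exists2 Q : nat -> nat -> Prop,
  ce_pred (fun z => Q (unpair z).1 (unpair z).2) &
  forall z x, K x -> W z x <-> exists2 k, Q z k & cball k x.

Lemma ce_open_on_ext K W W' : (forall z x, K x -> W z x <-> W' z x) -> ce_open_on K W -> ce_open_on K W'.
Proof. by move=> WW' [Q hQ h]; exists Q => // z x Kx; rewrite -WW' // h. Qed.

Lemma ce_open_on_index K W : ce_open_on K W ->
  exists2 h, computable h & forall z x, K x -> W z x <-> ce_open (h z) x.
Proof.
move=> [Q /ce_pred_index[h ch hh] hW]; exists h => // z x Kx; rewrite hW //.
by split=> -[k /hh]; exists k.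
Qed.

Lemma ce_open_on_ce_open K f : computable f -> ce_open_on K (fun z => ce_open (f z)).
Proof.
move=> cf; exists (fun z k => enumerated (f z) k).
  by apply: ce_pred2; [exact: ce_pred_enumerated | comp | comp].
by [].
Qed.

Lemma ce_open_on_comp K W f : ce_open_on K W -> computable f -> ce_open_on K (fun z => W (f z)).
Proof.
move=> [Q hQ h] cf; exists (fun z => Q (f z)); last by move=> z x; exact: h.
by apply: ce_pred2 => //; comp.
Qed.

Lemma ce_open_on2 K (W : nat -> nat -> X -> Prop) f g :
  ce_open_on K (fun z => W (unpair z).1 (unpair z).2) ->
  computable f -> computable g -> ce_open_on K (fun z => W (f z) (g z)).
Proof.
move=> hW cf cg; have := ce_open_on_comp hW (comp_pair cf cg).
by apply: ce_open_on_ext => z x _; rewrite unpairK.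
Qed.

Lemma ce_open_on_ex K (W : nat -> nat -> X -> Prop) :
  ce_open_on K (fun z => W (unpair z).1 (unpair z).2) ->
  ce_open_on K (fun z x => exists k, W z k x).
Proof.
move=> [Q hQ h]; exists (fun z k => exists i, Q (cpair z i) k).
  by comp.
move=> z x Kx; split=> [[i]|[k [i Qk] kx]].
  by have := h (cpair z i) x Kx; rewrite unpairK => -> [k ? ?]; exists k => //; exists i.
by exists i; have := h (cpair z i) x Kx; rewrite unpairK => ->; exists k.
Qed.

Lemma ce_open_on_or K W W' : ce_open_on K W -> ce_open_on K W' -> ce_open_on K (fun z x => W z x \/ W' z x).
Proof.
move=> [Q hQ h] [Q' hQ' h']; exists (fun z k => Q z k \/ Q' z k); first by comp.
move=> z x Kx; rewrite h // h' //; split=> [[] [k]|[k [] ? ?]].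
- by exists k; [left|].
- by exists k; [right|].
- by left; exists k.
- by right; exists k.
Qed.

Let rad (k : nat) : R := ratr (posrat_of_code (unpair k).2).
Let ctr (k : nat) : X := ideal_point (unpair k).1.

Lemma posrat_gt0 k : 0 < ratr (posrat_of_code k) :> R.
Proof.
by rewrite ltr0q /posrat_of_code; case: (unpair k) => a b; rewrite divr_gt0 ?ltr0n.
Qed.

Lemma posrat_qr k : ratr (posrat_of_code k) =
  qr (qcode (unpair k).1.+1 0 (unpair k).2.+1) :> R.
Proof.
rewrite /qr; congr ratr; rewrite /posrat_of_code; case: (unpair k) => a b.
by rewrite /rat_of_code /qcode !unpairK subr0.
Qed.

Lemma posrat_dense (x y : R) : 0 <= x -> x < y -> exists k, x < ratr (posrat_of_code k) < y.
Proof.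
move=> x0 /qr_dense[k /andP[xk ky]].
have k0 : 0 < (qr k : R) by exact: le_lt_trans xk.
exists (cpair (qnum k - qneg k).-1 (qden k).-1); rewrite posrat_qr unpairK.
have lt : (qneg k < qnum k)%N.
  by move: k0; rewrite qrE pmulr_lgt0 ?invr_gt0 ?ltr0n // subr_gt0 ltr_nat.
by rewrite qr_code // !prednK ?subn_gt0 // subr0 natrB ?(ltnW lt) // -qrE xk.
Qed.

Lemma cballE k x : cball k x <-> mdist (ctr k) x < rad k.
Proof. by rewrite /cball ballEmdist. Qed.

Lemma small_cball (x : X) (e : R) : 0 < e -> exists2 k, cball k x & rad k < e.
Proof.
move=> e0; have [y [/= bxy [i _ iy]]] : (ball x (e / 2) : set X)° `&` range (@ideal_point R X) !=set0.
  apply: dense_ideal_point; last exact: open_interior.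
  by exists x; apply: nbhsx_ballx; exact: divr_gt0.
have {}bxy : mdist x y < e / 2 by have := interior_subset bxy; rewrite ballEmdist.
have [k /andP[h1 h2]] := posrat_dense (mdist_ge0 x y) bxy.
exists (cpair i k); last by rewrite /rad unpairK /=; apply: lt_trans h2 _; rewrite ltr_pdivrMr // ltr_pMr // ltr1n.
by apply/cballE; rewrite /rad /ctr unpairK /= iy metric_sym.
Qed.

(* Formal inclusion: implies inclusion of balls, and is c.e. in [k], [l]. *)
Definition below (k l : nat) : Prop := mdist (ctr k) (ctr l) + rad k < rad l.

Lemma below_subset k l : below k l -> cball k `<=` cball l.
Proof.
rewrite /below => h x /cballE kx; apply/cballE.
by have := metric_triangle (ctr l) (ctr k) x; rewrite (metric_sym (ctr l) (ctr k)); lra.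
Qed.

(** A ball through [x] whose radius is below half of the slack of [x] in [cball l] is formally
    included in it, as the triangle inequality spends that radius twice. *)
Lemma small_below l x : cball l x ->
  exists2 e : R, 0 < e & forall k, cball k x -> rad k < e -> below k l.
Proof.
move=> /cballE lx; exists ((rad l - mdist (ctr l) x) / 2); first by rewrite divr_gt0 ?subr_gt0.
move=> k /cballE kx re; rewrite /below.
by have := metric_triangle (ctr k) x (ctr l); rewrite (metric_sym x); lra.
Qed.

Lemma mdist_cuts : ce_pred (fun z => mdist (ideal_point (unpair (unpair z).1).1 : X)
      (ideal_point (unpair (unpair z).1).2) < (qr (unpair z).2 : R)) /\
  ce_pred (fun z => (qr (unpair z).2 : R) < mdist (ideal_point (unpair (unpair z).1).1 : X)
      (ideal_point (unpair (unpair z).1).2)).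
Proof. exact: computable_reals_cuts (@computable_mdist R X). Qed.

Definition dlt (i j k : nat) : Prop := mdist (ideal_point i : X) (ideal_point j) < (qr k : R).
Definition dgt (i j k : nat) : Prop := (qr k : R) < mdist (ideal_point i : X) (ideal_point j).

Lemma ce_pred_dlt f g h : computable f -> computable g -> computable h -> ce_pred (fun z => dlt (f z) (g z) (h z)).
Proof.
move=> cf cg chh; have := ce_pred_comp (proj1 mdist_cuts) (comp_pair (comp_pair cf cg) chh).
by apply: ce_pred_ext => z; rewrite !unpairK.
Qed.

Lemma ce_pred_dgt f g h : computable f -> computable g -> computable h -> ce_pred (fun z => dgt (f z) (g z) (h z)).
Proof.
move=> cf cg chh; have := ce_pred_comp (proj2 mdist_cuts) (comp_pair (comp_pair cf cg) chh).
by apply: ce_pred_ext => z; rewrite !unpairK.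
Qed.

Let qrad k := qcode (unpair (unpair k).2).1.+1 0 (unpair (unpair k).2).2.+1.

Lemma comp_qrad f : computable f -> computable (fun z => qrad (f z)).
Proof. by move=> cf; rewrite /qrad /qcode; comp. Qed.

Lemma ce_pred_below : ce_pred (fun z => below (unpair z).1 (unpair z).2).
Proof.
apply: (@ce_pred_ext (fun z => dlt (unpair (unpair z).1).1 (unpair (unpair z).2).1
   (qadd (qrad (unpair z).2) (qopp (qrad (unpair z).1))))).
  move=> z; rewrite /dlt /below qr_add qr_opp /rad !posrat_qr /qrad /ctr; split; lra.
apply: ce_pred_dlt; [comp|comp|]; apply: comp_qadd; first by apply: comp_qrad; comp.
by apply: comp_qopp; apply: comp_qrad; comp.
Qed.

(** A finite intersection is enumerated by the balls formally below a ball of each member. At a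
    given point finitely many radius conditions have a common solution. *)
Lemma ce_open_on_all K (W : nat -> nat -> X -> Prop) n :
  ce_open_on K (fun z => W (unpair z).1 (unpair z).2) -> computable n ->
  ce_open_on K (fun z x => forall i, (i < n z)%N -> W z i x).
Proof.
move=> [Q hQ h] cn.
exists (fun z k => forall i, (i < n z)%N -> exists l, Q (cpair z i) l /\ below k l).
  apply: (@ce_pred_all (fun z i => exists l, Q (cpair (unpair z).1 i) l /\ below (unpair z).2 l)).
    by have := ce_pred_below => ?; comp.
  by comp.
move=> z x Kx.
have hW i : W z i x <-> exists2 k, Q (cpair z i) k & cball k x.
  by have := h (cpair z i) x Kx; rewrite unpairK.
split=> [hz|[k hk kx] i lt]; last first.
  by have [l [Ql /below_subset/(_ _ kx) lx]] := hk i lt; apply/hW; exists l.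
have [e e0 he] : exists2 e : R, 0 < e & forall i, (i < n z)%N -> forall k, cball k x -> rad k < e ->
    exists l, Q (cpair z i) l /\ below k l.
  elim: (n z) hz => [|m IH] hz; first by exists 1.
  have [|e e0 he] := IH; first by move=> i im; apply: hz; exact: leqW.
  have /hW[l Ql /small_below[e' e'0 he']] := hz m (leqnn _).
  exists (Num.min e e'); first by rewrite lt_min e0.
  move=> i; rewrite ltnS leq_eqVlt => /orP[/eqP ->|im] k kx; rewrite lt_min => /andP[k1 k2].
    by exists l; split => //; exact: he'.
  exact: he.
have [k kx ke] := small_cball x e0; exists k => // i lt; exact: he.
Qed.

Lemma ce_open_on_cep K P : ce_pred P -> ce_open_on K (fun z _ => P z).
Proof.
move=> hP; exists (fun z _ => P z); first by comp.
move=> z x _; split=> [Pz|[] //].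
by have [k kx _] := @small_cball x 1 ltr01; exists k.
Qed.

Lemma ce_open_on_dec K (P : nat -> bool) : dec P -> ce_open_on K (fun z _ => P z).
Proof. by move=> /ce_pred_dec; exact: ce_open_on_cep. Qed.

Lemma ce_open_on_and K W W' : ce_open_on K W -> ce_open_on K W' -> ce_open_on K (fun z x => W z x /\ W' z x).
Proof.
move=> [Q hQ h] [Q' hQ' h'].
exists (fun z k => (exists l, Q z l /\ below k l) /\ (exists l, Q' z l /\ below k l)).
  by have := ce_pred_below => ?; comp.
move=> z x Kx; rewrite h // h' //; split.
  move=> [[l Ql /small_below[e e0 he]] [l' Ql' /small_below[e' e'0 he']]].
  have [|k kx] := @small_cball x (Num.min e e'); first by rewrite lt_min e0.
  rewrite lt_min => /andP[k1 k2]; exists k => //; split; [exists l|exists l']; split => //.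
    exact: he.
  exact: he'.
move=> [k [[l [Ql /below_subset kl]] [l' [Ql' /below_subset kl']]] kx].
by split; [exists l => //; exact: kl|exists l' => //; exact: kl'].
Qed.

(** A constant set is nonempty iff some ball is enumerated, since each ball contains its center. So
    results about functions of [x] specialise to numbers, such as integrals with respect to [nu]. *)
Lemma ce_open_on_setT_cep P : ce_open_on setT (fun z _ => P z) -> ce_pred P.
Proof.
move=> [Q hQ h]; apply: (@ce_pred_ext (fun z => exists k, Q z k)); last exact: ce_pred_ex.
move=> z; split=> [[k Qk]|Pz].
  apply/(h z (ctr k) I); exists k => //; apply/cballE.
  by rewrite mdistxx; exact: posrat_gt0.
by have /(_ Pz)[k] := proj1 (h z point I); exists k.
Qed.

Lemma ce_open_on_mdist_lt K f g : computable f -> computable g ->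
  ce_open_on K (fun z x => mdist (ideal_point (f z)) x < qr (g z)).
Proof.
move=> cf cg; exists (fun z k => dlt (unpair k).1 (f z) (qadd (g z) (qopp (qrad k)))).
  apply: ce_pred_dlt; [comp|comp|]; apply: comp_qadd; first by comp.
  by apply: comp_qopp; apply: comp_qrad; comp.
move=> z x _; rewrite /dlt; split.
  move=> lt; have [|k kx] := @small_cball x ((qr (g z) - mdist (ideal_point (f z)) x) / 2).
    by rewrite divr_gt0 ?subr_gt0.
  rewrite /rad posrat_qr -/(qrad k) => rk; exists k => //.
  move/cballE: kx; rewrite /rad posrat_qr -/(qrad k) /ctr => kx.
  by rewrite qr_add qr_opp; have := metric_triangle (ideal_point (unpair k).1) x (ideal_point (f z));
    rewrite (metric_sym x); lra.
move=> [k + /cballE]; rewrite /rad posrat_qr -/(qrad k) /ctr qr_add qr_opp => h1 h2.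
have := metric_triangle (ideal_point (f z)) (ideal_point (unpair k).1) x.
by rewrite (metric_sym (ideal_point (f z)) (ideal_point _)); lra.
Qed.

Lemma ce_open_on_mdist_gt K f g : computable f -> computable g ->
  ce_open_on K (fun z x => qr (g z) < mdist (ideal_point (f z)) x).
Proof.
move=> cf cg; exists (fun z k => dgt (unpair k).1 (f z) (qadd (g z) (qrad k))).
  apply: ce_pred_dgt; [comp|comp|]; apply: comp_qadd; first by comp.
  by apply: comp_qrad; comp.
move=> z x _; rewrite /dgt; split.
  move=> lt; have [|k kx] := @small_cball x ((mdist (ideal_point (f z)) x - qr (g z)) / 2).
    by rewrite divr_gt0 ?subr_gt0.
  rewrite /rad posrat_qr -/(qrad k) => rk; exists k => //.
  move/cballE: kx; rewrite /rad posrat_qr -/(qrad k) /ctr => kx.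
  by rewrite qr_add; have := metric_triangle (ideal_point (f z)) (ideal_point (unpair k).1) x;
    rewrite (metric_sym (ideal_point (f z)) (ideal_point _)); lra.
move=> [k + /cballE]; rewrite /rad posrat_qr -/(qrad k) /ctr qr_add => h1 h2.
have := metric_triangle (ideal_point (unpair k).1) x (ideal_point (f z)).
by rewrite (metric_sym x); lra.
Qed.

End effective_open.

(** * Lower semi-computable functions and their integrals *)

Section lsc_calculus.
Context {R : realType} {X : computablePolishType R}.
Implicit Types (K : set X).
Local Open Scope ereal_scope.

Definition lsc_on K (f : nat -> X -> \bar R) :=
  ce_open_on K (fun z x => (qr (unpair z).2)%:E < f (unpair z).1 x).

Lemma lsc_on_ext K f g : (forall n x, K x -> f n x = g n x) -> lsc_on K f -> lsc_on K g.
Proof. by move=> fg; apply: ce_open_on_ext => z x Kx; rewrite fg. Qed.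

Lemma lsc_on2 K f a b : lsc_on K f -> computable a -> computable b ->
  ce_open_on K (fun z x => (qr (b z))%:E < f (a z) x).
Proof. exact: (@ce_open_on2 _ _ K (fun n k x => (qr k)%:E < f n x)). Qed.

Lemma lsc_on_comp K f a : lsc_on K f -> computable a -> lsc_on K (fun n => f (a n)).
Proof.
by move=> hf ca; apply: (@lsc_on2 K f (fun z => a (unpair z).1) (fun z => (unpair z).2)) => //; comp.
Qed.

Lemma lsc_on_lsc (f : X -> \bar R) : lsc f <-> lsc_on setT (fun=> f).
Proof.
split=> [[h ch hh]|hf].
  have : ce_open_on setT (fun z => ce_open (R := R) (X := X) (h (unpair z).2)) by apply: ce_open_on_ce_open; comp.
  by apply: ce_open_on_ext => z x _; rewrite -hh.
have [h ch hh] := ce_open_on_index (@lsc_on2 _ _ (fun=> 0%N) (fun z => z) hf ltac:(comp) ltac:(comp)).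
by exists h => // k; apply/seteqP; split => x /(hh k x I).
Qed.

End lsc_calculus.

Ltac sig_step :=
  match goal with
  | H : ce_open_on ?K ?W |- ce_open_on ?K ?W => exact H
  | |- ce_open_on _ (fun z x => _ /\ _) => apply: ce_open_on_and
  | |- ce_open_on _ (fun z x => _ \/ _) => apply: ce_open_on_or
  | |- ce_open_on _ (fun z x => exists k, _) => apply: ce_open_on_ex
  | |- ce_open_on _ (fun z x => forall i, is_true (i < _)%N -> _) => apply: ce_open_on_all
  | H : lsc_on ?K ?f |- ce_open_on ?K (fun z x => is_true ((qr _)%:E < ?f _ x)%E) => apply: (lsc_on2 H)
  | H : ce_open_on ?K ?W |- ce_open_on ?K (fun z => ?W _) => apply: (ce_open_on_comp H)
  | H : ce_open_on ?K ?W |- ce_open_on ?K (fun z x => ?W _ x) => apply: (ce_open_on_comp H)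
  | H : ce_open_on ?K (fun z => ?F (unpair z).1 (unpair z).2) |- ce_open_on ?K (fun z => ?F _ _) => apply: (ce_open_on2 H)
  | |- ce_open_on _ (fun z x => is_true (mdist (ideal_point _) x < qr _)%R) => apply: ce_open_on_mdist_lt
  | |- ce_open_on _ (fun z x => is_true (qr _ < mdist (ideal_point _) x)%R) => apply: ce_open_on_mdist_gt
  | |- ce_open_on _ (fun z _ => is_true _) => apply: ce_open_on_dec
  end.

Ltac sig := repeat (first [sig_step | comp_step | comp_extra]).

Section lsc_sums.
Context {R : realType} {X : computablePolishType R}.
Implicit Types (K : set X).
Local Open Scope ereal_scope.

Lemma lte_split (q : R) (u v : \bar R) : 0 <= u -> 0 <= v ->
  q%:E < u + v <-> exists a b, [/\ (qr a)%:E < u, (qr b)%:E < v & (q <= qr a + qr b)%R].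
Proof.
move=> u0 v0; split; last first.
  move=> [a [b [au bv qab]]]; apply: (@le_lt_trans _ _ (qr a + qr b)%:E) => //.
  case: u u0 au => [u|//|//] u0 au; case: v v0 bv => [v|//|//] v0 bv; rewrite ?ltey //.
  by move: au bv; rewrite -EFinD !lte_fin => *; apply: ltrD.
(* When one summand is [+oo], the other may be 0 and is then only strictly above negative rationals;
   the bound of the infinite one makes up for this loss. *)
have neg : exists b : nat, (-1 < (qr b : R) < 0)%R by apply: qr_dense; rewrite oppr_lt0.
case: u u0 => [u|_ _|//]; last first.
  have [b /andP[b1 b0]] := neg.
  have [|a /andP[qa _]] := @qr_dense R (q + 1) (q + 2); first by lra.
  exists a, b; split; [exact: ltey|exact: lt_le_trans v0|lra].
case: v v0 => [v|_ u0 _|//]; last first.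
  have [b /andP[b1 b0]] := neg.
  have [|a /andP[qa _]] := @qr_dense R (q + 1) (q + 2); first by lra.
  exists b, a; split; [exact: lt_le_trans u0|exact: ltey|lra].
move=> v0 u0; rewrite -EFinD lte_fin => quv.
have [|a /andP[a1 a2]] := @qr_dense R (u - (u + v - q) / 2) u; first by lra.
have [|b /andP[b1 b2]] := @qr_dense R (v - (u + v - q) / 2) v; first by lra.
by exists a, b; split; rewrite ?lte_fin //; lra.
Qed.

(* [s l] is a strict lower bound of the sum of the first [l] terms. *)
Lemma lte_sum_split (q : R) (u : nat -> \bar R) m : (forall l, 0 <= u l) ->
  q%:E < \sum_(l < m) u l <->
  exists s : nat -> nat, [/\ (qr (s 0%N) < 0 :> R)%R,
    forall l, (l < m)%N -> exists b, (qr (s l.+1) <= qr (s l) + qr b :> R)%R /\ (qr b)%:E < u l &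
    (q <= qr (s m))%R].
Proof.
move=> u0; split.
  elim: m q => [|m IH] q; rewrite ?big_ord0.
    rewrite lte_fin => /qr_dense[k /andP[qk k0]].
    by exists (fun=> k); split => //; exact: ltW.
  rewrite big_ord_recr /= => /lte_split[|//|a [b [/IH[s [s0 hs sa]] bu qab]]].
    exact: sume_ge0.
  have [|k /andP[k1 k2]] := @qr_dense R (qr a + qr b - 1) (qr a + qr b); first by lra.
  exists (fun l => if (l <= m)%N then s l else qadd a b); split => //=.
    move=> l; rewrite ltnS => lm; rewrite lm; case: ltnP => lm'; first exact: hs.
    exists b; have -> : l = m by apply/eqP; rewrite eqn_leq lm.
    by rewrite qr_add; split => //; lra.
  by rewrite ltnn qr_add.
move=> [s [s0 hs]]; elim: m q hs => [|m IH] q hs qs.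
  by rewrite big_ord0 lte_fin; exact: le_lt_trans s0.
rewrite big_ord_recr /=; have [b [sb bu]] := hs m (leqnn _).
apply/lte_split; [exact: sume_ge0|exact: u0|].
have : (qr (s m))%:E < \sum_(l < m) u l.
  by apply: IH => // l lm; apply: hs; exact: leqW.
by move=> sm; exists (s m), b; split => //; lra.
Qed.

(** The sequence of partial bounds in [lte_sum_split] becomes a number [w] read through [nthc], so
    that one existential quantifier over a finite conjunction remains. *)
Lemma lsc_on_psum K (g : nat -> X -> \bar R) : (forall n x, K x -> 0 <= g n x) ->
  lsc_on K g ->
  lsc_on K (fun n x => \sum_(l < (unpair n).2) g (cpair (unpair n).1 l) x).
Proof.
move=> g0 hg; apply: (@ce_open_on_ext _ _ _ (fun z x => exists w,
   [/\ (qr (nthc w 0) < qr (qnat 0) :> R)%R /\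
     (qr (unpair z).2 <= qr (nthc w (unpair (unpair z).1).2) :> R)%R &
   forall l, (l < (unpair (unpair z).1).2)%N -> exists b,
     (qr (nthc w l.+1) <= qr (qadd (nthc w l) b) :> R)%R /\
     (qr b)%:E < g (cpair (unpair (unpair z).1).1 l) x])).
  move=> z x Kx; move: (unpair z).1 (unpair z).2 => nm k.
  have e := @lte_sum_split (qr k) (fun l => g (cpair (unpair nm).1 l) x) (unpair nm).2
    (fun l => g0 _ _ Kx).
  split=> [[w [[w0 wm] hw]]|/e[s [s0 hs qs]]].
    apply/e; exists (nthc w); split => //; first by rewrite qr_nat in w0.
    by move=> l /hw[b]; rewrite qr_add; exists b.
  have [w hw] := nthc_ex s (unpair nm).2.+1; exists w; rewrite !hw // qr_nat.
  split => // l lt; have [b hb] := hs l lt; exists b.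
  by rewrite qr_add !hw // ltnW.
by sig.
Qed.

End lsc_sums.

(** Fatou's lemma. No monotonicity is asked for: Riemann sums with mesh [1 / j.+1] are not monotone
    in [j]. *)
Lemma integral_lim_le d (T : measurableType d) (R : realType) (mu : {measure set T -> \bar R})
    (u : nat -> T -> \bar R) (g : T -> \bar R) (n0 : nat) (c : \bar R) :
  (forall n x, (0 <= u n x)%E) -> (forall n, measurable_fun setT (u n)) ->
  (forall x, u n x @[n --> \oo] --> g x) ->
  (forall n, (n0 <= n)%N -> (\int[mu]_x u n x <= c)%E) -> (\int[mu]_x g x <= c)%E.
Proof.
move=> u0 mu_ ug hc.
apply: (@le_trans _ _ (limn_einf (fun j => \int[mu]_x u j x)%E)).
  apply: le_trans (fatou mu measurableT mu_ _); last by [].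
  rewrite le_eqVlt; apply/orP; left; apply/eqP; apply: eq_integral => x _.
  rewrite is_cvg_limn_einfE; last by apply/cvg_ex; exists (g x); exact: ug.
  by apply/esym/cvg_lim => //; exact: ug.
rewrite limn_einf_lim; apply: lime_le; first exact: is_cvg_einfs.
near=> j; apply: le_trans (hc j _); last by near: j; exact: nbhs_infty_ge.
by apply: ereal_inf_lbound; exists j => /=.
Unshelve. all: by end_near. Qed.

(** * Integrals as suprema of Riemann sums over level sets *)

Section integral.
Context d {T : measurableType d} {R : realType} (mu : {measure set T -> \bar R}).
Variable (g : T -> \bar R).
Hypotheses (g0 : forall x, (0 <= g x)%E) (mg : measurable_fun setT g).

Let level (D : R) (l : nat) : set T := [set x | ((l.+1%:R / D)%:E < g x)%E].

Lemma measurable_level D l : measurable (level D l).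
Proof. by rewrite /level -[X in measurable X]setTI; exact: emeasurable_fun_o_infty. Qed.

(** The sum counts the positive integers up to [L] strictly below [y], which is [ceil y - 1] cut off
    at 0 and at [L]. *)
Lemma count_bounds (y : R) L : (Num.min L%:R (y - 1) <= \sum_(l < L) (l.+1%:R < y)%R%:R :> R) /\
  (\sum_(l < L) (l.+1%:R < y)%R%:R <= Num.min L%:R (Num.max 0 y) :> R).
Proof.
elim: L => [|L [IH1 IH2]]; rewrite ?big_ord0 ?big_ord_recr /=.
  by rewrite ge_min lexx le_min lexx le_max lexx.
move: IH1 IH2; set S := \sum_(l < L) _; rewrite -natr1 => IH1 IH2.
have L0 : 0 <= L%:R :> R by [].
have [yL|Ly] := ltP (L%:R + 1) y.
  rewrite /= ge_min le_min le_max; move: IH1 IH2.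
  rewrite ge_min le_min le_max => /orP[] h1 /andP[h2 _]; (split; [apply/orP; left|apply/andP; split; [|apply/orP; right]]; lra).
rewrite /= addr0; split.
  by apply: le_trans IH1; rewrite !ge_min !le_min; apply/orP; right; apply/andP; split; lra.
by move: IH2; rewrite !le_min => /andP[h1 ->]; rewrite andbT; lra.
Qed.

(** Mesh [1 / j.+1] and truncation at height [j.+1], hence [j.+1 ^ 2] levels; with both tied to [j],
    a single limit suffices. *)
Let approx (j : nat) (x : T) : \bar R :=
  ((\sum_(l < j.+1 ^ 2) \1_(level j.+1%:R l) x) / j.+1%:R)%:E.

Let approxE j x (r : R) : g x = r%:E -> approx j x =
  ((\sum_(l < j.+1 ^ 2) (l.+1%:R < r * j.+1%:R)%R%:R) / j.+1%:R)%:E.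
Proof.
move=> gx; congr ((_ / _)%:E); apply: eq_bigr => l _.
have e : (l.+1%:R < r * j.+1%:R) = ((l.+1%:R / j.+1%:R)%:E < g x)%E.
  by rewrite gx lte_fin ltr_pdivrMr // ltr0n.
rewrite indicE e; congr (nat_of_bool _)%:R.
by apply/idP/idP => [/set_mem//|h]; apply/mem_set.
Qed.

Let approx_le j x : (approx j x <= g x)%E.
Proof.
case gx : (g x) => [r||]; [|exact: leey|by have := g0 x; rewrite gx].
rewrite (approxE j gx) lee_fin ler_pdivrMr ?ltr0n //.
apply: le_trans (proj2 (count_bounds _ _)) _.
rewrite ge_min; apply/orP; right; rewrite ge_max lexx andbT mulr_ge0 //.
by have := g0 x; rewrite gx lee_fin.
Qed.

Let approx_cvg x : approx j x @[j --> \oo] --> g x.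
Proof.
case gx : (g x) => [r||]; last by have := g0 x; rewrite gx.
  have r0 : 0 <= r by have := g0 x; rewrite gx lee_fin.
  have h : (r - 1 / j.+1%:R)%:E @[j --> \oo] --> r%:E.
    apply: cvg_EFin; first by apply: nearW.
    rewrite -[X in _ --> X]subr0; apply: cvgB; first exact: cvg_cst.
    rewrite (_ : (fun j => _) = harmonic); first exact: cvg_harmonic.
    by apply/funext => j; rewrite /= div1r.
  apply: (@squeeze_cvge _ _ _ _ (fun j => (r - 1 / j.+1%:R)%:E) _ (fun=> r%:E)) => //; last exact: cvg_cst.
  near=> j; apply/andP; split; last by rewrite -gx approx_le.
  rewrite (approxE j gx) lee_fin ler_pdivlMr ?ltr0n //.
  apply: le_trans (proj1 (count_bounds _ _)).
  rewrite mulrBl divfK ?pnatr_eq0 // le_min lexx andbT.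
  apply: (@le_trans _ _ (r * j.+1%:R)); first by rewrite gerBl.
  rewrite natrX expr2 ler_wpM2r //.
  apply: (@le_trans _ _ j%:R); last by rewrite ler_nat.
  by near: j; exact: nbhs_infty_ger.
have -> : (approx ^~ x) = (fun j => j.+1%:R%:E).
  apply/funext => j; rewrite /approx; congr EFin.
  rewrite (eq_bigr (fun=> 1)).
    by rewrite sumr_const card_ord natrX expr2 mulfK // pnatr_eq0.
  by move=> l _; rewrite indicE mem_set // /level /= gx ltey.
apply/cvgeyPge => A; near=> j; rewrite lee_fin.
apply: (@le_trans _ _ j%:R); last by rewrite ler_nat.
by near: j; exact: nbhs_infty_ger.
Unshelve. all: by end_near. Qed.

Let measurable_approx j : measurable_fun setT (approx j).
Proof.
apply/measurable_EFinP; apply: measurable_funM => //.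
by apply: measurable_sum => l; apply: measurable_indic; exact: measurable_level.
Qed.

Let approx_ge0 j x : (0 <= approx j x)%E.
Proof. by rewrite lee_fin divr_ge0 // sumr_ge0. Qed.

Let integral_approx j : (\int[mu]_x approx j x = (j.+1%:R^-1)%:E *
  \sum_(l < j.+1 ^ 2) mu (level j.+1%:R l))%E.
Proof.
rewrite /approx; under eq_integral do rewrite mulrC EFinM.
have hm : measurable_fun setT (fun x => (\sum_(l < j.+1 ^ 2) (\1_(level j.+1%:R l) x : R))%:E).
  by apply/measurable_EFinP; apply: measurable_sum => l; apply: measurable_indic; exact: measurable_level.
have h0 x : setT x -> (0 <= (\sum_(l < j.+1 ^ 2) (\1_(level j.+1%:R l) x : R))%:E)%E.
  by move=> _; rewrite lee_fin sumr_ge0.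
rewrite (ge0_integralZl_EFin mu measurableT h0 hm) //.
congr (_ * _)%E; under eq_integral do rewrite -sumEFin.
rewrite ge0_integral_sum //; last first.
  by move=> l; apply/measurable_EFinP; apply: measurable_indic; exact: measurable_level.
apply: eq_bigr => l _; rewrite integral_indic ?setIT //; exact: measurable_level.
Qed.

(* Lower Riemann sums, with mesh [1 / j.+1], of the layer cake integral of [g]. *)
Lemma lte_integral (q : R) : (q%:E < \int[mu]_x g x)%E <->
  exists j, ((q * j.+1%:R)%:E < \sum_(l < j.+1 ^ 2)
    mu [set x | ((l.+1%:R / j.+1%:R)%:E < g x)%E])%E.
Proof.
have eqv j : (q%:E < \int[mu]_x approx j x)%E <->
  ((q * j.+1%:R)%:E < \sum_(l < j.+1 ^ 2) mu (level j.+1%:R l))%E.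
  by rewrite integral_approx mulrC EFinM; rewrite lte_pdivlMl ?ltr0n // muleC.
split; last first.
  move=> [j /eqv h]; apply: lt_le_trans h _.
  by apply: ge0_le_integral.
apply: contraPP => /forallNP h; apply/negP; rewrite -leNgt.
have hq j : (\int[mu]_x approx j x <= q%:E)%E.
  by rewrite leNgt; apply/negP => /eqv; exact: h.
exact: (@integral_lim_le _ _ _ _ approx g 0 _ approx_ge0 measurable_approx approx_cvg (fun j _ => hq j)).
Qed.

End integral.

(** * Effective integration against kernels *)

Section effective_integral.
Context {R : realType} {X : computablePolishType R}.
Implicit Types (K : set X).
Local Open Scope ereal_scope.

Lemma ball_openP (x : X) (r : R) : open (ball x r : set X).
Proof.
rewrite openE => y; rewrite ballEmdist /= => xy.
apply/nbhs_ballP; exists (r - mdist x y)%R => /=; first by rewrite subr_gt0.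
move=> z; rewrite !ballEmdist /= => yz.
by have := metric_triangle x y z; lra.
Qed.

Lemma open_ce_open e : open (ce_open e : set X).
Proof. by apply: bigcup_open => k _; exact: ball_openP. Qed.

Lemma measurable_ce_open e : measurable (ce_open e : set (borel X)).
Proof. by apply: sub_sigma_algebra; exact: open_ce_open. Qed.

Lemma lsc_measurable (f : X -> \bar R) : lsc f ->
  measurable_fun setT (f : borel X -> \bar R).
Proof.
move=> [h _ hf]; apply: (measurability _ (ErealGenOInfty.measurableE R)) => // _ [_ [r ->] <-].
rewrite setTI (_ : _ @^-1` _ = \bigcup_(k in [set k | (r <= qr k)%R]) ce_open (h k)).
  by apply: bigcup_measurable => k _; exact: measurable_ce_open.
apply/seteqP; split=> x /=; rewrite in_itv /= andbT.
  case fx : (f x) => [s||] //.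
    rewrite lte_fin => /qr_dense[k /andP[rk ks]]; exists k; first exact: ltW.
    by rewrite -hf /= fx lte_fin.
  move=> _; have [|k /andP[rk _]] := @qr_dense R r (r + 1); first by lra.
  by exists k; [exact: ltW|rewrite -hf /= fx ltey].
by move=> [k rk]; rewrite -hf /=; apply: le_lt_trans; rewrite lee_fin.
Qed.

Lemma measure_le_on (mu : {measure set (borel X) -> \bar R}) K (A B : set (borel X)) :
  measurable (K : set (borel X)) -> mu (~` K) = 0 -> measurable A -> measurable B ->
  (forall x, K x -> A x -> B x) -> mu A <= mu B.
Proof.
move=> mK K0 mA mB AB; have mK' := measurableC mK.
have K0' : mu (~` K) <= 0 by rewrite K0.
rewrite -[leRHS]adde0; apply: (le_trans _ (le_trans (measureU2 mu mB mK') (leeD (lexx _) K0'))).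
apply: le_measure; rewrite ?inE //; first exact: measurableU.
by move=> x Ax; have [Kx|Kx] := pselect (K x); [left; exact: AB|right].
Qed.

Lemma measure_eq_on (mu : {measure set (borel X) -> \bar R}) K (A B : set (borel X)) :
  measurable (K : set (borel X)) -> mu (~` K) = 0 -> measurable A -> measurable B ->
  (forall x, K x -> A x <-> B x) -> mu A = mu B.
Proof.
move=> mK K0 mA mB AB.
by apply/eqP; rewrite eq_le !(measure_le_on mK K0) // => x /AB[].
Qed.

Lemma lsc_on_psum1 K (u : nat -> X -> \bar R) : (forall n x, K x -> 0 <= u n x) ->
  lsc_on K u -> lsc_on K (fun n x => \sum_(l < n) u l x).
Proof.
move=> u0 hu.
have hg : lsc_on K (fun p => u (unpair p).2).
  by apply: (lsc_on_comp (a := fun p => (unpair p).2) hu); comp.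
have := lsc_on_comp (a := cpair 0) (lsc_on_psum (fun n x => u0 (unpair n).2 x) hg) ltac:(comp).
apply: lsc_on_ext => n x _; rewrite unpairK /=.
by apply: eq_bigr => l _; rewrite unpairK.
Qed.

(* [K'] is the domain of the parameter of the kernel, [K] carries its measures. *)
Lemma lsc_on_integral K K' (kap : nat -> X -> {measure set (borel X) -> \bar R})
    (g : nat -> X -> \bar R) : measurable (K : set (borel X)) ->
  (forall n x, K' x -> kap n x (~` K) = 0) ->
  lsc_on K' (fun m x => kap (unpair m).1 x (ce_open (unpair m).2)) ->
  (forall m x, 0 <= g m x) ->
  (forall m, measurable_fun setT (g m : borel X -> \bar R)) -> lsc_on K g ->
  lsc_on K' (fun m x => \int[kap (unpair m).1 x]_y g (unpair m).2 y).
Proof.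
move=> mK kK hkap g0 mg /ce_open_on_index[h ch hh].
pose lev l j := qcode l.+1 0 j.+1.
pose G p x := kap (unpair (unpair (unpair p).1).1).1 x
  (ce_open (h (cpair (unpair (unpair (unpair p).1).1).2
     (lev (unpair p).2 (unpair (unpair p).1).2)))).
have hG : lsc_on K' G.
  have := lsc_on_comp hkap (a := fun p => cpair (unpair (unpair (unpair p).1).1).1
    (h (cpair (unpair (unpair (unpair p).1).1).2
     (lev (unpair p).2 (unpair (unpair p).1).2)))) ltac:(rewrite /lev /qcode; comp).
  by apply: lsc_on_ext => n x _; rewrite unpairK.
have hS := lsc_on_psum (fun n x _ => measure_ge0 _ _ : 0 <= G n x) hG.
apply: (@ce_open_on_ext _ _ _ (fun z x => exists j, (qr (qmul (unpair z).2 (qnat j.+1)))%:E <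
   \sum_(l < (unpair (cpair (cpair (unpair z).1 j) (j.+1 * j.+1))).2)
      G (cpair (unpair (cpair (cpair (unpair z).1 j) (j.+1 * j.+1))).1 l) x)); last first.
  apply: ce_open_on_ex; apply: (lsc_on2 hS (a := fun z => cpair (cpair (unpair (unpair z).1).1 (unpair z).2)
    ((unpair z).2.+1 * (unpair z).2.+1)) (b := fun z => qmul (unpair (unpair z).1).2 (qnat (unpair z).2.+1))); comp.
move=> z x Kx; move: (unpair z).1 (unpair z).2 => m k.
have e := lte_integral (kap (unpair m).1 x) (g0 (unpair m).2) (mg (unpair m).2) (qr k).
have eS j : \sum_(l < j.+1 ^ 2) kap (unpair m).1 x
      [set y | (l.+1%:R / j.+1%:R)%:E < g (unpair m).2 y] =
    \sum_(l < j.+1 * j.+1) G (cpair (cpair m j) l) x.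
  rewrite mulnn; apply: eq_bigr => l _; rewrite /G !unpairK /=.
  (* Level sets of [g] coincide with the c.e. open sets only on [K], which carries the measure. *)
  apply: (measure_eq_on mK (kK _ _ Kx)).
  - exact: (measurable_level (mg (unpair m).2)).
  - exact: measurable_ce_open.
  - move=> y Ky; rewrite -hh // unpairK /=.
    by rewrite /lev qr_code // subr0.
split=> [[j hj]|/e[j hj]].
  by apply/e; exists j; rewrite eS; move: hj; rewrite unpairK qr_mul qr_nat.
by exists j; rewrite unpairK qr_mul qr_nat /= -eS.
Qed.

(** The c.e. open sets that represent the levels of [f] on [K] make sense everywhere. Off [K] they
    need not be nested, so the extension takes the supremum of the rationals whose set contains the
    point, and of 0. *)
Lemma lsc_extend K (f : X -> \bar R) : (forall x, K x -> 0 <= f x) ->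
  lsc_on K (fun=> f) ->
  exists f', [/\ lsc f', forall x, 0 <= f' x & forall x, K x -> f' x = f x].
Proof.
move=> f0 hf.
have [h ch hh] := ce_open_on_index (@lsc_on2 _ _ _ (fun=> f) (fun=> 0%N) (fun z => z) hf ltac:(comp) ltac:(comp)).
pose S (x : X) : set (\bar R) := [set y | y = 0 \/ exists2 k, ce_open (R := R) (X := X) (h k) x & y = (qr k)%:E].
exists (fun x => ereal_sup (S x)); split.
- apply/lsc_on_lsc; apply: (@ce_open_on_ext _ _ _ (fun z x =>
     (qr (unpair z).2 < qr (qnat 0) :> R)%R \/ exists k, (qr (unpair z).2 < qr k :> R)%R /\ ce_open (h k) x)).
    move=> z x _; rewrite qr_nat; split.
      move=> [k0|[k [k1 hk]]]; apply/ereal_sup_gtP.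
        by exists 0; [left|rewrite lte_fin].
      by exists (qr k)%:E; [right; exists k|rewrite lte_fin].
    move=> /ereal_sup_gtP[_ [->|[k hk ->]]]; rewrite lte_fin => lt; [by left|right].
    by exists k.
  have hc := @ce_open_on_ce_open R X setT h ch.
  apply: ce_open_on_or; first by sig.
  apply: ce_open_on_ex; apply: ce_open_on_and; first by sig.
  by apply: ce_open_on_ce_open; comp.
- by move=> x; apply: ereal_sup_ubound; left.
- move=> x Kx; apply/eqP; rewrite eq_le; apply/andP; split.
    apply/ereal_supP => _ [->|[k hk ->]]; first exact: f0.
    by apply: ltW; apply/hh.
  rewrite leNgt; apply/negP => lt.
  have sup0 : 0 <= ereal_sup (S x) by apply: ereal_sup_ubound; left.
  have [r er] : exists r : R, ereal_sup (S x) = r%:E.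
    case: (ereal_sup (S x)) lt sup0 => [r||] //; first by exists r.
    by rewrite ltNge leey.
  have [k /andP[k1 k2]] : exists k, (r%:E < (qr k)%:E < f x).
    move: lt; rewrite er; case: (f x) => [s||] //.
      by rewrite lte_fin => /qr_dense[k hk]; exists k; rewrite !lte_fin.
    have [|k /andP[k1 _]] := @qr_dense R r (r + 1); first by lra.
    by exists k; rewrite lte_fin k1 ltey.
  have : (qr k)%:E <= ereal_sup (S x).
    by apply: ereal_sup_ubound; right; exists k => //; apply/hh.
  by rewrite er leNgt k1.
Qed.

End effective_integral.

(** * Schnorr tests from summable computable functions *)

Section schnorr.
Context {R : realType} {X : computablePolishType R} (nu : probability (borel X) R).
Implicit Types (K : set X).
Hypothesis comp_nu : computable_measure nu.
Local Open Scope ereal_scope.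

Lemma computable_measure_lsc : lsc_on (X := X) setT (fun m _ => nu (ce_open m)).
Proof. by apply: ce_open_on_cep; exact: ce_ce_pred. Qed.

(** The case of a kernel constantly equal to [nu], read off at a point on which nothing depends. *)
Lemma ce_pred_lt_integral K (g : nat -> X -> \bar R) : measurable (K : set (borel X)) ->
  nu (~` K) = 0 -> (forall m x, 0 <= g m x) ->
  (forall m, measurable_fun setT (g m : borel X -> \bar R)) -> lsc_on K g ->
  ce_pred (fun z => (qr (unpair z).2)%:E < \int[nu]_y g (unpair z).1 y).
Proof.
move=> mK nuK g0 mg hg.
have hkap : lsc_on (X := X) setT (fun m x => nu (ce_open (unpair m).2)).
  by apply: (lsc_on_comp (a := fun m => (unpair m).2) computable_measure_lsc); comp.
have h := lsc_on_integral (kap := fun _ _ => nu) mK (fun _ _ _ => nuK) hkap g0 mg hg.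
have := lsc_on_comp (a := cpair 0) h ltac:(comp).
move=> /ce_open_on_setT_cep; apply: ce_pred_ext => z.
by rewrite unpairK.
Qed.

Section engine.
Variables (K : set X) (T : nat -> X -> R).
Hypotheses (mK : measurable (K : set (borel X))) (nuK : nu (~` K) = 0).
Hypothesis T01 : forall i x, (0 <= T i x <= 1)%R.
Hypothesis mT : forall i, measurable_fun setT (T i : borel X -> R).
Hypothesis lscT : lsc_on K (fun i x => (T i x)%:E).
Hypothesis uscT : lsc_on K (fun i x => (1 - T i x)%:E).
Hypothesis intT : forall i, \int[nu]_x (T i x)%:E <= (2 ^- i)%:E.

Let P m x : \bar R := \sum_(l < m) (T l x)%:E.
Let S x : \bar R := ereal_sup (range (P ^~ x)).
Let a i : R := fine (\int[nu]_x (T i x)%:E).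

Let T0 i x : 0 <= (T i x)%:E.
Proof. by rewrite lee_fin; case/andP: (T01 i x). Qed.

Let T1 i x : 0 <= (1 - T i x)%:E.
Proof. by rewrite lee_fin subr_ge0; case/andP: (T01 i x). Qed.

Let mT1 l : measurable_fun setT (fun x : borel X => (T l x)%:E).
Proof. exact/measurable_EFinP. Qed.

Let mU l : measurable_fun setT (fun x : borel X => (1 - T l x)%:E).
Proof. by apply/measurable_EFinP; apply: measurable_funB. Qed.

Let aE i : \int[nu]_x (T i x)%:E = (a i)%:E.
Proof.
rewrite fineK // ge0_fin_numE; last exact: integral_ge0.
by apply: le_lt_trans (intT i) _; rewrite ltey.
Qed.

Let a_bnd i : (0 <= a i <= 2 ^- i)%R.
Proof. by rewrite -!lee_fin -aE intT integral_ge0. Qed.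

Let mP m : measurable_fun setT (P m : borel X -> \bar R).
Proof. by apply: emeasurable_sum => l _; exact: mT1. Qed.

Let intP m : \int[nu]_x P m x = (\sum_(l < m) a l)%:E.
Proof.
rewrite (ge0_integral_sum nu measurableT (fun l : 'I_m => mT1 l) (fun l x _ => T0 l x)).
by rewrite -sumEFin; apply: eq_bigr.
Qed.

Let intQ m : \int[nu]_x (\sum_(l < m) (1 - T l x)%:E) = (m%:R - \sum_(l < m) a l)%:E.
Proof.
rewrite (ge0_integral_sum nu measurableT (fun l : 'I_m => mU l) (fun l x _ => T1 l x)).
have -> : (m%:R = \sum_(l < m) 1 :> R)%R by rewrite sumr_const card_ord.
rewrite -sumrB -sumEFin; apply: eq_bigr => l _.
have : \int[nu]_x ((1 - T l x)%:E + (T l x)%:E) = 1.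
  under eq_integral do rewrite -EFinD subrK.
  by rewrite integral_cst // mul1e; exact: probability_setT.
rewrite (ge0_integralD nu measurableT (fun x _ => T1 l x) (mU l) (fun x _ => T0 l x) (mT1 l)).
by rewrite aE; case: (\int[nu]_x _) => // r [<-]; rewrite addrK.
Qed.

Let ndP x : nondecreasing_seq (P ^~ x).
Proof. by apply/nondecreasing_seqP => m; rewrite /P big_ord_recr /= leeDl. Qed.

Let P_cvg x : P ^~ x @ \oo --> S x.
Proof. exact: ereal_nondecreasing_cvgn. Qed.

Let mS : measurable_fun setT (S : borel X -> \bar R).
Proof. exact: (@emeasurable_fun_cvg _ (borel X) R setT P S mP (fun x _ => @P_cvg x)). Qed.

Let intS_cvg : \int[nu]_x P m x @[m --> \oo] --> \int[nu]_x S x.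
Proof.
have := @cvg_monotone_convergence _ _ _ nu setT measurableT P mP.
rewrite (_ : (fun x => limn (P^~ x)) = S); last first.
  by apply/funext => x; apply/cvg_lim => //; exact: P_cvg.
by apply => [n x _|x _]; [exact: sume_ge0|exact: ndP].
Qed.

(** [2 * 2 ^- n] is the sum of all [2 ^- l] with [l >= n], so [b] decreases to the integral of
    [S]. *)
Let b n : R := (\sum_(l < n) a l + 2 * 2 ^- n)%R.

Let b_dec n m : (n <= m)%N -> (b m <= b n)%R.
Proof.
elim: m => [|m IH]; first by rewrite leqn0 => /eqP ->.
rewrite leq_eqVlt => /orP[/eqP -> //|]; rewrite ltnS => /IH; apply: le_trans.
rewrite /b big_ord_recr /= exprS invfM mulrA mulfV ?pnatr_eq0 // mul1r.
by have /andP[_] := a_bnd m; lra.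
Qed.

Let sum_le_b n m : (\sum_(l < m) a l <= b n)%R.
Proof.
have pos k : (0 <= 2 ^- k :> R)%R by rewrite invr_ge0 exprn_ge0.
have [nm|/ltnW mn] := leqP n m.
  by apply: le_trans (b_dec nm); rewrite /b lerDl mulr_ge0.
apply: (@le_trans _ _ (\sum_(l < n) a l)%R); last by rewrite /b lerDl mulr_ge0.
rewrite (big_ord_widen _ a mn) big_mkcond /=; apply: ler_sum => l _.
by case: ifP => // _; case/andP: (a_bnd l).
Qed.

Let intS_le n : \int[nu]_x S x <= (b n)%:E.
Proof.
apply: (@cvge_to_le _ _ _ _ _ _ _ intS_cvg); apply: nearW => m.
by rewrite intP lee_fin.
Qed.

Let intS_ge m : (\sum_(l < m) a l)%:E <= \int[nu]_x S x.
Proof.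
rewrite -intP; apply: ge0_le_integral => //.
- by move=> x _; exact: sume_ge0.
- by move=> x _; apply: ereal_sup_ubound; exists m.
Qed.

(* The sum of the [T i], made lower semi-computable off [K], is a Schnorr test: its
   integral is approximated from above because each [1 - T i] is lsc as well. *)
Lemma schnorr_eventually x : SR nu x -> K x -> exists i0, forall i, (i0 <= i)%N -> (T i x < 1)%R.
Proof.
move=> SRx Kx.
have lscP : lsc_on K P := lsc_on_psum1 (fun n x _ => T0 n x) lscT.
have lscS : lsc_on K (fun=> S).
  apply: (@ce_open_on_ext _ _ _ (fun z x => exists m, (qr (unpair z).2)%:E < P m x)).
    move=> z y _; split=> [[m lt]|/ereal_sup_gtP[_ [m _ <-]]]; last by exists m.
    by apply/ereal_sup_gtP; exists (P m y) => //; exists m.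
  by sig.
have S0 y : 0 <= S y.
  by apply: (@le_trans _ _ (P 0%N y)); [rewrite /P big_ord0|apply: ereal_sup_ubound; exists 0%N].
have [f [lscf f0 fS]] := lsc_extend (fun y _ => S0 y) lscS.
have mf := lsc_measurable lscf.
have int_f : \int[nu]_x f x = \int[nu]_x S x.
  apply: ge0_ae_eq_integral => //.
  exists (~` K); split => //; first exact: measurableC.
  by move=> y /= h Ky; apply: h => _; exact: fS.
have [A eA] : exists A : R, \int[nu]_x S x = A%:E.
  have := intS_le 0; have := intS_ge 0; rewrite big_ord0.
  by case: (\int[nu]_x S x) => // A _ _; exists A.
have cA : computable_real A.
  apply: cuts_computable_reals; last first.
    have := ce_pred_lt_integral (g := fun=> f) measurableT _ (fun _ => f0) (fun _ => mf) (proj1 (lsc_on_lsc f) lscf).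
    rewrite setCT measure0 int_f eA => /(_ erefl).
    by apply: ce_pred_ext => z; rewrite lte_fin.
  have hQ : lsc_on K (fun m x => \sum_(l < m) (1 - T l x)%:E).
    exact: lsc_on_psum1 (fun n x _ => T1 n x) uscT.
  have mQ m : measurable_fun setT (fun x : borel X => \sum_(l < m) (1 - T l x)%:E).
    by apply: emeasurable_sum => l _; exact: mU.
  have h := ce_pred_lt_integral mK nuK (fun m x => sume_ge0 (fun (l : 'I_m) _ => T1 l x) _) mQ hQ.
  (* [A < q] iff [b n < q] for some [n], and the latter is a lower bound for the integral of the sum
     of the [1 - T l], [l < n]. *)
  apply: (@ce_pred_ext (fun z => exists n,
     (qr (qadd (qnat n) (qadd (qmul (qnat 2) (qexp2 n)) (qopp (unpair z).2))))%:E <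
      \int[nu]_x (\sum_(l < n) (1 - T l x)%:E))); last first.
    apply: ce_pred_ex.
    apply: (ce_pred2 (P := fun n k => (qr k)%:E < \int[nu]_x (\sum_(l < n) (1 - T l x)%:E))); last 2 first.
    - by comp.
    - by comp.
    - by apply: ce_pred_ext h.
  move=> z; move: (unpair z).2 => k; split.
    move=> [n]; rewrite intQ lte_fin !qr_add !qr_nat qr_mul qr_nat qr_opp qr_exp2 => lt.
    by have := intS_le n; rewrite eA lee_fin /b; lra.
  move=> Ak; have [|n hn] := @exp2_small R ((qr k - A) / 2); first by rewrite divr_gt0 ?subr_gt0.
  exists n; rewrite intQ lte_fin !qr_add !qr_nat qr_mul qr_nat qr_opp qr_exp2.
  by have := intS_ge n; rewrite eA lee_fin; lra.
have /SRx : schnorr_test nu 1 f.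
  split => //; exists A => //; rewrite Lnorm1 -eA -int_f.
  by apply: eq_integral => y _; rewrite gee0_abs.
rewrite fS // => Sfin.
have [M SM] : exists M : R, S x = M%:E.
  by case: (S x) (S0 x) Sfin => // M; exists M.
have : T ^~ x @ \oo --> 0%R.
  apply: cvg_series_cvg_0; apply: nondecreasing_is_cvgn.
    by apply: nondecreasing_series => i _ _; case/andP: (T01 i x).
  exists M => _ [m _ <-]; rewrite /series /= -lee_fin -SM big_mkord -sumEFin.
  by apply: ereal_sup_ubound; exists m.
move=> /cvgrPdist_lt/(_ 1%R ltr01)[i0 _ hi]; exists i0 => i /hi.
by rewrite sub0r normrN; apply: le_lt_trans; exact: ler_norm.
Qed.

End engine.

End schnorr.

(** * Schnorr random points are Kurtz random *)

Section kurtz.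
Context {R : realType} {X : computablePolishType R} (nu : probability (borel X) R).
Local Open Scope ereal_scope.

Lemma measurable_KR : measurable (KR nu : set (borel X)).
Proof.
rewrite (_ : KR nu = \bigcap_e (if nu (ce_open e) == 1 then ce_open e else setT)).
  apply: bigcapT_measurable => e; case: ifP => _ //; exact: measurable_ce_open.
apply/seteqP; split=> [x h e _|x h e e1]; first by case: ifP => // /eqP; exact: h.
by have := h e I; rewrite e1 eqxx.
Qed.

Lemma measure_KRC : nu (~` KR nu) = 0.
Proof.
apply: measure_negligible; first exact: measurableC measurable_KR.
rewrite (_ : ~` KR nu = \bigcup_e (if nu (ce_open e) == 1 then ~` ce_open e else set0)).
  apply: negligible_bigcup => e; case: ifPn => [/eqP e1|_]; last exact: negligible_set0.
  exists (~` ce_open e); split => //; first by apply: measurableC; exact: measurable_ce_open.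
  by have := probability_setC nu (measurable_ce_open e); rewrite e1 subee.
apply/seteqP; split=> x.
  move=> /existsNP[e /not_implyP[e1 ex]]; exists e => //.
  by move: e1 => ->; rewrite eqxx.
by move=> [e _]; case: ifPn => // /eqP e1 ex /(_ e e1).
Qed.

Hypothesis comp_nu : computable_measure nu.

Section full_ce_open.
Variables (D : nat -> nat -> bool) (U : set X).
Hypothesis decD : dec (fun z => D (unpair z).1 (unpair z).2).
Hypothesis UE : forall x : X, U x <-> exists k, (exists w, D k w) /\ cball k x.

Let rad (j : nat) : nat := qcode (unpair (unpair (unpair j).1).2).1.+1 0 (unpair (unpair (unpair j).1).2).2.+1.
Let ctr (j : nat) : nat := (unpair (unpair j).1).1.
Let act (j : nat) : bool := D (unpair j).1 (unpair j).2.

(** A continuous lower approximation of the indicator of [U]: [m] times the depth of [x] in the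
    first [m] balls, cut off at 1. Unlike the indicator it is computable from above as well, and it
    tends to the indicator because a point of [U] has positive depth in some ball. *)
Let ramp (m : nat) (x : X) : R :=
  Num.min 1%R (m%:R * \big[Num.max/0%R]_(j < m | act j) (qr (rad j) - mdist (ideal_point (ctr j)) x))%R.

Let rampP m x (q : R) : (q < ramp m x)%R <-> (q < 0)%R \/ ((q < 1)%R /\
  exists j, (j < m)%N /\ act j /\ (mdist (ideal_point (ctr j)) x < qr (rad j) - q / m%:R)%R).
Proof.
have m0 : (0 <= \big[Num.max/0%R]_(j < m | act j) (qr (rad j) - mdist (ideal_point (ctr j)) x))%R.
  exact: bigmax_ge_id.
rewrite /ramp lt_min; have [q0|q0] := ltP q 0%R.
  split=> _; first by left.
  by rewrite (lt_trans q0) //= (lt_le_trans q0) // mulr_ge0.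
split=> [/andP[q1]|[//|[q1 [j [jm [aj dj]]]]]].
  case: (posnP m) => [->|mpos]; first by rewrite mul0r ltNge q0.
  rewrite mulrC -ltr_pdivrMr ?ltr0n // => /bigmax_gtP[|[j aj lt]].
    by rewrite ltNge divr_ge0.
  by right; split => //; exists j; split => //; split => //; lra.
rewrite q1 /=; have mpos : (0 < m)%N by exact: leq_ltn_trans jm.
rewrite mulrC -ltr_pdivrMr ?ltr0n //; apply/bigmax_gtP; right.
by exists (Ordinal jm) => //=; lra.
Qed.

Let ramp_ltP m x (t : R) : (ramp m x < t)%R <-> (1 < t)%R \/ ((0 < t)%R /\
  forall j, (j < m)%N -> ~~ act j \/ (qr (rad j) - t / m%:R < mdist (ideal_point (ctr j)) x)%R).
Proof.
have m0 : (0 <= \big[Num.max/0%R]_(j < m | act j) (qr (rad j) - mdist (ideal_point (ctr j)) x))%R.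
  exact: bigmax_ge_id.
rewrite /ramp gt_min; split=> [/orP[h|h]|[h|[t0 h]]]; [by left| | by rewrite h |].
  have t0 : (0 < t)%R by apply: le_lt_trans h; rewrite mulr_ge0.
  right; split => // j jm; case: (boolP (act j)) => aj; [right|by left].
  move: h; rewrite mulrC -ltr_pdivlMr ?ltr0n ?(leq_ltn_trans _ jm) // => /bigmax_ltP[_ /(_ (Ordinal jm) aj)] /=.
  by lra.
apply/orP; right; case: (posnP m) => [->|mpos]; first by rewrite mul0r.
rewrite mulrC -ltr_pdivlMr ?ltr0n //; apply/bigmax_ltP; split; first by rewrite divr_gt0 ?ltr0n.
by move=> j aj; have [|] := h j (ltn_ord j); [rewrite aj|lra].
Qed.

Let ramp01 m x : (0 <= ramp m x <= 1)%R.
Proof.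
rewrite /ramp ge_min lexx /= le_min ler01 /= mulr_ge0 //.
exact: bigmax_ge_id.
Qed.

Let lsc_ramp : lsc_on setT (fun m x => (ramp m x)%:E).
Proof.
apply: (@ce_open_on_ext _ _ _ (fun z x => (qr (unpair z).2 < qr (qnat 0) :> R)%R \/
  ((qr (unpair z).2 < qr (qnat 1) :> R)%R /\ exists j, (j < (unpair z).1)%N /\
   (act j /\ (mdist (ideal_point (ctr j)) x <
     qr (qadd (rad j) (qopp (qmul (unpair z).2 (qcode 1 0 (unpair z).1)))))%R)))).
  (* [j < m] forces [m] to be positive, so [qcode 1 0 m] really stands for [1 / m] wherever it is
     used. *)
  move=> z x _; move: (unpair z).1 (unpair z).2 => m k; rewrite lte_fin rampP !qr_nat.
  split=> -[|[q1 [j [jm [aj dj]]]]]; [by left| | by left |]; right; split => //; exists j; split => //; split => //;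
    move: dj; rewrite qr_add qr_opp qr_mul qr_code ?(leq_ltn_trans _ jm) // subr0 mul1r //.
rewrite /act /ctr /rad /qcode; sig.
Qed.

Let usc_ramp : lsc_on setT (fun m x => (1 - ramp m x)%:E).
Proof.
apply: (@ce_open_on_ext _ _ _ (fun z x => (qr (unpair z).2 < qr (qnat 0) :> R)%R \/
  ((qr (unpair z).2 < qr (qnat 1) :> R)%R /\ forall j, (j < (unpair z).1)%N ->
   (~~ act j \/ (qr (qadd (rad j) (qopp (qmul (qadd (qnat 1) (qopp (unpair z).2)) (qcode 1 0 (unpair z).1)))) <
     mdist (ideal_point (ctr j)) x)%R)))).
  move=> z x _; move: (unpair z).1 (unpair z).2 => m k; rewrite lte_fin ltrBrDl -ltrBrDr ramp_ltP !qr_nat.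
  have e j : (j < m)%N -> qr (qadd (rad j) (qopp (qmul (qadd (qnat 1) (qopp k)) (qcode 1 0 m)))) =
     (qr (rad j) - (1 - qr k) / m%:R)%R.
    by move=> jm; rewrite qr_add qr_opp qr_mul qr_code ?(leq_ltn_trans _ jm) // subr0 mul1r qr_add qr_opp qr_nat.
  split=> -[h|[q1 h]]; [left; lra|right; split; first lra|left; lra|right; split; first lra];
    by move=> j jm; have := h j jm; rewrite e.
rewrite /act /ctr /rad /qcode; sig.
Qed.

Let measurable_ramp m : measurable_fun setT (ramp m : borel X -> R).
Proof.
apply/measurable_EFinP; apply: lsc_measurable; apply/lsc_on_lsc.
by apply: (lsc_on_comp (a := fun=> m) lsc_ramp); comp.
Qed.

Let ramp_out m x : ~ U x -> ramp m x = 0%R.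
Proof.
move=> Ux; apply/eqP; rewrite eq_le; case/andP: (ramp01 m x) => -> _; rewrite andbT.
rewrite leNgt; apply/negP => /rampP[|[_ [j [jm [aj]]]]]; first by rewrite ltxx.
rewrite mul0r subr0 => dj; apply: Ux; apply/UE; exists (unpair j).1; split; first by exists (unpair j).2.
by apply/cballE; rewrite posrat_qr.
Qed.

Let ramp_in x : U x -> exists n0, forall m, (n0 <= m)%N -> ramp m x = 1%R.
Proof.
move=> /UE[k [[w Dw] /cballE]]; rewrite posrat_qr => kx.
pose e := (qr (rad (cpair k w)) - mdist (ideal_point (ctr (cpair k w))) x)%R.
have e0 : (0 < e)%R by rewrite /e subr_gt0 /rad /ctr unpairK.
exists (maxn (cpair k w).+1 (Num.truncn e^-1).+1) => m.
rewrite geq_max => /andP[m1 m2]; apply/eqP; rewrite eq_le; case/andP: (ramp01 m x) => _ -> /=.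
rewrite /ramp le_min lexx /= -ler_pdivrMl ?ltr0n ?(leq_ltn_trans _ m1) // mulr1.
apply: (@le_trans _ _ e).
  rewrite invf_ple ?posrE ?ltr0n ?(leq_ltn_trans _ m1) //.
  by apply: ltW; apply: lt_le_trans (truncnS_gt _) _; rewrite ler_nat.
apply: (bigmax_sup (Ordinal m1)) => //.
by rewrite /act /= unpairK.
Qed.

Hypothesis nuU : nu U = 1.

(** The integrals of the ramps tend to [nu U = 1], and a computable subsequence does so fast.
    Outside [U] the complements of the ramps would keep the value 1, against
    [schnorr_eventually]. *)
Lemma SR_full x : SR nu x -> U x.
Proof.
move=> SRx.
have mU : measurable (U : set (borel X)).
  rewrite (_ : U = \bigcup_(k in [set k | exists w, D k w]) cball k).
    by apply: bigcup_measurable => k _; apply: sub_sigma_algebra; exact: ball_openP.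
  by apply/seteqP; split=> y; [move=> /UE[k [? ?]]; exists k|move=> [k ? ?]; apply/UE; exists k].
have nu0 : nu (~` [set: X]) = 0 by rewrite setCT measure0.
have ramp0 m y : 0 <= (ramp m y)%:E by rewrite lee_fin; case/andP: (ramp01 m y).
have mramp m : measurable_fun setT (fun y : borel X => (ramp m y)%:E) by apply/measurable_EFinP.
have hc := ce_pred_lt_integral comp_nu measurableT nu0 ramp0 mramp lsc_ramp.
have [||s cs hs] := @ce_pred_select (fun n m =>
    (qr (qadd (qnat 1) (qopp (qexp2 n))))%:E < \int[nu]_y (ramp m y)%:E).
- apply: (@ce_pred2 (fun m k => (qr k)%:E < \int[nu]_y (ramp m y)%:E)) => //; comp.
- move=> n; apply: contrapT => /forallNP h.
  suff : \int[nu]_y (\1_U y)%:E <= (1 - 2 ^- n)%:E.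
    have -> : \int[nu]_y (\1_U y)%:E = 1 by rewrite integral_indic // setIT; exact: nuU.
    rewrite lee_fin; apply/negP; rewrite -ltNge.
    by rewrite gtrBl invr_gt0 exprn_gt0.
  apply: (@integral_lim_le _ (borel X) R nu (fun m y => (ramp m y)%:E) _ 0) => //.
    move=> y; have [Uy|Uy] := pselect (U y).
      have [n0 hn0] := ramp_in Uy; rewrite indicE mem_set //.
      apply: cvg_near_cst; exists n0 => // m /= nm; by rewrite hn0.
    rewrite indicE memNset //; apply: cvg_near_cst; apply: nearW => m.
    by rewrite ramp_out.
  move=> m _; rewrite leNgt; apply/negP => lt; apply: (h m).
  by rewrite qr_add qr_opp qr_exp2 qr_nat.
apply: contrapT => Ux.
(* Each [T n] is 1 off [U] and has integral at most [2^-n]. *)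
pose T n y := (1 - ramp (s n) y)%R.
have T01 n y : (0 <= T n y <= 1)%R by have := ramp01 (s n) y; rewrite /T; lra.
have mT n : measurable_fun setT (T n : borel X -> R) by apply: measurable_funB.
have lT : lsc_on setT (fun n y => (T n y)%:E) by exact: (lsc_on_comp usc_ramp cs).
have uT : lsc_on setT (fun n y => (1 - T n y)%:E).
  apply: lsc_on_ext (lsc_on_comp lsc_ramp cs) => n y _.
  by rewrite /T opprB addrC subrK.
have iT n : \int[nu]_y (T n y)%:E <= (2 ^- n)%:E.
  have : \int[nu]_y ((T n y)%:E + (ramp (s n) y)%:E) = 1.
    under eq_integral do rewrite -EFinD subrK.
    by rewrite integral_cst // mul1e; exact: probability_setT.
  have T0 y : 0 <= (T n y)%:E by rewrite lee_fin; case/andP: (T01 n y).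
  have mTn : measurable_fun setT (fun y : borel X => (T n y)%:E) by apply/measurable_EFinP.
  rewrite (ge0_integralD nu measurableT (fun y _ => T0 y) mTn (fun y _ => ramp0 _ y) (mramp _)).
  have := hs n; rewrite qr_add qr_opp qr_exp2 qr_nat.
  have := integral_ge0 nu (fun y (_ : setT y) => T0 y).
  case: (\int[nu]_y (T n y)%:E) => [a||] //; case: (\int[nu]_y _) => [b||] //.
  by rewrite -EFinD => _ + [] ; rewrite !lte_fin lee_fin; lra.
have [i0 hi0] := schnorr_eventually comp_nu measurableT nu0 T01 mT lT uT iT SRx I.
by have := hi0 i0 (leqnn _); rewrite /T ramp_out // subr0 ltxx.
Qed.

End full_ce_open.

Lemma SR_KR x : SR nu x -> KR nu x.
Proof.
move=> SRx e nu1.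
have [D hD hE] := ce_pred2 ce_pred_enumerated (comp_const e) comp_id.
apply: (SR_full hD _ nu1 SRx) => y; split=> [[k /hE ek ky]|[k [/hE ek ky]]].
  by exists k.
by exists k.
Qed.

End kurtz.

(** * Boolean combinations of basic sets *)

Section bexp_effective.
Context {R : realType} {X : computablePolishType R} (nu : probability (borel X) R).

Let code_cases (u : nat) : [\/ u = (u %/ 3 * 3)%N, u = (u %/ 3 * 3 + 1)%N | u = (u %/ 3 * 3 + 2)%N].
Proof.
have := divn_eq u 3; have : (u %% 3 < 3)%N by rewrite ltn_pmod.
case: (u %% 3)%N => [|[|[|//]]] _ e; [apply: Or31|apply: Or32|apply: Or33]; rewrite {1}e ?addn0 //.
Qed.

(** With injectivity of the coding, this lets truth tables be indexed by all numbers. *)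
Lemma bexp_code_surj u : exists t, bexp_code t = u.
Proof.
elim/ltn_ind: u => u IH; case: (code_cases u) => e.
- by exists (Basic (u %/ 3)); rewrite /= -e.
- have [|t ht] := IH (u %/ 3)%N; first by lia.
  by exists (Compl t); rewrite /= ht -e.
- have [l1 l2] := unpair_leq (u %/ 3).
  have [|t ht] := IH (unpair (u %/ 3)).1; first by lia.
  have [|t' ht'] := IH (unpair (u %/ 3)).2; first by lia.
  by exists (Union t t'); rewrite /= ht ht' cpairK -e.
Qed.

Lemma bexp_code_inj t t' : bexp_code t = bexp_code t' -> t = t'.
Proof.
elim: t t' => [i|t IH|t IHt u IHu] [i'|t'|t' u'] //=; try lia.
- by move=> h; have -> : i = i' by lia.
- by move=> h; have /IH -> : bexp_code t = bexp_code t' by lia.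
- move=> h; have : cpair (bexp_code t) (bexp_code u) = cpair (bexp_code t') (bexp_code u') by lia.
  by move=> /(congr1 unpair); rewrite !unpairK => -[/IHt -> /IHu ->].
Qed.

Variable B : nat -> set X.
Hypothesis basisB : measure_computable_basis nu B.

Lemma measurable_bexp t : measurable (bexp_set B t : set (borel X)).
Proof.
have [[[b _ hb] _] _ _] := basisB.
elim: t => [i|t IH|t IHt u IHu] /=.
- by rewrite hb; exact: measurable_ce_open.
- exact: measurableC.
- exact: measurableU.
Qed.

Local Open Scope ereal_scope.

(** [B i] together with the complement of its effectively closed superset is a c.e. open set of
    measure 1, hence contains [KR]. This is why complements of basic sets are c.e. open on [KR]. *)
Lemma KR_basis : exists2 c, computable c &
  forall i x, KR nu x -> (~ B i x) <-> ce_open (R := R) (X := X) (c i) x.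
Proof.
have [[[b cb hb] _] _ [c cc hc]] := basisB.
exists c => // i x Kx; have [sub eqm] := hc i.
have mB : measurable (B i : set (borel X)) by rewrite hb; exact: measurable_ce_open.
split=> [Bx|cx Bx]; last exact: (sub x Bx).
have : ce_open_on setT (fun i (x : X) => ce_open (b i) x \/ ce_open (c i) x).
  by apply: ce_open_on_or; exact: ce_open_on_ce_open.
move=> /ce_open_on_index[h ch hh].
suff /Kx/(hh i x I)[] : nu (ce_open (h i)) = 1; [by rewrite -hb|by []|].
have -> : ce_open (h i) = B i `|` ce_open (c i).
  by apply/seteqP; split=> y; rewrite hb; [move=> /(hh i y I)|move=> ?; apply/hh].
have e := probability_setC nu (measurable_ce_open (X := X) (c i)).
have finc : nu (ce_open (c i)) \is a fin_num by rewrite fin_num_measure //; exact: measurable_ce_open.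
have e1 : nu (B i) = 1 - nu (ce_open (c i)) by rewrite -eqm; exact: e.
have disj : B i `&` ce_open (c i) = set0 by apply/seteqP; split=> // y [/sub].
apply: (eq_trans (measureU nu mB (measurable_ce_open (c i)) disj)).
apply: (eq_trans (congr1 (fun t => t + nu (ce_open (c i))) e1)).
exact: subeK.
Qed.

(** Instead of recursion over expressions, a truth table for all codes up to the given one is
    guessed and each entry is checked locally; this takes one existential quantifier over a finite
    conjunction. *)
Lemma ce_open_on_bexp : exists2 V : nat -> X -> Prop, ce_open_on (KR nu) V &
  forall t x, KR nu x -> V (bexp_code t) x <-> bexp_set B t x.
Proof.
have [[[b cb hb] _] _ _] := basisB; have [c cc hc] := KR_basis.
(* [nthc w u] is the truth value at [x] of the boolean expression with code [u]; the
   false basic expressions are witnessed by the complements [ce_open (c _)]. *)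
pose ok (w u : nat) (x : X) : Prop :=
  (((u %% 3 == 1) && ((nthc w u != 0) == (nthc w (u %/ 3) == 0)) ||
    (u %% 3 == 2) && ((nthc w u != 0) == ((nthc w (unpair (u %/ 3)).1 != 0) || (nthc w (unpair (u %/ 3)).2 != 0))))%N
  \/ (((u %% 3 == 0) && (nthc w u != 0))%N /\ ce_open (b (u %/ 3)%N) x))
  \/ (((u %% 3 == 0) && (nthc w u == 0))%N /\ ce_open (c (u %/ 3)%N) x).
exists (fun z x => exists w, (nthc w z != 0%N) /\ forall u, (u < z.+1)%N -> ok w u x).
  apply: ce_open_on_ex; apply: ce_open_on_and; first by sig.
  apply: (@ce_open_on_all _ _ _ (fun z u x => ok (unpair z).2 u x)); last by comp.
  apply: ce_open_on_or; first apply: ce_open_on_or; first by sig.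
    by apply: ce_open_on_and; [sig|apply: ce_open_on_ce_open; comp].
  by apply: ce_open_on_and; [sig|apply: ce_open_on_ce_open; comp].
have okP w u x : ok w u x <-> [\/ ((u %% 3 == 1) && ((nthc w u != 0) == (nthc w (u %/ 3) == 0)))%N,
    ((u %% 3 == 2) && ((nthc w u != 0) == ((nthc w (unpair (u %/ 3)).1 != 0) || (nthc w (unpair (u %/ 3)).2 != 0))))%N,
    ((u %% 3 == 0) && (nthc w u != 0))%N /\ ce_open (b (u %/ 3)%N) x |
    ((u %% 3 == 0) && (nthc w u == 0))%N /\ ce_open (c (u %/ 3)%N) x].
  split=> [[[/orP[]|]|]|[]].
  - by apply: Or41. - by apply: Or42. - by apply: Or43. - by apply: Or44.
  - by left; left; apply/orP; left. - by left; left; apply/orP; right.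
  - by left; right. - by right.
have d1 v : ((v * 3 + 1) %% 3 = 1 /\ (v * 3 + 1) %/ 3 = v)%N by lia.
have d2 v : ((v * 3 + 2) %% 3 = 2 /\ (v * 3 + 2) %/ 3 = v)%N by lia.
have d0 v : ((v * 3) %% 3 = 0 /\ (v * 3) %/ 3 = v)%N by lia.
move=> t x Kx; split.
  move=> [w [wt okw]]; suff h t' : (bexp_code t' <= bexp_code t)%N ->
      (nthc w (bexp_code t') != 0)%N <-> bexp_set B t' x.
    by apply/h.
  elim: t' => [i|t' IH|t1 IH1 t2 IH2] /= le.
  - have := okw _ le; have [e1 e2] := d0 i; rewrite okP e1 e2 /= => -[|//| |] //.
      by move=> [-> Bx]; split=> //; rewrite hb.
    move=> [/eqP -> /(hc i x Kx) nB]; split=> // /eqP //.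
  - have := okw _ le; have [e1 e2] := d1 (bexp_code t'); rewrite okP e1 e2 /=.
    move=> [/eqP -> |//|[]//|[]//]; have := IH ltac:(lia).
    by case: (_ == 0%N) => /= -[h1 h2]; split=> // h; [move=> /h2|exfalso; apply: h; exact: h1].
  - have := okw _ le; have [e1 e2] := d2 (cpair (bexp_code t1) (bexp_code t2)).
    have [l1 l2] := cpair_geq (bexp_code t1) (bexp_code t2).
    rewrite okP e1 e2 unpairK /= => -[//|/eqP ->|[]//|[]//].
    have := IH1 ltac:(lia); have := IH2 ltac:(lia).
    by do 2 case: (_ == 0%N) => /=; move=> [h1 h2] [h3 h4]; split=> //; (try by left; exact: h3); (try by right; exact: h1); move=> [/h4|/h2].
move=> tx; have [dc hdc] := choice bexp_code_surj.
pose s u : nat := if `[< bexp_set B (dc u) x >] then 1%N else 0%N.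
have sP t' : (s (bexp_code t') != 0)%N <-> bexp_set B t' x.
  by rewrite /s (bexp_code_inj (hdc (bexp_code t'))); case: asboolP.
have [w hw] := nthc_ex s (bexp_code t).+1.
exists w; split; first by rewrite hw //; apply/sP.
move=> u ut; apply/okP; rewrite -(hdc u).
have hw' v : (v <= u)%N -> nthc w v = s v by move=> vu; rewrite hw //; lia.
have := hdc u; case: (dc u) => [i|t'|t1 t2] /= e.
- have [e1 e2] := d0 i; rewrite e1 e2 /= e hw' //.
  have := sP (Basic i); rewrite /= e; case: (boolP (s u == 0%N)) => /= _ [h1 h2].
    by apply: Or44; split=> //; apply/(hc i x Kx) => /h2.
  by apply: Or43; split=> //; rewrite -hb; exact: h1.
- have [e1 e2] := d1 (bexp_code t'); apply: Or41; rewrite e1 e2 /= e !hw' //; last lia.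
  have := sP (Compl t'); have := sP t'; rewrite /= e.
  case: (s u == 0%N); case: (s (bexp_code t') == 0%N) => //= -[h1 h2] [h3 h4].
    by apply: h4 => /h2.
  by have := h3 isT (h1 isT).
- have [e1 e2] := d2 (cpair (bexp_code t1) (bexp_code t2)).
  have [l1 l2] := cpair_geq (bexp_code t1) (bexp_code t2).
  apply: Or42; rewrite e1 e2 unpairK /= e !hw' //; try lia.
  have := sP (Union t1 t2); have := sP t1; have := sP t2; rewrite /= e.
  case: (s u == 0%N); case: (s (bexp_code t1) == 0%N); case: (s (bexp_code t2) == 0%N) => //= -[h1 h2] [h3 h4] [h5 h6].
  - by have := h6 (or_intror (h1 isT)).
  - by have := h6 (or_introl (h3 isT)).
  - by have := h6 (or_introl (h3 isT)).
  - by have [/h4|/h2] := h5 isT.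
Qed.

End bexp_effective.

(** * Conditional expectations *)

Section doob.
Context {R : realType} {X : computablePolishType R} (nu : probability (borel X) R).
Variables (F : nat -> set_system X) (f : borel X -> \bar R) (e : nat -> borel X -> \bar R).
Hypothesis sF : forall n, sigma_algebra setT (F n).
Hypothesis mF : forall n, F n `<=` @measurable _ (borel X).
Hypothesis ndF : forall n, F n `<=` F n.+1.
Hypothesis f0 : forall x, (0 <= f x)%E.
Hypothesis mf : measurable_fun setT f.
Hypothesis fe : forall n, condexp_version nu (F n) f (e n).
Local Open Scope ereal_scope.

(** The event is split by the first time [m] at which [e m] exceeds [l]. That part, [C m], belongs
    to [F m], so [e m] and [f] have the same integral over it. *)
Lemma doob_maximal (l : R) N : (0 < l)%R ->
  l%:E * nu [set x | exists n, (n < N)%N /\ l%:E < e n x] <= \int[nu]_x f x.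
Proof.
move=> l0; pose G m : set (borel X) := [set x | exists n, (n < m)%N /\ l%:E < e n x].
pose H m : set (borel X) := [set x | l%:E < e m x].
have FH m : F m (H m).
  have [+ _ _] := fe m; move=> /(_ `]l%:E, +oo[%classic (emeasurable_itv _)).
  by congr (F m _); apply/seteqP; split=> x; rewrite /H /= in_itv /= andbT.
have FU n A B : F n A -> F n B -> F n (A `|` B).
  move=> FA FB; have [F0 _ Fb] := sF n; rewrite -bigcup2E; apply: Fb => -[|[|k]] //=.
have GS m : G m.+1 = G m `|` H m.
  apply/seteqP; split=> x.
    by move=> [n [+ h]]; rewrite ltnS leq_eqVlt => /orP[/eqP nm|nm]; [right; rewrite /H /= -nm|left; exists n].
  by move=> [[n [nm h]]|h]; [exists n; split=> //; exact: ltnW|exists m].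
have FG m : F m (G m).
  elim: m => [|m IH].
    suff -> : G 0%N = set0 by have [F0 _ _] := sF 0.
    by apply/seteqP; split=> // x [n []].
  by rewrite GS; apply: ndF; exact: FU.
pose C m := H m `\` G m.
have FC m : F m (C m).
  have [_ FD Fb] := sF m; have -> : C m = ~` (~` H m `|` G m).
    by apply/seteqP; split=> x; [move=> [h1 h2] [] //|move=> h; split; [apply: contrapT => nh; apply: h; left|move=> g; apply: h; right]].
  by rewrite -setTD; apply/FD/FU => //; rewrite -setTD; exact/FD/FH.
have mG m := mF (FG m); have mC m := mF (FC m).
have GS' m : G m.+1 = G m `|` C m.
  by rewrite GS /C setDE setUIr setUCr setIT.
have disj m : G m `&` C m = set0 by rewrite /C setDE setICA setICr setI0.
have hC m : l%:E * nu (C m) <= \int[nu]_(x in C m) f x.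
  have [_ ie <-] := fe m; last exact: FC.
  have me := measurable_int _ ie.
  rewrite -integral_cst; last exact: mC.
  apply: ge0_le_integral; first exact: mC.
  - by move=> x _; rewrite lee_fin ltW.
  - exact: measurable_cst.
  - exact: measurable_funS me.
  - by move=> x [h _]; exact: ltW.
suff hG m : l%:E * nu (G m) <= \int[nu]_(x in G m) f x.
  apply: le_trans (hG N) _.
  exact: (ge0_subset_integral nu (mG N) measurableT mf (fun x _ => f0 x) (@subsetT _ _)).
elim: m => [|m IH].
  have -> : G 0%N = set0 by apply/seteqP; split=> // x [n []].
  by rewrite measure0 mule0 integral_ge0.
have dis2 : [disjoint G m & C m] by rewrite disj_set2E disj.
rewrite GS' (ge0_integral_setU nu (mG m) (mC m)
  (measurable_funS measurableT (@subsetT _ _) mf) (fun x _ => f0 x) dis2).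
have mU : nu (G m `|` C m) = nu (G m) + nu (C m) by apply: measureU; [exact: mG|exact: mC|].
by rewrite mU ge0_muleDr //; exact: leeD.
Qed.

End doob.

Section measure_lemmas.
Context d {T : measurableType d} {R : realType}.
Local Open Scope ereal_scope.

Lemma ge0_le_integral_on (mu : {measure set T -> \bar R}) (S : set T) (f g : T -> \bar R) :
  measurable S -> mu (~` S) = 0 ->
  (forall x, 0 <= f x) -> measurable_fun setT f ->
  (forall x, 0 <= g x) -> measurable_fun setT g ->
  (forall x, S x -> f x <= g x) -> \int[mu]_x f x <= \int[mu]_x g x.
Proof.
move=> mS S0 f0 mf g0 mg fg.
apply: (ae_ge0_le_integral measurableT (fun x _ => f0 x) mf (fun x _ => g0 x) mg).
exists (~` S); split=> //; first exact: measurableC.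
by move=> x /= h Sx; apply: h => _; exact: fg.
Qed.

Lemma ge0_eq_integral_on (mu : {measure set T -> \bar R}) (S : set T) (f g : T -> \bar R) :
  measurable S -> mu (~` S) = 0 ->
  (forall x, 0 <= f x) -> measurable_fun setT f ->
  (forall x, 0 <= g x) -> measurable_fun setT g ->
  (forall x, S x -> f x = g x) -> \int[mu]_x f x = \int[mu]_x g x.
Proof.
move=> mS S0 f0 mf g0 mg fg; apply/eqP; rewrite eq_le.
by rewrite !(ge0_le_integral_on mS S0) // => x Sx; rewrite fg.
Qed.

Lemma measurable_gt (v : T -> R) : (forall q : R, measurable [set x | (q < v x)%R]) ->
  measurable_fun setT v.
Proof.
move=> h; apply: (measurability _ (RGenOInfty.measurableE R)) => // _ [_ [r ->] <-].
rewrite setTI; have := h r; congr measurable.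
by apply/seteqP; split=> x /=; rewrite in_itv /= andbT.
Qed.

Lemma measurable_bigmax (v : nat -> T -> R) m : (forall n, measurable_fun setT (v n)) ->
  measurable_fun setT (fun x => \big[Num.max/0%R]_(n < m) v n x).
Proof.
move=> mv; apply: measurable_gt => q.
have [q0|q0] := ltP q 0%R.
  rewrite (_ : [set x | _] = setT) //; apply/seteqP; split=> // x _ /=.
  by apply: lt_le_trans q0 _; exact: bigmax_ge_id.
rewrite (_ : [set x | _] = \big[setU/set0]_(n < m) [set x | (q < v n x)%R]).
  apply: bigsetU_measurable => n _; rewrite -[X in measurable X]setTI.
  have := mv n measurableT `]q, +oo[%classic (measurable_itv _).
  by congr measurable; apply/seteqP; split=> x [] _ /=; rewrite in_itv /= andbT.
rewrite -(bigcup_mkord m (fun n => [set x | (q < v n x)%R])); apply/seteqP; split=> x /=.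
  move=> /bigmax_gtP[|[n _ lt]]; first by rewrite ltNge q0.
  by exists n => //=.
by move=> [n nm lt]; apply/bigmax_gtP; right; exists (Ordinal nm).
Qed.

End measure_lemmas.

(** * Convergence along the filtration at Schnorr random points *)

Section levy.
Context {R : realType} {X : computablePolishType R} (nu : probability (borel X) R).
Variables (F : nat -> set_system X) (rho : nat -> R.-ftker borel X ~> borel X).
Hypothesis comp_nu : computable_measure nu.
Hypothesis kurtz : uniform_kurtz_disintegrations nu F rho.
Hypothesis ndF1 : forall n, F n `<=` F n.+1.
Variables (B : nat -> set X) (t : nat -> nat -> bexp).
Hypothesis basisB : measure_computable_basis nu B.
Let A n m := bexp_set B (t n m).
Hypothesis comp_t : computable (fun k => bexp_code (t (unpair k).1 (unpair k).2)).
Hypothesis FE : forall n, F n = <<s range (A n) >>.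
Variable gg : nat -> nat.
Hypothesis comp_gg : computable gg.
Hypothesis ggE : forall e, ce_open e `&` KR nu =
  (\bigcup_(k in enumerated (gg e)) A (unpair k).1 (unpair k).2) `&` KR nu.
Local Open Scope ereal_scope.
Local Notation K := (KR nu).

Let mK : measurable (K : set (borel X)) := measurable_KR nu.

Let sF n : sigma_algebra setT (F n).
Proof. by rewrite FE; exact: smallest_sigma_algebra. Qed.

Let mA n m : measurable (A n m : set (borel X)).
Proof. exact: measurable_bexp basisB _. Qed.

Let FA n m : F n (A n m).
Proof. by rewrite FE; apply: sub_sigma_algebra; exists m. Qed.

Let mF n : F n `<=` @measurable _ (borel X).
Proof.
rewrite FE; apply: smallest_sub; first exact: sigma_algebra_measurable.
by move=> _ [m _ <-]; exact: mA.
Qed.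

Let ndF n m : (n <= m)%N -> F n `<=` F m.
Proof.
elim: m => [|m IH]; first by rewrite leqn0 => /eqP ->.
rewrite leq_eqVlt => /orP[/eqP -> //|]; rewrite ltnS => /IH nm.
exact: subset_trans nm (@ndF1 m).
Qed.

(** The sets that do not separate [x] from [y] form a sigma-algebra, so the countably many
    generators determine the atom. *)
Lemma measurable_atom n x : measurable (atom (F n) x : set (borel X)).
Proof.
rewrite (_ : atom (F n) x = \bigcap_m (if `[< A n m x >] then A n m else ~` A n m)).
  apply: bigcapT_measurable => m; case: ifP => _; first exact: mA.
  exact: measurableC (@mA n m).
apply/seteqP; split=> y.
  move=> h m _; have := h _ (FA n m); case: asboolP => Ax [h1 h2]; first exact: h2.
  by move=> /h1.
move=> h; have : F n `<=` [set S | S y <-> S x].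
  rewrite FE; apply: smallest_sub.
    split=> //=.
    - by move=> S e; split=> -[_ h']; split=> // /e.
    - by move=> S e; split=> -[i _ Si]; exists i => //; exact/e.
  move=> _ [m _ <-] /=; have := h m I; case: asboolP => Ax; first by split.
  by move=> Ay; split.
by move=> sub A' FA'; exact: (sub _ FA').
Qed.

Lemma disint_setT n x : K x -> rho n x setT = 1.
Proof. by have [_ /(_ n x) h _] := kurtz => /h[]. Qed.

Let S n x : set (borel X) := atom (F n) x `&` K.

Let mS n x : measurable (S n x).
Proof. by apply: measurableI => //; exact: measurable_atom. Qed.

Lemma disint_atomC n x : K x -> rho n x (~` S n x) = 0.
Proof.
move=> Kx; have [_ /(_ n x Kx)[h1 h2] _] := kurtz.
have := measureU (rho n x) (mS n x) (measurableC (mS n x)) (setICr _).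
rewrite setUCr => e3.
have : 1 = 1 + rho n x (~` S n x).
  exact: (eq_trans (esym h1) (eq_trans e3 (congr1 (fun z => z + _) h2))).
case: (rho n x (~` S n x)) (measure_ge0 (rho n x) (~` S n x)) => [r||] //.
by move=> _; rewrite -EFinD => -[h]; congr EFin; lra.
Qed.

Lemma disint_KRC n x : K x -> rho n x (~` (K : set (borel X))) = 0.
Proof.
move=> Kx; apply/eqP; rewrite eq_le measure_ge0 andbT -(disint_atomC n Kx).
apply: le_measure; rewrite ?inE; [exact: measurableC|exact: measurableC|].
by move=> y nK [_ /nK].
Qed.

Lemma disint_lsc K' : lsc_on K' (fun m x => rho (unpair m).1 x (ce_open (unpair m).2)).
Proof.
have [_ _ [h ch hh]] := kurtz.
apply: (@ce_open_on_ext _ _ _ (fun z => ce_open (h (cpair (unpair z).1 (unpair z).2)))).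
  by move=> z x _; rewrite -hh.
by apply: ce_open_on_ce_open; comp.
Qed.

(** Almost fullness puts [x] into some [A k m] that lies inside the open set on [KR]. For [n >= k]
    the whole atom of [x] lies in it, and the atom has full mass. *)
Lemma disint_ce_open e x : K x -> ce_open e x ->
  exists n0, forall n, (n0 <= n)%N -> rho n x (ce_open e) = 1.
Proof.
move=> Kx ex; have : (ce_open e `&` K) x by [].
rewrite ggE => -[[k ke Ax] _]; exists (unpair k).1 => n kn.
apply/eqP; rewrite eq_le; apply/andP; split.
  rewrite -(disint_setT n Kx); apply: le_measure; rewrite ?inE //.
  exact: measurable_ce_open.
have [_ /(_ n x Kx)[_ <-] _] := kurtz.
apply: le_measure; rewrite ?inE; [exact: mS|exact: measurable_ce_open|].
move=> y [ay Ky]; suff : (ce_open e `&` K) y by case.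
by rewrite ggE; split=> //; exists k => //; apply/(ay _ (ndF kn (FA _ _))).
Qed.

(** From some time on, [rho n x] is carried by the c.e. open set where [f] exceeds a rational above
    [q]. This gives the lower half of the convergence, and divergence where [f] is infinite. *)
Lemma disint_exp_lsc_ge (f : X -> \bar R) x (q : R) : K x -> lsc f -> (forall y, 0 <= f y) ->
  q%:E < f x -> exists n0, forall n, (n0 <= n)%N -> q%:E <= disint_exp (rho n) f x.
Proof.
move=> Kx lf f0 qf.
have [q0|q0] := ltP q 0%R.
  exists 0%N => n _; apply: (@le_trans _ _ 0); first by rewrite lee_fin ltW.
  exact: integral_ge0.
have mf := lsc_measurable lf.
have [h ch hh] := lf.
have [k /andP[qk kf]] : exists k, (q%:E < (qr k)%:E < f x).
  move: qf; case: (f x) => [r||] //.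
    by rewrite lte_fin => /qr_dense[k hk]; exists k; rewrite !lte_fin.
  have [|k /andP[k1 _]] := @qr_dense R q (q + 1); first by lra.
  by exists k; rewrite lte_fin k1 ltey.
have [|n0 hn0] := @disint_ce_open (h k) x Kx; first by rewrite -hh.
exists n0 => n /hn0 e1; apply: (@le_trans _ _ (qr k)%:E); first exact: ltW.
have k0 : (0 <= qr k :> R)%R by rewrite lte_fin in qk; apply: ltW; exact: le_lt_trans qk.
have mU : measurable (ce_open (h k) : set (borel X)) := measurable_ce_open (h k).
have e2 : (qr k)%:E * \int[rho n x]_y (\1_(ce_open (h k)) y)%:E = (qr k)%:E.
  rewrite integral_indic // setIT.
  exact: (eq_trans (congr1 (fun z => (qr k)%:E * z) e1) (mule1 _)).
apply: (@le_trans _ _ (\int[rho n x]_y ((qr k)%:E * (\1_(ce_open (h k)) y)%:E))).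
  rewrite ge0_integralZl_EFin ?e2 //; exact/measurable_EFinP/measurable_indic.
apply: ge0_le_integral => //.
- by move=> y _; rewrite mule_ge0 // lee_fin.
- by apply/measurable_EFinP; apply: measurable_funM => //; exact: measurable_indic.
- move=> y _; rewrite indicE; case: (boolP (y \in _)) => yU; last by rewrite mule0.
  rewrite mule1; apply: ltW; move: yU; rewrite inE -hh //.
Qed.

Section approximation.
Variables (g : X -> \bar R) (a : R).
Hypothesis g0 : forall y, 0 <= g y.
Hypothesis lsc_g : lsc g.
Hypothesis int_g : \int[nu]_y (g : borel X -> \bar R) y = a%:E.
Hypothesis comp_a : computable_real a.

Variables (h : nat -> nat) (D : nat -> nat -> bool).
Hypothesis hE : forall k, [set x | (qr k)%:E < g x] = ce_open (h k).
Hypothesis dec_D : dec (fun z => D (unpair z).1 (unpair z).2).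
Hypothesis DE : forall kc, enumerated (gg (h (unpair kc).1)) (unpair kc).2 <-> exists w, D kc w.

(* An index [j] codes a rational [q j], a set [A (I j)] of [F (tm j)] and a witness
   that [A (I j)] occurs in the enumeration of [[g > q j]] on [KR]. *)
Let q (j : nat) : nat := (unpair (unpair j).1).1.
Let I (j : nat) : nat := (unpair (unpair j).1).2.
Let tm (j : nat) : nat := (unpair (I j)).1.
Let act (j : nat) : bool := D (unpair j).1 (unpair j).2.
Let AI (c : nat) : set X := A (unpair c).1 (unpair c).2.

(** Defined from the sets [A] and not from the c.e. open level sets, so that it is constant on late
    atoms and, on [KR], computable from both sides. The maximum over no index is 0. *)
Let s (m : nat) (y : X) : R :=
  \big[Num.max/0%R]_(j < m | act j && `[< AI (I j) y >]) qr (q j).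

Let s_gtP m y (r : R) : (r < s m y)%R <-> (r < 0)%R \/
  exists j, ((j < m)%N && act j && (r < qr (q j))%R) /\ AI (I j) y.
Proof.
split=> [/bigmax_gtP[r0|[j /andP[aj /asboolP Aj] lt]]|h']; [by left|right|].
  by exists j; rewrite ltn_ord aj.
apply/bigmax_gtP; case: h' => [r0|[j [/andP[/andP[jm aj] lt] Aj]]]; [by left|right].
by exists (Ordinal jm) => //=; rewrite aj; apply/asboolP.
Qed.

Let s_ltP m y (r : R) : (s m y < r)%R <-> (0 < r)%R /\
  forall j, (j < m)%N -> (~~ act j || (qr (q j) < r)%R) \/ ~ AI (I j) y.
Proof.
split=> [/bigmax_ltP[r0 hm]|[r0 hm]].
  split=> // j jm; have [Aj|nAj] := pselect (AI (I j) y); [left|by right].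
  case: (boolP (act j)) => //= aj; apply: (hm (Ordinal jm)) => /=.
  by rewrite aj; apply/asboolP.
apply/bigmax_ltP; split=> // j /andP[aj /asboolP Aj].
by have [|//] := hm j (ltn_ord j); rewrite aj.
Qed.

Let s0 m y : (0 <= s m y)%R.
Proof. exact: bigmax_ge_id. Qed.

Let s_mono m m' y : (m <= m')%N -> (s m y <= s m' y)%R.
Proof.
move=> mm; rewrite leNgt; apply/negP => /s_gtP[|[j [/andP[/andP[jm aj] lt] Aj]]].
  by rewrite ltNge s0.
suff : (s m' y < s m' y)%R by rewrite ltxx.
by apply/s_gtP; right; exists j; rewrite (leq_trans jm mm) aj lt.
Qed.

Let s_le m y : (s m y <= m%:R)%R.
Proof.
rewrite leNgt; apply/negP => /s_gtP[|[j [/andP[/andP[jm aj] lt] Aj]]].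
  by rewrite ltNge ler0n.
move: lt; apply/negP; rewrite -leNgt; apply: le_trans (qr_leq _) _; rewrite ler_nat.
apply: ltnW; apply: leq_ltn_trans jm.
by have := unpair_leq j; have := unpair_leq (unpair j).1; rewrite /q; lia.
Qed.

Let act_g j y : K y -> act j -> AI (I j) y -> (qr (q j))%:E < g y.
Proof.
move=> Ky aj Aj; have en : enumerated (gg (h (q j))) (I j) by apply/DE; exists (unpair j).2.
have : ((\bigcup_(k in enumerated (gg (h (q j)))) A (unpair k).1 (unpair k).2) `&` K) y.
  by split=> //; exists (I j).
by rewrite -ggE -hE => -[].
Qed.

Let s_le_g m y : K y -> (s m y)%:E <= g y.
Proof.
move=> Ky; rewrite leNgt; apply/negP => lt.
have [r er] : exists r : R, g y = r%:E.
  by case: (g y) (g0 y) lt => // r; exists r.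
move: lt; rewrite er lte_fin => /s_gtP[|[j [/andP[/andP[jm aj] lt] Aj]]].
  by apply/negP; rewrite -leNgt -lee_fin -er.
by have := act_g Ky aj Aj; rewrite er lte_fin ltNge (ltW lt).
Qed.

Let s_sup y (r : R) : K y -> r%:E < g y -> exists m, (r < s m y)%R.
Proof.
move=> Ky rg.
have [k [rk kg]] : exists k, (r < qr k)%R /\ (qr k)%:E < g y.
  move: rg; case: (g y) => [u||] //.
    by rewrite lte_fin => /qr_dense[k /andP[? ?]]; exists k; rewrite lte_fin.
  have [|k /andP[k1 _]] := @qr_dense R r (r + 1); first by lra.
  by exists k; rewrite ltey.
have : (ce_open (h k) `&` K) y by split=> //; rewrite -hE.
rewrite ggE => -[[c ce Ac] _].
have [|w Dw] := proj1 (DE (cpair k c)); first by rewrite unpairK.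
exists (cpair (cpair k c) w).+1; apply/s_gtP; right; exists (cpair (cpair k c) w).
by rewrite /act /q /I /AI !unpairK leqnn Dw rk.
Qed.

Let s_local n x y m : (forall j, (j < m)%N -> (tm j <= n)%N) -> atom (F n) x y ->
  s m y = s m x.
Proof.
move=> tmn axy; apply: eq_bigl => j; congr (_ && _).
have e := axy _ (ndF (tmn j (ltn_ord j)) (FA (tm j) (unpair (I j)).2)).
by apply/idP/idP => /asboolP hA; apply/asboolP; apply/e.
Qed.

Let ms m : measurable_fun setT (s m : borel X -> R).
Proof.
have -> : s m = (fun y => \big[Num.max/0%R]_(j < m) if act j && `[< AI (I j) y >] then qr (q j) else 0%R).
  by apply/funext => y; rewrite /s bigmax_mkcond.
apply: (@measurable_bigmax _ (borel X) R (fun j y => if act j && `[< AI (I j) y >] then qr (q j) else 0%R)) => j.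
case: (act j) => /=; last exact: measurable_cst.
rewrite (_ : (fun y => _) = (fun y => qr (q j) * \1_(AI (I j)) y)%R).
  by apply: measurable_funM => //; apply: measurable_indic; exact: mA.
apply/funext => y; rewrite indicE; case: asboolP => Ay.
  by rewrite mem_set // mulr1.
by rewrite memNset // mulr0.
Qed.

(** The limit of the [s m] at every point. It is known to equal [g] only on [KR], off which a set
    [A] may stick out of the level set that it helps to cover. *)
Let sup_s y : \bar R := ereal_sup (range (fun m => (s m y)%:E)).

Let s_le_sup m y : (s m y)%:E <= sup_s y.
Proof. by apply: ereal_sup_ubound; exists m. Qed.

Let s_cvg y : (s m y)%:E @[m --> \oo] --> sup_s y.
Proof. by apply: ereal_nondecreasing_cvgn => m m' mm; rewrite lee_fin s_mono. Qed.

Let sup_s_g y : K y -> sup_s y = g y.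
Proof.
move=> Ky; apply/eqP; rewrite eq_le; apply/andP; split.
  by apply/ereal_supP => _ [m _ <-]; exact: s_le_g.
rewrite leNgt; apply/negP => lt.
have [r er] : exists r : R, sup_s y = r%:E.
  have := s_le_sup 0 y; case: (sup_s y) lt => [r||] //; first by exists r.
  by rewrite ltNge leey.
move: lt; rewrite er => /(s_sup Ky)[m]; apply/negP; rewrite -leNgt -lee_fin -er.
exact: s_le_sup.
Qed.

Let sup_s0 y : 0 <= sup_s y.
Proof. by apply: le_trans (s_le_sup 0 y); rewrite lee_fin. Qed.

Let ms' m : measurable_fun setT (fun y : borel X => (s m y)%:E).
Proof. exact/measurable_EFinP. Qed.

Let msup_s : measurable_fun setT (sup_s : borel X -> \bar R).
Proof.
exact: (@emeasurable_fun_cvg _ (borel X) R setT (fun m y => (s m y)%:E) sup_s ms' (fun x _ => @s_cvg x)).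
Qed.

Let nuKC : nu (~` K) = 0 := measure_KRC nu.

Let int_sup_s : \int[nu]_y sup_s y = a%:E.
Proof.
rewrite -int_g; apply: (ge0_eq_integral_on mK nuKC) => //.
exact: lsc_measurable.
Qed.

Let tc (c : nat) : nat := bexp_code (t (unpair c).1 (unpair c).2).

(** [tc c * 3 + 1] codes the complement, so the same [V] serves lower and upper bounds for [s]. *)
Let ce_open_on_AI : exists2 V : nat -> X -> Prop, ce_open_on K V &
  forall c x, K x -> (V (tc c) x <-> AI c x) /\ (V (tc c * 3 + 1)%N x <-> ~ AI c x).
Proof.
have [V sV hV] := ce_open_on_bexp basisB; exists V => // c x Kx; split; first exact: hV.
exact: (hV (Compl (t (unpair c).1 (unpair c).2)) x Kx).
Qed.

Let comp_tc : computable tc := comp_t.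

Let lsc_s : ce_open_on K (fun z y => (qr (unpair z).2 < s (unpair z).1 y)%R).
Proof.
have [V sV hV] := ce_open_on_AI.
apply: (@ce_open_on_ext _ _ _ (fun z y => (qr (unpair z).2 < qr (qnat 0) :> R)%R \/
  exists j, ((j < (unpair z).1)%N && act j && (qr (unpair z).2 < qr (q j) :> R)%R) /\ V (tc (I j)) y)).
  move=> z y Ky; rewrite s_gtP qr_nat.
  split=> -[|[j [hj Vj]]]; [by left|right|by left|right]; exists j; split=> //; exact/(hV _ _ Ky).1.
by rewrite /act /q /I; sig.
Qed.

Let usc_s : ce_open_on K (fun z y => (s (unpair z).1 y < qr (unpair z).2)%R).
Proof.
have [V sV hV] := ce_open_on_AI.
apply: (@ce_open_on_ext _ _ _ (fun z y => (qr (qnat 0) < qr (unpair z).2 :> R)%R /\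
  forall j, (j < (unpair z).1)%N -> (~~ act j || (qr (q j) < qr (unpair z).2 :> R)%R) \/ V (tc (I j) * 3 + 1)%N y)).
  move=> z y Ky; rewrite s_ltP qr_nat.
  split=> -[h1 h2]; split=> // j /h2[]; [by left|move=> ?; right; exact/(hV _ _ Ky).2|by left|move=> /(hV _ _ Ky).2 ?; by right].
by rewrite /act /q /I; sig.
Qed.

Let lsc_s' : lsc_on K (fun m y => (s m y)%:E).
Proof. by apply: ce_open_on_ext lsc_s => z y _; rewrite lte_fin. Qed.

(** The comparison becomes c.e. by guessing a rational [b > a] with [b - 4^-i] below the integral.
    The selected [mm] need not be monotone; [i <= mm i] still makes it tend to infinity. *)
Let select : exists2 mm : nat -> nat, computable mm & forall i,
  (i <= mm i)%N /\ (a - 4 ^- i)%:E < \int[nu]_y (s (mm i) y)%:E.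
Proof.
have [cu cl] := computable_reals_cuts comp_a.
have s0' m y : 0 <= (s m y)%:E by rewrite lee_fin.
have hc := ce_pred_lt_integral comp_nu mK nuKC s0' ms' lsc_s'.
have [||mm cm hm] := @ce_pred_select (fun i m => (i <= m)%N /\ exists b, (a < qr b)%R /\
   (qr (qadd b (qopp (qexp2 (2 * i)))))%:E < \int[nu]_y (s m y)%:E).
- apply: ce_pred_and; first by apply: ce_pred_dec; comp.
  apply: ce_pred_ex; apply: ce_pred_and.
    by apply: (@ce_pred2 (fun _ k => (a < qr k)%R) (fun=> 0%N)) => //; comp.
  by apply: (@ce_pred2 (fun m k => (qr k)%:E < \int[nu]_y (s m y)%:E)) => //; comp.
- move=> i; apply: contrapT => /forallNP nex.
  have [|b /andP[b1 b2]] := @qr_dense R a (a + 2 ^- (2 * i)).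
    by rewrite ltrDl invr_gt0 exprn_gt0.
  suff : a%:E <= (qr b - 2 ^- (2 * i))%:E by rewrite lee_fin; lra.
  rewrite -int_sup_s; apply: (@integral_lim_le _ (borel X) R nu (fun m y => (s m y)%:E) _ i) => //.
  move=> m im; rewrite leNgt; apply/negP => lt; apply: (nex m); split=> //.
  by exists b; rewrite qr_add qr_opp qr_exp2.
exists mm => // i; have [im [b [ab lt]]] := hm i; split=> //; apply: lt_trans lt.
have e4 : (2 ^- (2 * i) = 4 ^- i :> R)%R by rewrite exprM -natrX.
by rewrite lte_fin qr_add qr_opp qr_exp2 e4; lra.
Qed.

Section levels.
Variable mm : nat -> nat.
Hypothesis comp_mm : computable mm.
Hypothesis mmP : forall i, (i <= mm i)%N /\ (a - 4 ^- i)%:E < \int[nu]_y (s (mm i) y)%:E.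
Variable N : nat -> nat.
Hypothesis comp_N : computable N.
Hypothesis NP : forall i j, (j < mm i + mm i.+1)%N -> (tm j <= N i)%N.

(* [d i] has integral at most [4^-i] and is [F (N i)]-measurable on [KR], so its maximal
   function is a maximum over [n <= N i]; by Doob's inequality, [T i] below, a
   continuous substitute for the indicator of [maximal function > 2^-i], has integral
   at most [2^-i]. *)
Let d i y : R := Num.max 0%R (s (mm i.+1) y - s (mm i) y)%R.

Let d0 i y : (0 <= d i y)%R.
Proof. by rewrite /d le_max lexx. Qed.

(** A known bound makes [mm i.+1 - d i] nonnegative; lower approximations of its integrals give
    upper approximations for [d i], as [rho n x] has mass 1. *)
Let d_le i y : (d i y <= (mm i.+1)%:R)%R.
Proof. by rewrite /d ge_max ler0n; have := s_le (mm i.+1) y; have := s0 (mm i) y; lra. Qed.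

Let d0' i y : 0 <= (d i y)%:E.
Proof. by rewrite lee_fin. Qed.

Let cd0' i y : 0 <= ((mm i.+1)%:R - d i y)%:E.
Proof. by rewrite lee_fin subr_ge0. Qed.

Let md i : measurable_fun setT (d i : borel X -> R).
Proof. by apply: measurable_maxr => //; apply: measurable_funB. Qed.

Let md' i : measurable_fun setT (fun y : borel X => (d i y)%:E).
Proof. exact/measurable_EFinP. Qed.

Let mcd' i : measurable_fun setT (fun y : borel X => ((mm i.+1)%:R - d i y)%:E).
Proof. by apply/measurable_EFinP; apply: measurable_funB. Qed.

Let d_local n i x y : (N i <= n)%N -> atom (F n) x y -> d i y = d i x.
Proof.
move=> Nn axy; rewrite /d !(@s_local n x y) // => j jm; apply: leq_trans (NP _) Nn; lia.
Qed.

Let lsc_d : lsc_on K (fun i y => (d i y)%:E).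
Proof.
apply: (@ce_open_on_ext _ _ _ (fun z y => (qr (unpair z).2 < qr (qnat 0) :> R)%R \/
  exists u v, (qr (qadd (unpair z).2 v) <= qr u :> R)%R /\
   ((qr u < s (mm (unpair z).1.+1) y)%R /\ (s (mm (unpair z).1) y < qr v)%R))).
  move=> z y _; move: (unpair z).1 (unpair z).2 => i k.
  rewrite lte_fin /d lt_max qr_nat; split=> [[->//|[u [v [h1 [h2 h3]]]]]|/orP[|lt]].
  - by apply/orP; right; rewrite qr_add in h1; lra.
  - by left.
  - right; pose e := (s (mm i.+1) y - s (mm i) y - qr k)%R.
    have e0 : (0 < e)%R by rewrite /e; lra.
    have [|v /andP[v1 v2]] := @qr_dense R (s (mm i) y) (s (mm i) y + e / 2); first by lra.
    have [|u /andP[u1 u2]] := @qr_dense R (s (mm i.+1) y - e / 2) (s (mm i.+1) y); first by lra.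
    by exists u, v; rewrite qr_add; split=> //; rewrite /e in v2 u1; lra.
apply: ce_open_on_or; first by sig.
apply: ce_open_on_ex; apply: ce_open_on_ex; apply: ce_open_on_and; first by sig.
apply: ce_open_on_and.
  by apply: (@ce_open_on2 _ _ _ (fun m k y => (qr k < s m y)%R)) lsc_s _ _; comp.
by apply: (@ce_open_on2 _ _ _ (fun m k y => (s m y < qr k)%R)) usc_s _ _; comp.
Qed.

Let usc_d : lsc_on K (fun i y => ((mm i.+1)%:R - d i y)%:E).
Proof.
apply: (@ce_open_on_ext _ _ _ (fun z y => (qr (unpair z).2 < qr (qnat (mm (unpair z).1.+1)) :> R)%R /\
  exists u v, (qr (qadd u (unpair z).2) <= qr (qadd (qnat (mm (unpair z).1.+1)) v) :> R)%R /\
   ((s (mm (unpair z).1.+1) y < qr u)%R /\ (qr v < s (mm (unpair z).1) y)%R))).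
  move=> z y _; move: (unpair z).1 (unpair z).2 => i k.
  rewrite lte_fin ltrBrDl -ltrBrDr /d gt_max qr_nat; split=> [[h0 [u [v [h1 [h2 h3]]]]]|/andP[h0 lt]].
    by rewrite !qr_add qr_nat in h1; apply/andP; split; lra.
  split; first lra.
  pose e := ((mm i.+1)%:R - qr k - (s (mm i.+1) y - s (mm i) y))%R.
  have e0 : (0 < e)%R by rewrite /e; lra.
  have [|v /andP[v1 v2]] := @qr_dense R (s (mm i) y - e / 2) (s (mm i) y); first by lra.
  have [|u /andP[u1 u2]] := @qr_dense R (s (mm i.+1) y) (s (mm i.+1) y + e / 2); first by lra.
  by exists u, v; rewrite !qr_add qr_nat; split=> //; rewrite /e in u2 v1; lra.
apply: ce_open_on_and; first by sig.
apply: ce_open_on_ex; apply: ce_open_on_ex; apply: ce_open_on_and; first by sig.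
apply: ce_open_on_and.
  by apply: (@ce_open_on2 _ _ _ (fun m k y => (s m y < qr k)%R)) usc_s _ _; comp.
by apply: (@ce_open_on2 _ _ _ (fun m k y => (qr k < s m y)%R)) lsc_s _ _; comp.
Qed.

Let e n i x : \bar R := \int[rho n x]_y (d i y)%:E.

Let e0 n i x : 0 <= e n i x.
Proof. exact: integral_ge0. Qed.

Let er n i x : R := fine (e n i x).

Let eE n i x : K x -> e n i x = (er n i x)%:E /\
  \int[rho n x]_y ((mm i.+1)%:R - d i y)%:E = ((mm i.+1)%:R - er n i x)%:E.
Proof.
move=> Kx; have : \int[rho n x]_y (((mm i.+1)%:R - d i y)%:E + (d i y)%:E) = ((mm i.+1)%:R)%:E.
  under eq_integral do rewrite -EFinD subrK.
  rewrite integral_cst //.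
  exact: (eq_trans (congr1 (fun z => _ * z) (disint_setT n Kx)) (mule1 _)).
rewrite (ge0_integralD (rho n x) measurableT (fun y _ => cd0' i y) (mcd' i) (fun y _ => d0' i y) (md' i)).
rewrite -/(e n i x) /er.
have := e0 n i x; have := integral_ge0 (rho n x) (fun y (_ : setT y) => cd0' i y).
case: (\int[rho n x]_y _) => [u||] //; case: (e n i x) => [v||] //=.
by rewrite -EFinD => _ _ [<-]; rewrite addrK.
Qed.

Let er0 n i x : (0 <= er n i x)%R.
Proof. exact: fine_ge0. Qed.

Let lsc_e : ce_open_on K (fun z x => (qr (unpair z).2 < er (unpair (unpair z).1).1 (unpair (unpair z).1).2 x)%R).
Proof.
have := lsc_on_integral mK (fun n x Kx => disint_KRC n Kx) (disint_lsc K) d0' md' lsc_d.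
apply: ce_open_on_ext => z x Kx; have := (eE (unpair (unpair z).1).1 (unpair (unpair z).1).2 Kx).1.
by rewrite /e => ->; rewrite lte_fin.
Qed.

Let usc_e : ce_open_on K (fun z x => (er (unpair (unpair z).1).1 (unpair (unpair z).1).2 x < qr (unpair z).2)%R).
Proof.
have hl := lsc_on_integral mK (fun n x Kx => disint_KRC n Kx) (disint_lsc K) cd0' mcd' usc_d.
have := lsc_on2 hl (a := fun z => (unpair z).1)
  (b := fun z => qadd (qnat (mm (unpair (unpair z).1).2.+1)) (qopp (unpair z).2)) ltac:(comp) ltac:(comp).
apply: ce_open_on_ext => z x Kx; have := (eE (unpair (unpair z).1).1 (unpair (unpair z).1).2 Kx).2.
by move=> ->; rewrite lte_fin qr_add qr_opp qr_nat; split; lra.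
Qed.

Let int_d i : \int[nu]_y (d i y)%:E <= (4 ^- i)%:E.
Proof.
have := (mmP i).2.
have : \int[nu]_y ((d i y)%:E + (s (mm i) y)%:E) <= a%:E.
  rewrite -int_sup_s; apply: ge0_le_integral => //.
  - by move=> y _; apply: adde_ge0 => //; rewrite lee_fin.
  - exact: emeasurable_funD.
  - move=> y _; rewrite -EFinD; have [le|/ltW le] := leP (s (mm i.+1) y) (s (mm i) y).
      by rewrite /d (max_idPl _) ?subr_le0 // add0r.
    by rewrite /d (max_idPr _) ?subr_ge0 // subrK.
have s0' y : 0 <= (s (mm i) y)%:E by rewrite lee_fin.
rewrite (ge0_integralD nu measurableT (fun y _ => d0' i y) (md' i) (fun y _ => s0' y) (ms' (mm i))).
have := integral_ge0 nu (fun y (_ : setT y) => d0' i y).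
case: (\int[nu]_y (d i y)%:E) => [u||] //; case: (\int[nu]_y _) => [v||] //.
by rewrite -EFinD !lee_fin lte_fin; lra.
Qed.

Let integrable_d i : nu.-integrable setT (fun y : borel X => (d i y)%:E).
Proof.
apply/integrableP; split=> //; under eq_integral do rewrite gee0_abs //.
by apply: le_lt_trans (int_d i) _; rewrite ltey.
Qed.

Let mer n i : measurable_fun setT (er n i : borel X -> R).
Proof.
have [hv _ _] := kurtz; have [_ ie _] := hv n _ (integrable_d i).
exact: (measurableT_comp (fine_measurable measurableT) (measurable_int _ ie)).
Qed.

(** Rises from 0 to 1 while the maximum grows from [2^-i] to [2 * 2^-i]; so [T i x < 1] bounds every
    term by [2 * 2^-i]. *)
Let T i x : R := Num.min 1%R (Num.max 0%R (2 ^+ i * \big[Num.max/0%R]_(n < (N i).+1) er n i x - 1)%R).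

Let T01 i x : (0 <= T i x <= 1)%R.
Proof. by rewrite /T le_min ge_min le_max !lexx ler01. Qed.

Let mT i : measurable_fun setT (T i : borel X -> R).
Proof.
apply: measurable_minr => //; apply: measurable_maxr => //; apply: measurable_funB => //.
by apply: measurable_funM => //; exact: (@measurable_bigmax _ (borel X) R (fun n => er n i) _ (fun n => mer n i)).
Qed.

Let pow2 i : (0 < 2 ^+ i :> R)%R.
Proof. exact: exprn_gt0. Qed.

Let T_gtP i x (r : R) : (0 <= r)%R -> (r < T i x)%R <-> (r < 1)%R /\
  exists n, (n < (N i).+1)%N /\ ((r + 1) * 2 ^- i < er n i x)%R.
Proof.
move=> r0; rewrite /T lt_min lt_max [(r < 0)%R]ltNge r0 /= ltrBrDr.
rewrite -ltr_pdivrMl // mulrC.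
split=> [/andP[r1 /bigmax_gtP[|[n _ lt]]]|[r1 [n [nN lt]]]].
- by rewrite ltNge mulr_ge0 // ?addr_ge0 // invr_ge0 ltW.
- by split=> //; exists n.
- by rewrite r1; apply/bigmax_gtP; right; exists (Ordinal nN).
Qed.

Let T_ltP i x (r : R) : (T i x < r)%R <-> (1 < r)%R \/ ((0 < r)%R /\
  forall n, (n < (N i).+1)%N -> (er n i x < (r + 1) * 2 ^- i)%R).
Proof.
rewrite /T gt_min gt_max ltrBlDr -ltr_pdivlMl //.
have -> : ((2 ^+ i)^-1 * (r + 1) = (r + 1) * 2 ^- i)%R by rewrite mulrC.
split=> [/orP[|/andP[r0 /bigmax_ltP[_ hn]]]|[->//|[r0 hn]]]; [by left|right|].
  by split=> // n nN; exact: (hn (Ordinal nN)).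
apply/orP; right; rewrite r0; apply/bigmax_ltP; split=> [|n _]; last exact: hn.
by rewrite mulr_gt0 ?invr_gt0 // addr_gt0.
Qed.

Let lscT : lsc_on K (fun i x => (T i x)%:E).
Proof.
apply: (@ce_open_on_ext _ _ _ (fun z x => (qr (unpair z).2 < qr (qnat 0) :> R)%R \/
  ((qr (unpair z).2 < qr (qnat 1) :> R)%R /\ exists n, ((n < (N (unpair z).1).+1)%N /\
     (qr (qmul (qadd (unpair z).2 (qnat 1)) (qexp2 (unpair z).1)) < er n (unpair z).1 x)%R)))).
  move=> z x Kx; move: (unpair z).1 (unpair z).2 => i k; rewrite lte_fin qr_nat.
  have e1 : qr (qmul (qadd k (qnat 1)) (qexp2 i)) = ((qr k + 1) * 2 ^- i)%R :> R.
    by rewrite qr_mul qr_add qr_nat qr_exp2.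
  have [k0|k0] := ltP (qr k : R) 0%R.
    split=> _; last by left.
    by apply: lt_le_trans k0 _; case/andP: (T01 i x).
  rewrite T_gtP // qr_nat; split=> [[lt|[h1 [n]]]|[h1 [n]]]; first by exfalso; move: k0; rewrite leNgt => /negP; apply.
    by rewrite e1 => hn; split=> //; exists n.
  by right; split=> //; exists n; rewrite e1.
apply: ce_open_on_or; first by sig.
apply: ce_open_on_and; first by sig.
apply: ce_open_on_ex; apply: ce_open_on_and; first by sig.
apply: ce_open_on_ext (ce_open_on_comp lsc_e (f := fun z => cpair (cpair (unpair z).2 (unpair (unpair z).1).1)
  (qmul (qadd (unpair (unpair z).1).2 (qnat 1)) (qexp2 (unpair (unpair z).1).1))) ltac:(comp)) => z x _.
by rewrite !unpairK.
Qed.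

Let uscT : lsc_on K (fun i x => (1 - T i x)%:E).
Proof.
apply: (@ce_open_on_ext _ _ _ (fun z x => (qr (unpair z).2 < qr (qnat 0) :> R)%R \/
  ((qr (unpair z).2 < qr (qnat 1) :> R)%R /\ forall n, (n < (N (unpair z).1).+1)%N ->
     (er n (unpair z).1 x < qr (qmul (qadd (qnat 2) (qopp (unpair z).2)) (qexp2 (unpair z).1)))%R))).
  move=> z x Kx; move: (unpair z).1 (unpair z).2 => i k; rewrite lte_fin ltrBrDl -ltrBrDr T_ltP !qr_nat.
  have e1 : qr (qmul (qadd (qnat 2) (qopp k)) (qexp2 i)) = ((1 - qr k + 1) * 2 ^- i)%R :> R.
    by rewrite qr_mul qr_add qr_nat qr_exp2 qr_opp; congr (_ * _)%R; lra.
  by rewrite e1; split=> -[h1|[h1 h2]]; [left; lra|right; split=> //; lra|left; lra|right; split=> //; lra].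
apply: ce_open_on_or; first by sig.
apply: ce_open_on_and; first by sig.
apply: (@ce_open_on_all _ _ _ (fun z n x => (er n (unpair z).1 x < qr (qmul (qadd (qnat 2) (qopp (unpair z).2)) (qexp2 (unpair z).1)))%R)); last by comp.
apply: ce_open_on_ext (ce_open_on_comp usc_e (f := fun z => cpair (cpair (unpair z).2 (unpair (unpair z).1).1)
  (qmul (qadd (qnat 2) (qopp (unpair (unpair z).1).2)) (qexp2 (unpair (unpair z).1).1))) ltac:(comp)) => z x _.
by rewrite !unpairK.
Qed.

Let intT i : \int[nu]_x (T i x)%:E <= (2 ^- i)%:E.
Proof.
have [hv _ _] := kurtz.
pose H : set (borel X) := [set x | exists n, (n < (N i).+1)%N /\ (2 ^- i)%:E < e n i x].
have mH : measurable H.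
  rewrite (_ : H = \bigcup_(n in `I_(N i).+1) [set x | (2 ^- i)%:E < e n i x]).
    apply: bigcup_measurable => n _; rewrite -[X in measurable X]setTI.
    apply: emeasurable_fun_o_infty => //.
    by have [_ ie _] := hv n _ (integrable_d i); exact: measurable_int ie.
  by apply/seteqP; split=> x [n]; [move=> []|]; exists n.
have hd := doob_maximal sF mF ndF1 (d0' i) (md' i) (fun n => hv n _ (integrable_d i)) (N i).+1
  (_ : 0 < 2 ^- i)%R.
have h1 : \int[nu]_x (T i x)%:E <= nu H.
  rewrite -[H in nu H]setIT -integral_indic //; apply: ge0_le_integral => //.
  - by move=> x _; rewrite lee_fin; case/andP: (T01 i x).
  - exact/measurable_EFinP.
  - by apply/measurable_EFinP; exact: measurable_indic.
  - move=> x _; rewrite lee_fin indicE; case: (boolP (x \in H)) => [_|/negP nH].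
      by case/andP: (T01 i x).
    rewrite leNgt; apply/negP => /T_gtP[//|_ [n [nN]]]; rewrite add0r mul1r => lt.
    apply: nH; rewrite inE; exists n; split=> //; move: lt; rewrite /er.
    case: (e n i x) => [u||] /=; [by rewrite lte_fin|by rewrite ltey|].
    by rewrite ltNge invr_ge0 ltW.
apply: le_trans h1 _.
have : (2 ^- i)%:E * nu H <= (4 ^- i)%:E.
  by apply: le_trans (int_d i); apply: hd; rewrite invr_gt0.
have : nu H \is a fin_num by exact: fin_num_measure.
case: (nu H) => // u _; rewrite -EFinM !lee_fin.
have -> : (4 ^- i = 2 ^- i * 2 ^- i :> R)%R by rewrite -invfM -exprMn; congr (_ ^- _)%R; rewrite -natrM.
by rewrite ler_pM2l ?invr_gt0.
Qed.

(** From [N i] on, [d i] is constant on the atom of [x], which carries [rho n x]. *)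
Let e_local n i x : K x -> (N i <= n)%N -> e n i x = (d i x)%:E.
Proof.
move=> Kx Nn; rewrite -[RHS]mule1 -(disint_setT n Kx) -integral_cst //.
apply: (ge0_eq_integral_on (mS n x) (disint_atomC n Kx) (d0' i) (md' i)
  (fun _ => d0' i x) (measurable_cst _)).
by move=> y [ay _]; rewrite (d_local Nn ay).
Qed.

Let tail x : SR nu x -> exists i0, forall i, (i0 <= i)%N -> forall n, e n i x <= (2 * 2 ^- i)%:E.
Proof.
move=> SRx; have Kx := SR_KR comp_nu SRx.
have [i0 hi0] := schnorr_eventually comp_nu mK nuKC T01 mT lscT uscT intT SRx Kx.
exists i0 => i /hi0 /T_ltP[|[_ hn] n]; first by rewrite ltxx.
have [nN|Nn] := leqP n (N i).
  by rewrite (eE n i Kx).1 lee_fin ltW // (_ : 2 = 1 + 1)%R // hn.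
rewrite (e_local Kx (ltnW Nn)) -(e_local Kx (leqnn _)) (eE (N i) i Kx).1.
by rewrite lee_fin ltW // (_ : 2 = 1 + 1)%R // hn.
Qed.

Let remainder j y : \bar R := sup_s y - (s (mm j) y)%:E.

Let remainder0 j y : 0 <= remainder j y.
Proof. by rewrite sube_ge0 //; exact: s_le_sup. Qed.

Let m_remainder j : measurable_fun setT (remainder j : borel X -> \bar R).
Proof. exact: emeasurable_funB. Qed.

Let int_remainder x : SR nu x -> exists i0, forall j, (i0 <= j)%N -> forall n,
  \int[rho n x]_y remainder j y <= (4 * 2 ^- j)%:E.
Proof.
move=> SRx; have [i0 hi0] := tail SRx; exists i0 => j ij n.
(* Telescoping: [s (mm L) - s (mm j)] is at most the sum of the [d i], [j <= i < L]. *)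
pose u L y : \bar R := (Num.max 0 (s (mm L) y - s (mm j) y))%:E.
have u_le L y : (j <= L)%N -> u L y <= \sum_(j <= i < L) (d i y)%:E.
  elim: L => [|L IH]; first by rewrite leqn0 => /eqP j0; rewrite /u j0 big_geq // subrr maxxx.
  rewrite leq_eqVlt => /orP[/eqP <-|]; first by rewrite big_geq // /u subrr maxxx.
  rewrite ltnS => jL; rewrite big_nat_recr //=; apply: le_trans (leeD (IH jL) (lexx _)).
  rewrite /u /d -EFinD lee_fin ge_max; apply/andP; split.
    by apply: addr_ge0; rewrite le_max lexx.
  have h1 : (s (mm L) y - s (mm j) y <= Num.max 0 (s (mm L) y - s (mm j) y))%R by rewrite le_max lexx orbT.
  have h2 : (s (mm L.+1) y - s (mm L) y <= Num.max 0 (s (mm L.+1) y - s (mm L) y))%R by rewrite le_max lexx orbT.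
  lra.
have u0 L y : 0 <= u L y by rewrite lee_fin le_max lexx.
have mu_ L : measurable_fun setT (u L : borel X -> \bar R).
  by apply/measurable_EFinP; apply: measurable_maxr => //; apply: measurable_funB.
apply: (@integral_lim_le _ (borel X) R (rho n x) u _ j) => //.
  move=> y.
  have h1 : (s (mm L) y)%:E @[L --> \oo] --> sup_s y.
    (* As [L <= mm L], the value [s (mm L)] lies between [s L] and the supremum. *)
    apply: (@squeeze_cvge _ _ _ _ (fun L => (s L y)%:E) _ (fun=> sup_s y)); last 2 first.
    - exact: s_cvg.
    - exact: cvg_cst.
    - by apply: nearW => L; rewrite lee_fin s_mono ?s_le_sup //; exact: (mmP L).1.
  have h2 : (s (mm L) y)%:E - (s (mm j) y)%:E @[L --> \oo] --> remainder j y.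
    apply: cvgeB; [|exact: h1|exact: cvg_cst].
    by first [apply: fin_num_adde_defl | apply: fin_num_adde_defr].
  apply: cvg_trans h2; apply: near_eq_cvg.
  near=> L; rewrite /u -EFinB; congr EFin; apply/esym/max_idPr.
  rewrite subr_ge0; apply: s_mono.
  apply: (@leq_trans L); last exact: (mmP L).1.
  by near: L; exact: nbhs_infty_ge.
move=> L jL.
apply: (@le_trans _ _ (\sum_(j <= i < L) e n i x)).
  rewrite /e -(ge0_integral_sum (rho n x) measurableT (fun i => md' i) (fun i y _ => d0' i y)).
  apply: ge0_le_integral => //.
  - by apply: emeasurable_sum => i _; exact: md'.
  - by move=> y _; exact: u_le.
(* The exact sum of the bounds [2 * 2^-i]; the subtracted term carries the induction on [L]. *)
suff : \sum_(j <= i < L) e n i x <= (4 * 2 ^- j - 4 * 2 ^- L)%:E.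
  move=> /le_trans; apply; rewrite lee_fin gerBl mulr_ge0 // invr_ge0 ltW //.
elim: L jL => [|L IH]; first by rewrite leqn0 => /eqP ->; rewrite big_geq // subrr.
rewrite leq_eqVlt => /orP[/eqP <-|]; first by rewrite big_geq // subrr.
rewrite ltnS => jL; rewrite big_nat_recr //=.
apply: (le_trans (leeD (IH jL) (hi0 L (leq_trans ij jL) n))).
rewrite -EFinD lee_fin exprS invfM.
have := pow2 L; rewrite -(invr_gt0 (2 ^+ L)); lra.
Unshelve. all: by end_near. Qed.

Lemma simple_approximation_levels x (eps : R) : SR nu x -> (0 < eps)%R ->
  exists (v : X -> R) (r : X -> \bar R) n0,
  [/\ forall y, (0 <= v y)%R /\ 0 <= r y, measurable_fun setT (r : borel X -> \bar R),
      forall y, K y -> (v y)%:E <= g y <= (v y)%:E + r y &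
      forall n, (n0 <= n)%N -> (forall y, atom (F n) x y -> v y = v x) /\
        \int[rho n x]_y r y <= eps%:E].
Proof.
move=> SRx eps0; have [i0 hi0] := int_remainder SRx.
have [k hk] := @exp2_small R (eps / 4) ltac:(rewrite divr_gt0 //).
(* [j >= i0] bounds the integral of the remainder by [4 * 2^-j], and [j >= k] makes this less than
   [eps]. *)
pose j := maxn i0 k.
exists (s (mm j)), (remainder j), (N j); split=> // [y Ky|n Nn].
  rewrite s_le_g //= /remainder sup_s_g // addeC subeK //.
split; first by move=> y ay; apply: (s_local _ ay) => i im; apply: leq_trans (NP _) Nn; lia.
apply: le_trans (hi0 j _ n) _; first exact: leq_maxl.
rewrite lee_fin; apply: (@le_trans _ _ (4 * 2 ^- k)%R); last lra.
rewrite ler_pM2l // lef_pV2 ?posrE // ler_weXn2l ?ler1n // leq_maxr //.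
Qed.

End levels.

Lemma simple_approximation_from_codes x (eps : R) : SR nu x -> (0 < eps)%R ->
  exists (v : X -> R) (r : X -> \bar R) n0,
  [/\ forall y, (0 <= v y)%R /\ 0 <= r y, measurable_fun setT (r : borel X -> \bar R),
      forall y, K y -> (v y)%:E <= g y <= (v y)%:E + r y &
      forall n, (n0 <= n)%N -> (forall y, atom (F n) x y -> v y = v x) /\
        \int[rho n x]_y r y <= eps%:E].
Proof.
have [mm cmm mmP] := select.
(* [mm i + mm i.+1] is a common bound for the indices in both simple functions that make up
   [d i]. *)
have [||N cN NP] := @comp_search (fun i n => all (fun j => tm j <= n)%N (iota 0 (mm i + mm i.+1))).
- by rewrite /tm /I; comp.
- move=> i; exists (\max_(j < mm i + mm i.+1) tm j)%N; apply/allsP => j jm.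
  exact: (leq_bigmax (Ordinal jm)).
by apply: (simple_approximation_levels cmm mmP cN) => i; exact/allsP/NP.
Qed.

End approximation.

(** For late [n] the measure [rho n x] sees [g] as the constant [v x], up to an error with integral
    at most [eps]. *)
Lemma simple_approximation (g : X -> \bar R) x (eps : R) : (forall y, 0 <= g y) -> lsc g ->
  computable_ereal (\int[nu]_y (g : borel X -> \bar R) y) ->
  SR nu x -> (0 < eps)%R ->
  exists (v : X -> R) (r : X -> \bar R) n0,
  [/\ forall y, (0 <= v y)%R /\ 0 <= r y, measurable_fun setT (r : borel X -> \bar R),
      forall y, K y -> (v y)%:E <= g y <= (v y)%:E + r y &
      forall n, (n0 <= n)%N -> (forall y, atom (F n) x y -> v y = v x) /\
        \int[rho n x]_y r y <= eps%:E].
Proof.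
move=> g0 lg [a ca ia]; have [h ch hh] := lg.
have [D hD DE] := ce_pred2 ce_pred_enumerated (comp_comp comp_gg (comp_comp ch (comp_fst comp_id))) (comp_snd comp_id).
exact: (simple_approximation_from_codes g0 lg ia ca hh hD DE).
Qed.

End levy.

(** * Powers with a computable exponent *)

Section powers.
Context {R : realType}.
Implicit Types (r u v p : R).

Lemma powR_lt_mono r u v : 0 < r -> 0 <= u -> 0 <= v -> (u `^ r < v `^ r) = (u < v).
Proof.
move=> r0 u0 v0; apply/idP/idP; last by apply: gt0_ltr_powR; rewrite ?nnegrE.
by apply: contraLR; rewrite -!leNgt => vu; apply: ge0_ler_powR; rewrite ?nnegrE // ltW.
Qed.

Lemma powR_invK r u : 0 < r -> 0 <= u -> (u `^ r^-1) `^ r = u.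
Proof. by move=> r0 u0; rewrite -powRrM mulVf ?gt_eqF // powRr1. Qed.

(** Both cuts of [b ^ r], uniformly in the rational [b >= 0]. In this form the property passes to
    [r^-1]: the base and the bound exchange their roles, and the cuts with them. *)
Definition pow_cuts r :=
  ce_pred (fun z => 0 <= (qr (unpair z).1 : R) /\ qr (unpair z).2 < qr (unpair z).1 `^ r) /\
  ce_pred (fun z => 0 <= (qr (unpair z).1 : R) /\ qr (unpair z).1 `^ r < qr (unpair z).2).

Lemma pow_cuts_inv r : 0 < r -> pow_cuts r -> pow_cuts r^-1.
Proof.
move=> r0 [hl hu]; split.
  apply: (@ce_pred_ext (fun z => (qr (qnat 0) <= qr (unpair z).1 :> R) /\
    ((qr (unpair z).2 < qr (qnat 0) :> R) \/
     0 <= (qr (unpair z).2 : R) /\ (qr (unpair z).2 : R) `^ r < qr (unpair z).1))).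
    move=> z; move: (unpair z).1 (unpair z).2 => b k; rewrite !qr_nat.
    split=> -[b0 h]; split=> //.
      case: h => [k0|[k0 h]]; first exact: lt_le_trans (powR_ge0 _ _).
      by rewrite -(powR_lt_mono r0) ?powR_ge0 // powR_invK.
    have [k0|k0] := ltP (qr k : R) 0; [by left|right; split=> //].
    by rewrite -(powR_lt_mono r0) ?powR_ge0 // powR_invK in h.
  apply: ce_pred_and; first by apply: ce_pred_dec; comp.
  apply: ce_pred_or; first by apply: ce_pred_dec; comp.
  by apply: (@ce_pred2 (fun b k => 0 <= (qr b : R) /\ (qr b : R) `^ r < qr k)) => //; comp.
apply: (@ce_pred_ext (fun z => (qr (qnat 0) <= qr (unpair z).1 :> R) /\
  (0 <= (qr (unpair z).2 : R) /\ (qr (unpair z).1 < (qr (unpair z).2 : R) `^ r)))).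
  move=> z; move: (unpair z).1 (unpair z).2 => b k; rewrite !qr_nat.
  split=> -[b0 h]; split=> //.
    by case: h => k0 h; rewrite -(powR_lt_mono r0) ?powR_ge0 // powR_invK.
  have k0 : 0 <= (qr k : R) by apply: le_trans (ltW h); exact: powR_ge0.
  by split=> //; rewrite -(powR_lt_mono r0) ?powR_ge0 // powR_invK in h.
apply: ce_pred_and; first by apply: ce_pred_dec; comp.
by apply: (@ce_pred2 (fun b k => 0 <= (qr b : R) /\ qr k < (qr b : R) `^ r)) => //; comp.
Qed.

(* Compares [l] with [p * L] through rationals [m / n] on the appropriate side of [p]. *)
Lemma lt_mul_rat p (L l : R) : 0 < p -> l < p * L <->
  exists m n : nat, [/\ (0 < n)%N, n%:R * l < m%:R * L &
    (0 <= L) && (m%:R < p * n%:R) || (L <= 0) && (p * n%:R < m%:R)].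
Proof.
move=> p0; split; last first.
  move=> [m [n [n0 lt h]]]; have n0' : 0 < n%:R :> R by rewrite ltr0n.
  rewrite -(ltr_pM2l n0'); apply: lt_le_trans lt _; rewrite mulrA [n%:R * p]mulrC.
  by case/orP: h => /andP[L0 /ltW h]; [rewrite ler_wpM2r|rewrite ler_wnM2r].
have frac (x y : R) : 0 <= x -> x < y -> exists m n : nat, (0 < n)%N /\ x * n%:R < m%:R < y * n%:R.
  move=> x0 /(posrat_dense x0)[k]; rewrite posrat_qr qr_code // subr0 => h.
  exists (unpair k).1.+1, (unpair k).2.+1; split=> //.
  by move: h; rewrite ltr_pdivlMr ?ltr0n // ltr_pdivrMr ?ltr0n.
move=> lt; have [L0|L0|L0] := ltgtP L 0.
- have [||m [n [n0 /andP[h1 h2]]]] := frac p (l / L); first exact: ltW.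
    by rewrite ltr_ndivlMr.
  exists m, n; split=> //.
  by move: h2; rewrite -(ltr_nM2r L0) mulrAC divfK ?lt_eqF // mulrC.
- have [||m [n [n0 /andP[h1 h2]]]] := frac (Num.max 0 (l / L)) p; first by rewrite le_max lexx.
    by rewrite gt_max p0 ltr_pdivrMr.
  exists m, n; split; rewrite ?h2 //.
  have : l / L * n%:R < m%:R.
    by apply: le_lt_trans h1; rewrite ler_wpM2r // le_max lexx orbT.
  by rewrite mulrAC ltr_pdivrMr // mulrC.
- exists 0%N, 1%N; split; rewrite ?mulr1 ?p0 //.
  by move: lt; rewrite L0 !mulr0 mul1r.
Qed.

Definition qpow (b m : nat) : nat := iteri m (fun _ k => qmul b k) (qnat 1).

Lemma qr_pow b m : qr (qpow b m) = qr b ^+ m :> R.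
Proof. by elim: m => [|m IH]; rewrite /qpow /= ?qr_nat // qr_mul -/(qpow b m) IH exprS. Qed.

Lemma comp_qpow f g : computable f -> computable g -> computable (fun z => qpow (f z) (g z)).
Proof. by move=> cf cg; apply: comp_iteri; comp. Qed.

Lemma ln_lt_exp (q b : R) (m n : nat) : 0 < q -> 0 < b ->
  (n%:R * ln q < m%:R * ln b) = (q ^+ n < b ^+ m).
Proof.
move=> q0 b0; rewrite !mulr_natl -!lnXn // ltr_ln ?posrE ?exprn_gt0 //.
Qed.

Lemma ln_sign (b : R) : 0 < b -> (0 <= ln b) = (1 <= b) /\ (ln b <= 0) = (b <= 1).
Proof. by move=> b0; rewrite -ln1 !ler_ln ?posrE. Qed.

(** By logarithms and [lt_mul_rat], [k < b ^ p] iff [k ^ n < b ^ m] for some [m / n] below [p] if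
    [b >= 1], or above [p] if [b <= 1]; only integer powers of rationals remain. Bases and bounds
    without a logarithm are treated apart. *)
Lemma pow_cuts_computable p : computable_real p -> 0 < p -> pow_cuts p.
Proof.
move=> /computable_reals_cuts[cu cl] p0.
have cu' f : computable f -> ce_pred (fun z => p < qr (f z)).
  by move=> cf; apply: (@ce_pred2 (fun _ k => p < qr k) (fun=> 0%N)) => //; comp.
have cl' f : computable f -> ce_pred (fun z => qr (f z) < p).
  by move=> cf; apply: (@ce_pred2 (fun _ k => qr k < p) (fun=> 0%N)) => //; comp.
have cpow f g : computable f -> computable g -> computable (fun z => qpow (f z) (g z)) := @comp_qpow f g.
have qmn (m n : nat) : (0 < n)%N -> qr (qcode m 0 n) = m%:R / n%:R :> R by move=> n0; rewrite qr_code // subr0.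
have lnpow (b : R) : 0 < b -> ln (b `^ p) = p * ln b by move=> _; exact: ln_powR.
have cq m n : computable m -> computable n -> computable (fun z => qcode (m z) 0 (n z)).
  by move=> cm cn; rewrite /qcode; comp.
split.
- apply: (@ce_pred_ext (fun z => (qr (qnat 0) <= qr (unpair z).1 :> R) /\
   ((qr (unpair z).2 < qr (qnat 0) :> R) \/ ((qr (qnat 0) < qr (unpair z).1 :> R) /\
     ((qr (unpair z).2 <= qr (qnat 0) :> R) \/ exists m, exists n,
      ((0 < n)%N && (qr (qpow (unpair z).2 n) < qr (qpow (unpair z).1 m) :> R)) /\
      ((qr (qnat 1) <= qr (unpair z).1 :> R) /\ (qr (qcode m 0 n) < p) \/
       (qr (unpair z).1 <= qr (qnat 1) :> R) /\ (p < qr (qcode m 0 n)))))))).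
    move=> z; move: (unpair z).1 (unpair z).2 => b k; rewrite !qr_nat.
    split=> -[b0 h]; split=> //.
      case: h => [k0|[b0' [k0|[m [n [/andP[n0]]]]]]]; first exact: lt_le_trans (powR_ge0 _ _).
        by apply: le_lt_trans k0 _; exact: powR_gt0.
      rewrite !qr_pow qmn // ltr_pdivrMr ?ltr0n // ltr_pdivlMr ?ltr0n // => lt h.
      have [k0|k0] := leP (qr k : R) 0; first by apply: le_lt_trans k0 _; exact: powR_gt0.
      rewrite -ltr_ln ?posrE ?powR_gt0 // lnpow //; apply/(lt_mul_rat _ _ p0).
      exists m, n; rewrite n0 ln_lt_exp // lt !(ln_sign b0').1 !(ln_sign b0').2; split=> //.
      by case: h => -[-> ->]; rewrite ?orbT.
    have [k0|k0] := ltP (qr k : R) 0; [by left|right].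
    have b0' : 0 < (qr b : R).
      rewrite lt_neqAle b0 andbT; apply/eqP => e; move: h; rewrite -e powR0 ?gt_eqF //.
      by rewrite ltNge k0.
    split=> //; have [k0'|k0'] := leP (qr k : R) 0; [by left|right].
    move: h; rewrite -ltr_ln ?posrE ?powR_gt0 // lnpow // => /(lt_mul_rat _ _ p0)[m [n [n0]]].
    rewrite ln_lt_exp // !(ln_sign b0').1 !(ln_sign b0').2 => lt h; exists m, n.
    rewrite n0 !qr_pow lt qmn // ltr_pdivrMr ?ltr0n // ltr_pdivlMr ?ltr0n //; split=> //.
    by case/orP: h => /andP[-> ->]; [left|right].
  apply: ce_pred_and; first by apply: ce_pred_dec; comp.
  apply: ce_pred_or; first by apply: ce_pred_dec; comp.
  apply: ce_pred_and; first by apply: ce_pred_dec; comp.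
  apply: ce_pred_or; first by apply: ce_pred_dec; comp.
  apply: ce_pred_ex; apply: ce_pred_ex; apply: ce_pred_and.
    by apply: ce_pred_dec; apply: dec_and; [comp|apply: dec_qlt; apply: cpow; comp].
  apply: ce_pred_or; apply: ce_pred_and; try by apply: ce_pred_dec; comp.
    by apply: cl'; apply: cq; comp.
  by apply: cu'; apply: cq; comp.
- apply: (@ce_pred_ext (fun z => (qr (qnat 0) <= qr (unpair z).1 :> R) /\
   ((qr (qnat 0) < qr (unpair z).2 :> R) /\ ((qr (unpair z).1 <= qr (qnat 0) :> R) \/ exists m, exists n,
      ((0 < n)%N && (qr (qpow (unpair z).1 m) < qr (qpow (unpair z).2 n) :> R)) /\
      ((qr (unpair z).1 <= qr (qnat 1) :> R) /\ (qr (qcode m 0 n) < p) \/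
       (qr (qnat 1) <= qr (unpair z).1 :> R) /\ (p < qr (qcode m 0 n))))))).
    move=> z; move: (unpair z).1 (unpair z).2 => b k; rewrite !qr_nat.
    (* [lt_mul_rat] bounds a product from below only; for the upper cut both logarithms are negated,
       which exchanges the cases [b <= 1] and [b >= 1]. *)
    have lnE : 0 < (qr b : R) -> 0 < (qr k : R) -> ((qr b : R) `^ p < qr k) = (- ln (qr k) < p * - ln (qr b : R)).
      by move=> b0 k0; rewrite mulrN ltrN2 -lnpow // ltr_ln ?posrE ?powR_gt0.
    have expE m n : 0 < (qr b : R) -> 0 < (qr k : R) ->
        (n%:R * - ln (qr k) < m%:R * - ln (qr b) :> R) = ((qr b : R) ^+ m < qr k ^+ n).
      by move=> b0 k0; rewrite !mulrN ltrN2 ln_lt_exp.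
    split=> -[b0 h]; split=> //.
      case: h => [k0 [b0'|[m [n [/andP[n0]]]]]].
        have -> : (qr b : R) = 0 by apply/eqP; rewrite eq_le b0'.
        by rewrite powR0 ?gt_eqF.
      rewrite !qr_pow qmn // ltr_pdivrMr ?ltr0n // ltr_pdivlMr ?ltr0n // => lt h.
      have [b0'|b0'] := leP (qr b : R) 0.
        have -> : (qr b : R) = 0 by apply/eqP; rewrite eq_le b0'.
        by rewrite powR0 ?gt_eqF.
      rewrite lnE //; apply/(lt_mul_rat _ _ p0); exists m, n.
      rewrite n0 expE // lt oppr_ge0 oppr_le0 !(ln_sign b0').1 !(ln_sign b0').2; split=> //.
      by case: h => -[-> ->]; rewrite ?orbT.
    have k0 : 0 < (qr k : R) by apply: le_lt_trans h; exact: powR_ge0.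
    split=> //; have [b0'|b0'] := leP (qr b : R) 0; [by left|right].
    move: h; rewrite lnE // => /(lt_mul_rat _ _ p0)[m [n [n0]]].
    rewrite expE // oppr_ge0 oppr_le0 !(ln_sign b0').1 !(ln_sign b0').2 => lt h; exists m, n.
    rewrite n0 !qr_pow lt qmn // ltr_pdivrMr ?ltr0n // ltr_pdivlMr ?ltr0n //; split=> //.
    by case/orP: h => /andP[-> ->]; [left|right].
  apply: ce_pred_and; first by apply: ce_pred_dec; comp.
  apply: ce_pred_and; first by apply: ce_pred_dec; comp.
  apply: ce_pred_or; first by apply: ce_pred_dec; comp.
  apply: ce_pred_ex; apply: ce_pred_ex; apply: ce_pred_and.
    by apply: ce_pred_dec; apply: dec_and; [comp|apply: dec_qlt; apply: cpow; comp].
  apply: ce_pred_or; apply: ce_pred_and; try by apply: ce_pred_dec; comp.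
    by apply: cl'; apply: cq; comp.
  by apply: cu'; apply: cq; comp.
Qed.

Local Open Scope ereal_scope.

Lemma lte_poweR r (q : R) (u : \bar R) : (0 < r)%R -> 0 <= u ->
  q%:E < u `^ r <-> (q < 0)%R \/ exists b, ((0 <= (qr b : R)) /\ (q < qr b `^ r))%R /\ (qr b)%:E < u.
Proof.
move=> r0 u0; split; last first.
  move=> [q0|[b [[b0 qb] bu]]].
    by apply: (@lt_le_trans _ _ 0); [rewrite lte_fin|exact: poweR_ge0].
  apply: (@lt_le_trans _ _ ((qr b `^ r)%:E)); first by rewrite lte_fin.
  rewrite -poweR_EFin; apply: gt0_ler_poweR; first exact: ltW; rewrite ?in_itv /= ?lee_fin ?leey ?b0 ?u0 //; exact: ltW.
move=> qu; have [q0|q0] := ltP q 0%R; [by left|right].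
have [b /andP[b1 b2]] : exists b : nat, (q `^ r^-1)%:E < (qr b)%:E < u.
  case: u u0 qu => [u|_ _|//].
    rewrite poweR_EFin lee_fin lte_fin => u0 qu.
    have /qr_dense[b hb] : (q `^ r^-1 < u)%R by rewrite -(powR_lt_mono r0) ?powR_ge0 // powR_invK.
    by exists b; rewrite !lte_fin.
  have /qr_dense[b /andP[hb _]] : (q `^ r^-1 < q `^ r^-1 + 1)%R by rewrite ltrDl.
  by exists b; rewrite lte_fin hb ltey.
rewrite lte_fin in b1.
have b0 : (0 <= qr b :> R)%R by apply: le_trans (ltW b1); exact: powR_ge0.
exists b; split=> //; split=> //.
by move: b1; rewrite -(powR_lt_mono r0 (powR_ge0 _ _) b0) powR_invK.
Qed.

(** The base is real while [pow_cuts] speaks of rational bases: a rational between [a] and the root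
    of the bound mediates. *)
Lemma computable_powR r (a : R) : (0 < r)%R -> pow_cuts r -> (0 <= a)%R ->
  computable_real a -> computable_real (a `^ r).
Proof.
move=> r0 [hl hu] a0 /computable_reals_cuts[cu cl].
apply: cuts_computable_reals.
  apply: (@ce_pred_ext (fun z => exists b,
     ((0 <= (qr b : R)) /\ (qr b `^ r < qr (unpair z).2))%R /\ (a < qr b)%R)).
    move=> z; move: (unpair z).2 => k; split.
      move=> [b [[b0 h] ab]]; apply: lt_trans h.
      by rewrite powR_lt_mono.
    move=> h; have k0 : (0 <= qr k :> R)%R by apply: le_trans (ltW h); exact: powR_ge0.
    have /qr_dense[b /andP[h1 h2]] : (a < qr k `^ r^-1)%R.
      by rewrite -(powR_lt_mono r0) ?powR_ge0 // powR_invK.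
    have b0 : (0 <= qr b :> R)%R by apply: le_trans (ltW h1).
    exists b; split=> //; split=> //.
    by move: h2; rewrite -(powR_lt_mono r0 b0 (powR_ge0 _ _)) powR_invK.
  apply: ce_pred_ex; apply: ce_pred_and.
    by apply: (@ce_pred2 (fun b k => (0 <= (qr b : R) /\ (qr b : R) `^ r < qr k)%R)) => //; comp.
  by apply: (@ce_pred2 (fun _ k => (a < qr k)%R) (fun=> 0%N)) => //; comp.
apply: (@ce_pred_ext (fun z => (qr (unpair z).2 < qr (qnat 0) :> R)%R \/ exists b,
   ((0 <= (qr b : R)) /\ (qr (unpair z).2 < qr b `^ r))%R /\ (qr b < a)%R)).
  move=> z; have e := @lte_poweR r (qr (unpair z).2) a%:E r0 ltac:(by rewrite lee_fin).
  rewrite poweR_EFin lte_fin in e; rewrite qr_nat.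
  by split=> [[h|[b [h1 h2]]]|/e[h|[b [h1 h2]]]]; [apply/e; left|apply/e; right; exists b|left|right; exists b].
apply: ce_pred_or; first by apply: ce_pred_dec; comp.
apply: ce_pred_ex; apply: ce_pred_and.
  by apply: (@ce_pred2 (fun b k => (0 <= (qr b : R) /\ qr k < (qr b : R) `^ r)%R)) => //; comp.
by apply: (@ce_pred2 (fun _ k => (qr k < a)%R) (fun=> 0%N)) => //; comp.
Qed.

Lemma lsc_poweR (X : computablePolishType R) r (f : X -> \bar R) : (0 < r)%R -> pow_cuts r ->
  (forall x, 0 <= f x) -> lsc f -> lsc (fun x => f x `^ r).
Proof.
move=> r0 [hl _] f0 /lsc_on_lsc lf; apply/lsc_on_lsc.
apply: (@ce_open_on_ext _ _ _ (fun z x => (qr (unpair z).2 < qr (qnat 0) :> R)%R \/ exists b,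
   ((0 <= (qr b : R)) /\ (qr (unpair z).2 < qr b `^ r))%R /\ (qr b)%:E < f x)).
  by move=> z x _; rewrite lte_poweR // qr_nat.
apply: ce_open_on_or; first by sig.
apply: ce_open_on_ex; apply: ce_open_on_and.
  apply: ce_open_on_cep.
  by apply: (@ce_pred2 (fun b k => (0 <= (qr b : R) /\ qr k < (qr b : R) `^ r)%R)) => //; comp.
by apply: (lsc_on2 lf (a := fun=> 0%N)); comp.
Qed.

(* From [u^p - v^p >= (u - v) u^(p-1)] for [u >= v]. *)
Lemma poweR_le_add (p v w : R) (u s : \bar R) (eps : R) : (1 <= p)%R -> (0 < eps)%R ->
  (0 <= v)%R -> 0 <= u -> 0 <= s -> u `^ p <= (v `^ p)%:E + s ->
  u <= (v + eps)%:E + ((eps `^ (p - 1))^-1)%:E * s.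
Proof.
move=> p1 e0 v0 u0 s0 h; have p0 : (0 < p)%R by lra.
have C0 : (0 < eps `^ (p - 1))%R by exact: powR_gt0.
case: s s0 h => [s|_ _|//]; last by rewrite gt0_muley ?lte_fin ?invr_gt0 // addey // leey.
rewrite lee_fin => s0; case: u u0 => [u|_|//]; last by rewrite poweRyr ?gt_eqF.
rewrite lee_fin => u0; rewrite poweR_EFin -EFinD -EFinM -EFinD !lee_fin => h.
have [uv|uv] := leP u (v + eps)%R.
  by apply: le_trans uv _; rewrite lerDl mulr_ge0 // invr_ge0 ltW.
rewrite -lerBlDl (le_trans (_ : _ <= u - v)%R) //; first by lra.
rewrite mulrC ler_pdivlMr //.
have h1 : (v `^ p <= v * u `^ (p - 1))%R.
  rewrite -mulr_powRB1 // ler_wpM2l //; apply: ge0_ler_powR; rewrite ?nnegrE //; lra.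
have h2 : (u `^ p = u * u `^ (p - 1))%R by rewrite mulr_powRB1.
have h3 : (eps `^ (p - 1) <= u `^ (p - 1))%R.
  by apply: ge0_ler_powR; rewrite ?nnegrE //; lra.
have h4 : ((u - v) * eps `^ (p - 1) <= (u - v) * u `^ (p - 1))%R by rewrite ler_wpM2l //; lra.
have h5 : ((u - v) * u `^ (p - 1) = u `^ p - v * u `^ (p - 1))%R by rewrite mulrBl h2.
by lra.
Qed.

End powers.

(** * The equivalence *)

Section convergence.
Context {R : realType} {X : computablePolishType R} (nu : probability (borel X) R).
Variables (F : nat -> set_system X) (rho : nat -> R.-ftker borel X ~> borel X).
Hypothesis comp_nu : computable_measure nu.
Hypothesis filt : almost_full_effective_filtration nu F.
Hypothesis kurtz : uniform_kurtz_disintegrations nu F rho.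
Local Open Scope ereal_scope.

Lemma schnorr_test1_indic e : computable_ereal (nu (ce_open e)) ->
  schnorr_test nu 1 (fun y : X => (\1_(ce_open e) y)%:E).
Proof.
move=> ce; split; first by move=> y; rewrite lee_fin.
  apply/lsc_on_lsc; apply: (@ce_open_on_ext _ _ _ (fun z y => (qr (unpair z).2 < qr (qnat 0) :> R)%R \/
    ((qr (unpair z).2 < qr (qnat 1) :> R)%R /\ ce_open e y))).
    move=> z y _; rewrite lte_fin indicE !qr_nat; case: (boolP (y \in _)) => ye; split.
    - by move=> [h|[h _]] //; apply: lt_trans h _; exact: ltr01.
    - by move=> h; right; split=> //; rewrite inE in ye.
    - by move=> [//|[_ h]]; move: ye; rewrite mem_set.
    - by left.
  apply: ce_open_on_or; first by sig.
  by apply: ce_open_on_and; [sig|apply: ce_open_on_ce_open; comp].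
rewrite Lnorm1; under eq_integral do rewrite gee0_abs ?lee_fin //.
rewrite integral_indic ?setIT //; exact: measurable_ce_open.
Qed.

Lemma computable_real1 : computable_real (1 : R).
Proof.
exists (fun=> qnat 1) => [|n k]; first by comp.
by rewrite -/(qr (qnat 1)) qr_nat subrr normr0 invr_ge0 exprn_ge0.
Qed.

Lemma SR_convergence (p : R) x (f : X -> \bar R) : computable_real p -> (1 <= p)%R ->
  SR nu x -> schnorr_test nu p f ->
  f x \is a fin_num /\ disint_exp (rho n) f x @[n --> \oo] --> f x.
Proof.
move=> cp p1 SRx [f0 lf [c cc cE]].
have p0 : (0 < p)%R by apply: lt_le_trans p1.
have Kx := SR_KR comp_nu SRx.
have cutp := pow_cuts_computable cp p0.
pose g y := f y `^ p.
have g0 y : 0 <= g y by exact: poweR_ge0.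
have lg : lsc g := lsc_poweR p0 cutp f0 lf.
have mf := lsc_measurable lf.
have c0 : (0 <= c)%R by rewrite -lee_fin -cE Lnorm_ge0.
have ig : computable_ereal (\int[nu]_y (g : borel X -> \bar R) y).
  exists (c `^ p)%R; first exact: computable_powR.
  rewrite -poweR_EFin -cE poweR_Lnorm ?gt_eqF //.
  by apply: eq_integral => y _; rewrite gee0_abs.
have [ndF [B [t [basisB ct FE [gg cgg ggE]]]]] := filt.
have lower q : q%:E < f x -> exists n0, forall n, (n0 <= n)%N -> q%:E <= disint_exp (rho n) f x.
  exact: (disint_exp_lsc_ge kurtz ndF basisB FE ggE).
have upper (eps : R) : (0 < eps)%R -> exists V : R, [/\ (0 <= V)%R, V%:E <= f x &
    exists n0, forall n, (n0 <= n)%N -> disint_exp (rho n) f x <= (V + 2 * eps)%:E].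
  (* The tolerance [eps ^ p] for [g] turns into [eps] for [f], since [poweR_le_add] divides it by
     [eps ^ (p - 1)]; the second [eps] is the additive one of that lemma. *)
  move=> e0; have [v [r [n0 [vr mr vg hn]]]] :=
    simple_approximation comp_nu kurtz ndF basisB ct FE cgg ggE g0 lg ig SRx (powR_gt0 p e0).
  have v0 y : (0 <= v y)%R := (vr y).1.
  have r0 y : 0 <= r y := (vr y).2.
  pose V := (v x `^ p^-1)%R.
  have VE : (V `^ p = v x)%R by rewrite /V powR_invK.
  have V0 : (0 <= V)%R by exact: powR_ge0.
  exists V; split=> //.
    have := vg x Kx; rewrite /g => /andP[+ _]; case: (f x) (f0 x) => [u| |] //; last by move=> _ _; exact: leey.
    rewrite poweR_EFin !lee_fin -VE => u0; rewrite leNgt => h; rewrite leNgt.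
    by apply: contra h; rewrite powR_lt_mono.
  exists n0 => n /hn[vloc rint].
  pose C := ((eps `^ (p - 1))^-1)%R.
  have C0 : (0 < C)%R by rewrite invr_gt0 powR_gt0.
  have CE : (C * eps `^ p = eps)%R.
    have -> : (eps `^ p = eps * eps `^ (p - 1))%R by rewrite mulr_powRB1 // ltW.
    by rewrite /C mulrCA mulVf ?mulr1 // gt_eqF // powR_gt0.
  have mCr : measurable_fun setT (fun y : borel X => C%:E * r y) by exact: measurable_funeM.
  have Cr0 y : 0 <= C%:E * r y by rewrite mule_ge0 // lee_fin ltW.
  have Ve0 (y : borel X) : 0 <= (cst (V + eps)%:E) y by rewrite /= lee_fin; lra.
  have mV : measurable_fun setT (cst (V + eps)%:E : borel X -> \bar R) by exact: measurable_cst.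
  apply: (@le_trans _ _ (\int[rho n x]_y ((V + eps)%:E + C%:E * r y))).
    have mS : measurable ((atom (F n) x : set (borel X)) `&` KR nu).
      by apply: measurableI; [exact: (measurable_atom basisB FE)|exact: measurable_KR].
    apply: (ge0_le_integral_on mS (disint_atomC kurtz basisB FE n Kx)) => //.
    - by move=> y; exact: adde_ge0 (Ve0 y) (Cr0 y).
    - exact: (emeasurable_funD mV mCr).
    - move=> y [ay Ky]; apply: poweR_le_add => //.
      by rewrite VE -(vloc y ay); case/andP: (vg y Ky).
  rewrite (ge0_integralD (rho n x) measurableT (fun y _ => Ve0 y) mV (fun y _ => Cr0 y) mCr).
  rewrite (ge0_integralZl_EFin (rho n x) measurableT (fun y _ => r0 y) mr (ltW C0)) integral_cst //.
  apply: (@le_trans _ _ ((V + eps)%:E + (C * eps `^ p)%:E)); last first.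
    by rewrite CE -EFinD lee_fin; lra.
  apply: leeD; last by rewrite EFinM lee_pmul2l // lte_fin.
  rewrite -[leRHS]mule1; apply: lee_wpmul2l; first by rewrite lee_fin addr_ge0 // ltW.
  have e1 := disint_setT kurtz n Kx.
  by apply: (le_trans (y := rho n x setT)) => //; rewrite e1.
(* This also proves that [f x] is finite: a real strictly between an eventual upper bound and [f x]
   would be an eventual lower bound. *)
have fle (eps V : R) n0 : (forall n, (n0 <= n)%N -> disint_exp (rho n) f x <= (V + 2 * eps)%:E) ->
    f x <= (V + 2 * eps)%:E.
  move=> h; rewrite leNgt; apply/negP => lt.
  have [q /andP[q1 q2]] : exists q : R, ((V + 2 * eps)%:E < q%:E < f x).
    case: (f x) lt => [u| |] //; last by move=> _; exists (V + 2 * eps + 1)%R; rewrite lte_fin ltey andbT; lra.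
    by rewrite lte_fin => /qr_dense[k hk]; exists (qr k); rewrite !lte_fin.
  have [n1 hn1] := lower q q2.
  have := le_trans (hn1 (maxn n0 n1) (leq_maxr _ _)) (h _ (leq_maxl _ _)).
  by rewrite leNgt q1.
have [u fu] : exists u : R, f x = u%:E.
  have [V [_ _ [n0 hn0]]] := upper 1%R ltr01.
  have := fle _ _ _ hn0; case: (f x) (f0 x) => [u||] //; first by exists u.
rewrite fu; split=> //; apply/fine_cvgP; split.
  have [V [_ _ [n0 hn0]]] := upper 1%R ltr01.
  exists n0 => // n /= nn; rewrite ge0_fin_numE; last exact: integral_ge0.
  by apply: le_lt_trans (hn0 n nn) _; rewrite ltey.
apply/cvgrPdist_le => d d0.
have [V [V0 Vf [n0 hn0]]] := upper (d / 2)%R ltac:(rewrite divr_gt0 //).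
have [|n1 hn1] := lower (u - d)%R; first by rewrite fu lte_fin; lra.
exists (maxn n0 n1) => // n /=; rewrite geq_max => /andP[h0 h1].
have := hn0 n h0; have := hn1 n h1; move: Vf; rewrite fu lee_fin => Vu.
case: (disint_exp (rho n) f x) => [w||] //=; rewrite !lee_fin => w1 w2.
by rewrite ler_norml; lra.
Qed.

Lemma convergence_SR (p : R) x : computable_real p -> (1 <= p)%R -> KR nu x ->
  (forall f, schnorr_test nu p f -> exists l : R, disint_exp (rho n) f x @[n --> \oo] --> l%:E) ->
  SR nu x.
Proof.
move=> cp p1 Kx hconv g [g0 lg [c cc cE]].
have p0 : (0 < p)%R by apply: lt_le_trans p1.
have ip0 : (0 < p^-1)%R by rewrite invr_gt0.
have cutp := pow_cuts_inv p0 (pow_cuts_computable cp p0).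
have [ndF [B [t [basisB ct FE [gg cgg ggE]]]]] := filt.
rewrite ltNge leye_eq; apply/negP => /eqP gx.
pose f y := g y `^ p^-1.
have f0 y : 0 <= f y by exact: poweR_ge0.
have lf : lsc f := lsc_poweR ip0 cutp g0 lg.
have [|l fl] := hconv f.
  split=> //; exists (c `^ p^-1)%R.
    by apply: computable_powR => //; rewrite -lee_fin -cE Lnorm_ge0.
  rewrite -poweR_EFin -cE Lnorm1 unlock; congr (_ `^ _); apply: eq_integral => y _.
  by rewrite !gee0_abs // /f -poweRrM mulVf ?gt_eqF // poweRe1.
have [|n0 hn0] := disint_exp_lsc_ge kurtz ndF basisB FE ggE (f := f) (x := x) (q := (l + 1)%R) Kx lf f0.
  by rewrite /f gx poweRyr ?gt_eqF // ltey.
have : (l + 1)%:E <= l%:E.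
  by apply: (cvge_to_ge fl); exists n0.
by rewrite lee_fin; lra.
Qed.

End convergence.

Theorem theorem1p5 (R : realType) (X : computablePolishType R)
    (nu : probability (borel X) R) (F : nat -> set_system X)
    (rho : nat -> R.-ftker borel X ~> borel X) (p : R) :
  computable_measure nu ->
  almost_full_effective_filtration nu F ->
  uniform_kurtz_disintegrations nu F rho ->
  computable_real p -> 1 <= p ->
  forall x : X,
  let converges (f : X -> \bar R) :=
    exists l : R, disint_exp (rho n) f x @[n --> \oo] --> l%:E in
  let converges_to_value (f : X -> \bar R) :=
    f x \is a fin_num /\ disint_exp (rho n) f x @[n --> \oo] --> f x in
  [<-> SR nu x;
       KR nu x /\ (forall f, schnorr_test nu p f -> converges_to_value f);
       [/\ KR nu x,
           forall f, schnorr_test nu p f -> converges f &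
           forall e, computable_ereal (nu (ce_open e)) ->
             converges_to_value (fun y => (\1_(ce_open e) y)%:E)];
       KR nu x /\ (forall f, schnorr_test nu p f -> converges f)].
Proof.
move=> comp_nu filt kurtz cp p1 x converges converges_to_value.
have value_conv f : converges_to_value f -> converges f.
  by move=> [fin h]; exists (fine (f x)); rewrite fineK.
split; first by move=> SRx; split; [exact: SR_KR|move=> f tf; exact: (SR_convergence comp_nu filt kurtz cp p1 SRx tf)].
split.
  move=> [Kx h]; have hc f tf := value_conv f (h f tf).
  split=> // e /schnorr_test1_indic te; have SRx := convergence_SR filt kurtz cp p1 Kx hc.
  exact: (SR_convergence comp_nu filt kurtz (@computable_real1 R) (lexx 1) SRx te).
split; first by move=> [].
by move=> [Kx hc]; exact: (convergence_SR filt kurtz cp p1 Kx hc).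
Qed.
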